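(* Let $\Gamma(z)=D$ for all $z\in\mathbb{C}^n$, where $D\in\mathbb{C}^n$, and let $U$ be a holomorphic function on $\mathbb{C}^n$ such that $C_{U,\Gamma}$ is bounded on $F_\psi^2$. Then the weighted composition operator $C_{U,\Gamma}$ is self-adjoint if and only if $$U(z)=\alpha K_{\Gamma(0),\psi}(z)\quad\text{for all } z\in\mathbb{C}^n,$$ where $\alpha=c_{n-1}\overline{U(0)}$ is a real number.
   Context: Let $n\ge 1$. On $\mathbb{C}^n$ write $\langle w,z\rangle=\sum_{j=1}^n w_j\overline{z_j}$ and $|w|^2=\langle w,w\rangle$. Weight: $\psi:[0,\infty)\to[0,\infty)$ is a $C^3$ function with $\psi'(y)>0$, $\psi''(y)\ge 0$, $\psi'''(y)\ge 0$ for all $y\ge 0$. Moreover there is a real number $l<\tfrac12$ such that, with $\phi(y)=y\psi'(y)$, $\phi''(y)=O\big(y^{-1/2}[\phi'(y)]^{1+l}\big)$ as $y\to\infty$; when $n>1$ it is also assumed that $\psi''(y)=O\big(y^{-1/2}[\psi'(y)]^{1+l}\big)$ as $y\to\infty$. Put $c_r=\int_0^\infty s^re^{-\psi(s)}\,ds$ for $r\ge 0$. Space: $F_\psi^2$ is the Hilbert space of holomorphic functions $g:\mathbb{C}^n\to\mathbb{C}$ with $\int_{\mathbb{C}^n}|g(z)|^2e^{-\psi(|z|^2)}\,d\mu(z)<\infty$, with inner product $\langle g,h\rangle_\psi=\int_{\mathbb{C}^n} g(z)\overline{h(z)}e^{-\psi(|z|^2)}\,d\mu(z)$, where $\mu$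 is $\frac{(n-1)!}{\pi^n}$ times standard Lebesgue measure on $\mathbb{C}^n$. Its reproducing kernel at $p\in\mathbb{C}^n$ (so $f(p)=\langle f,K_{p,\psi}\rangle_\psi$ for all $f\in F_\psi^2$) is $$K_{p,\psi}(z)=\frac{1}{(n-1)!}\sum_{r=n-1}^\infty\frac{r(r-1)\cdots(r-n+2)}{c_r}\langle z,p\rangle^{r-n+1}$$ (the product in the numerator is $1$ when $n=1$). For holomorphic $U:\mathbb{C}^n\to\mathbb{C}$ and $\Gamma:\mathbb{C}^n\to\mathbb{C}^n$, the weighted composition operator is $C_{U,\Gamma}f=U\cdot(f\circ\Gamma)$. ''Bounded on $F_\psi^2$'' means that the operator maps $F_\psi^2$ into itself and is a bounded linear operator. *)

(* Defs.v *)
From HB Require Import structures.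
From mathcomp Require Import all_boot all_order all_algebra.
From mathcomp Require Import complex.
From mathcomp Require Import all_classical all_reals all_analysis.

Set Implicit Arguments.
Unset Strict Implicit.
Unset Printing Implicit Defensive.

Import Order.TTheory GRing.Theory Num.Theory.
Import numFieldNormedType.Exports.

Local Open Scope classical_set_scope.
Local Open Scope ring_scope.

(* R[i] gets the norm topology that any numFieldType K carries through K^o; in
   particular [differentiable] over R[i] is complex differentiability. *)
HB.instance Definition _ (R : realType) := PseudoPointedMetric.copy R[i] R[i]^o.
HB.instance Definition _ (R : realType) := NormedModule.copy R[i] R[i]^o.

(* An alias of the product measure: for [mu \x nu] itself the library's
   sigma-finite instance is shadowed by the subprobability one and cannot be
   inferred. *)
Section sigma_finite_product.
Local Open Scope ereal_scope.
Context d1 d2 (T1 : measurableType d1) (T2 : measurableType d2) (R : realType).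
Variables (mu : {sigma_finite_measure set T1 -> \bar R})
          (nu : {sigma_finite_measure set T2 -> \bar R}).

Definition prodm : set (T1 * T2) -> \bar R := mu \x nu.

HB.instance Definition _ := Measure.on prodm.

Let prodm_sigma_finite : sigma_finite setT prodm.
Proof.
have /sigma_finiteP[F [TF ndF Foo]] := sigma_finiteT mu.
have /sigma_finiteP[G [TG ndG Goo]] := sigma_finiteT nu.
exists (fun n => F n `*` G n).
  rewrite -setXTT TF TG predeqE => -[x y]; split.
    move=> [/= [n _ Fnx] [k _ Gky]]; exists (maxn n k) => //; split.
    - by move: x Fnx; exact/subsetPset/ndF/leq_maxl.
    - by move: y Gky; exact/subsetPset/ndG/leq_maxr.
  by move=> [n _ []/= ? ?]; split; exists n.
move=> k; have [? ?] := Foo k; have [? ?] := Goo k.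
split; first exact: measurableX.
by rewrite /prodm product_measure1E// lte_mul_pinfty// ge0_fin_numE.
Qed.

HB.instance Definition _ := Measure_isSigmaFinite.Build _ _ _ prodm
  prodm_sigma_finite.

End sigma_finite_product.

Section power_measure.
Context d (T : measurableType d) (R : realType).
Variable mu : {sigma_finite_measure set T -> \bar R}.

Definition tcons n (x : T * n.-tuple T) : n.+1.-tuple T := [tuple of x.1 :: x.2].

Definition tuncons n (t : n.+1.-tuple T) : T * n.-tuple T :=
  (thead t, [tuple of behead t]).

Lemma tconsK n : cancel (@tcons n) (@tuncons n).
Proof.
by case=> x t; rewrite /tuncons /tcons /= theadE; congr pair; apply: val_inj.
Qed.

Lemma measurable_tcons n : measurable_fun [set: T * n.-tuple T] (@tcons n).
Proof. exact: (@measurable_cons _ _ (T * n.-tuple T)%type T fst n snd). Qed.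

Lemma measurable_tuncons n : measurable_fun [set: n.+1.-tuple T] (@tuncons n).
Proof.
apply: measurable_fun_pair => /=; first exact: measurable_tnth.
exact: measurable_behead.
Qed.

Section step.
Variables (n : nat) (nu : {sigma_finite_measure set (n.-tuple T) -> \bar R}).

Definition consm : set (n.+1.-tuple T) -> \bar R :=
  pushforward (prodm mu nu) (@tcons n).

Let mpre (A : set (n.+1.-tuple T)) :
  measurable A -> measurable (@tcons n @^-1` A).
Proof.
by move=> mA; rewrite -[X in measurable X]setTI; exact: measurable_tcons.
Qed.

Let consm0 : consm set0 = 0%E.
Proof. by rewrite /consm /pushforward preimage_set0 measure0. Qed.

Let consm_ge0 A : (0 <= consm A)%E.
Proof. by rewrite /consm /pushforward measure_ge0. Qed.

Let consm_sigma_additive : semi_sigma_additive consm.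
Proof.
move=> F mF tF mUF; rewrite /consm /pushforward preimage_bigcup.
apply: measure_semi_sigma_additive.
- by move=> k; exact: mpre.
- apply/trivIsetP => /= i j _ _ ij; rewrite -preimage_setI.
  by move/trivIsetP : tF => /(_ _ _ _ _ ij) ->//; rewrite preimage_set0.
- by rewrite -preimage_bigcup; exact: mpre.
Qed.

HB.instance Definition _ := isMeasure.Build _ _ _ consm
  consm0 consm_ge0 consm_sigma_additive.

Let consm_sigma_finite : sigma_finite setT consm.
Proof.
have [F UF mF] := sigma_finiteT (prodm mu nu).
exists (fun k => @tuncons n @^-1` F k).
  by rewrite -preimage_bigcup -UF preimage_setT.
move=> k; have [mFk Fk] := mF k; split.
  by rewrite -[X in measurable X]setTI; exact: measurable_tuncons.
rewrite /consm /pushforward (_ : _ @^-1` _ = F k)//.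
by apply/seteqP; split => x /=; rewrite tconsK.
Qed.

HB.instance Definition _ := Measure_isSigmaFinite.Build _ _ _ consm
  consm_sigma_finite.

End step.

Fixpoint power_measure n : {sigma_finite_measure set (n.-tuple T) -> \bar R} :=
  if n is m.+1 then consm (power_measure m) else \d_[tuple].

End power_measure.

(* [=O_] needs a bundled filter. *)
Definition at_pinfty (R : realType) : filter_on R :=
  FilterType (pinfty_nbhs R) _.

Section weight.
Variable R : realType.

(* Derivative on the half-line [0, +oo[: one-sided at 0, two-sided elsewhere;
   only its values at nonnegative points are meaningful. *)
Definition halfline_quotient (f : R -> R) (y : R) :=
  (fun h => h^-1 * (f (y + h) - f y)) @ within [set h | 0 <= y + h] 0^'.

Definition dhalf (f : R -> R) (y : R) : R := lim (halfline_quotient f y).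

Definition C3_halfline (f : R -> R) :=
  (forall k (y : R), (k < 3)%N -> 0 <= y -> cvg (halfline_quotient (iter k dhalf f) y))
  /\ {within `[0, +oo[, continuous (iter 3 dhalf f)}.

Definition admissible_weight (n : nat) (psi : R -> R) :=
  let psi1 := dhalf psi in
  let psi2 := dhalf psi1 in
  let psi3 := dhalf psi2 in
  let phi := fun y => y * psi1 y in
  let phi1 := dhalf phi in
  let phi2 := dhalf phi1 in
  [/\ forall y : R, 0 <= y -> 0 <= psi y,
      C3_halfline psi,
      forall y : R, 0 <= y -> [/\ 0 < psi1 y, 0 <= psi2 y & 0 <= psi3 y] &
      exists2 l : R, l < 2^-1 &
        phi2 =O_ (at_pinfty R) (fun y => y `^ (- 2^-1) * phi1 y `^ (1 + l)) /\
        ((1 < n)%N ->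
         psi2 =O_ (at_pinfty R) (fun y => y `^ (- 2^-1) * psi1 y `^ (1 + l)))].

Definition cmoment (psi : R -> R) (r : nat) : R :=
  \int[lebesgue_measure]_(s in `[0, +oo[) (s ^+ r * expR (- psi s)).

End weight.

Section Fock_space.
Variables (R : realType) (n : nat).
Local Notation C := R[i].
Local Notation Cn := 'rV[R[i]]_n.
Local Notation RR := (measurableTypeR R * measurableTypeR R)%type.

Definition holomorphic (V : normedModType C) (f : Cn -> V) :=
  forall z, differentiable f z.

Definition cdot (w z : Cn) : C := \sum_j w 0 j * (z 0 j)^*.

Definition normsq (z : Cn) : R := complex.Re (cdot z z).

(* C^n is parametrized by the n-tuples of pairs (real part, imaginary part), on
   which the library has a product sigma-algebra; an integral over C^n is
   written as an integral over these tuples. *)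
Definition Cn_of (t : n.-tuple RR) : Cn :=
  \row_j Complex (tnth t j).1 (tnth t j).2.

Definition lebesgueC : {sigma_finite_measure set (n.-tuple RR) -> \bar R} :=
  power_measure (prodm lebesgue_measure lebesgue_measure) n.

Lemma mu_factor_ge0 : 0 <= (n.-1)`!%:R / pi ^+ n :> R.
Proof. by rewrite divr_ge0// exprn_ge0// pi_ge0. Qed.

Definition muC : {measure set (n.-tuple RR) -> \bar R} :=
  mscale (NngNum mu_factor_ge0) lebesgueC.

Definition Cintegral (F : Cn -> C) : C :=
  Complex (\int[muC]_t complex.Re (F (Cn_of t)))
          (\int[muC]_t complex.Im (F (Cn_of t))).

Variable psi : R -> R.

Definition weight (z : Cn) : R := expR (- psi (normsq z)).

Definition Fock (g : Cn -> C) :=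
  holomorphic g /\
  (\int[muC]_t (ComplexField.Normc.normc (g (Cn_of t)) ^+ 2 * weight (Cn_of t))%:E
     < +oo)%E.

Definition Fock_inner (g h : Cn -> C) : C :=
  Cintegral (fun z => g z * (h z)^* * (weight z)%:C%C).

Definition Fock_norm (g : Cn -> C) : R :=
  Num.sqrt (complex.Re (Fock_inner g g)).

(* The summation starts at r = n - 1, so the truncated subtraction r - (n - 1)
   is exact, and the falling factorial r ^_ (n - 1) is the product
   r (r - 1) ... (r - n + 2). *)
Definition Fock_kernel (p z : Cn) : C :=
  ((n.-1)`!)%:R^-1 *
  limn (fun N => \sum_(n.-1 <= r < N)
     (r ^_ n.-1)%:R / (cmoment psi r)%:C%C * cdot z p ^+ (r - n.-1)).

Definition wcomp (U : Cn -> C) (Gamma : Cn -> Cn) (f : Cn -> C) : Cn -> C :=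
  fun z => U z * f (Gamma z).

Definition bounded_on_Fock (A : (Cn -> C) -> (Cn -> C)) :=
  [/\ forall f, Fock f -> Fock (A f),
      forall (a : C) f g, Fock f -> Fock g ->
        A (fun z => a * f z + g z) = (fun z => a * A f z + A g z) &
      exists M : R, forall f, Fock f -> Fock_norm (A f) <= M * Fock_norm f].

Definition Fock_adjoint (A B : (Cn -> C) -> (Cn -> C)) :=
  (forall g, Fock g -> Fock (B g)) /\
  (forall f g, Fock f -> Fock g -> Fock_inner (A f) g = Fock_inner f (B g)).

Definition Fock_self_adjoint (A : (Cn -> C) -> (Cn -> C)) := Fock_adjoint A A.

End Fock_space.

(* Main.v *)
Require Import Defs.
From HB Require Import structures.
From mathcomp Require Import all_boot all_order all_algebra.
From mathcomp Require Import complex.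
From mathcomp Require Import all_classical all_reals all_analysis.
From mathcomp Require Import measurable_realfun.
From mathcomp Require Import ring lra.

Set Implicit Arguments.
Unset Strict Implicit.
Unset Printing Implicit Defensive.

Import Order.TTheory GRing.Theory Num.Theory.
Import numFieldNormedType.Exports.

Local Open Scope classical_set_scope.
Local Open Scope ring_scope.

(* For Gamma = D constant, A f = f(D) U. If A is self-adjoint, testing the
   identity on the constants gives alpha = <U, 1> with alpha real, and testing it
   on f(z) = <z, p>^m against 1 gives <U, <., p>^m> = alpha <p, D>^m. On the other
   side, averaging over rotations shows that <f, <., p>^m> is the m-th Taylor
   coefficient of l |-> f(l p) divided by the m-th kernel coefficient, for every f
   in the Fock space. Summing the Taylor series of U at l = 1 yields U = alpha K_D.

   Conversely let U = alpha K_D with alpha real and nonzero, so that K_D is in the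
   Fock space. The partial sums of K_D converge to K_D pointwise, because the
   moments c_r grow faster than every T^r, and then in norm by orthogonality of the
   monomials and Fatou's lemma; the same Taylor expansion then gives
   <f, K_D> = f(D), whence <A f, g> = alpha f(D) conj(g(D)) = <f, A g>. *)

(** Holomorphic means complex differentiable, so the Taylor expansion is built from that alone.
    Goursat's lemma on rectangles is carried to circles by the exponential: circles around 0 lift to
    vertical segments of a strip with period [2 pi i], and the vanishing of the integral along a
    rectangle one period high says that the Fourier coefficients of [g] on the circle through [l]
    scale like [l ^+ m], with none of negative order. These are the coefficients that rotation
    averages produce, so the pairing with a monomial and the Taylor series at [l = 1] meet directly.
    Changes of variables are handled in the same elementary way. Rotations are products of three
    shears, and a shear preserves Lebesgue measure by Fubini and translation invariance. The area of
    a disc is linear in its squared radius, which gives polar coordinates in the plane; the radial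
    variables of several planes merge through Beta integrals. This produces the factor
    [m! / (m + n)!] in dimension [n.+1], which cancels against the binomial coefficient hidden in
    the kernel. *)

Local Notation Re := complex.Re.
Local Notation Im := complex.Im.
Local Notation normc := ComplexField.Normc.normc.

(** * Complex-valued integrals *)

Section complex_numbers.
Variable R : realType.
Implicit Types (x y z : R[i]) (a b : R).

Lemma ReD x y : Re (x + y) = Re x + Re y. Proof. by case: x y => ? ? []. Qed.
Lemma ImD x y : Im (x + y) = Im x + Im y. Proof. by case: x y => ? ? []. Qed.
Lemma ReN x : Re (- x) = - Re x. Proof. by case: x. Qed.
Lemma ImN x : Im (- x) = - Im x. Proof. by case: x. Qed.
Lemma ReM x y : Re (x * y) = Re x * Re y - Im x * Im y.
Proof. by case: x y => ? ? []. Qed.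
Lemma ImM x y : Im (x * y) = Re x * Im y + Im x * Re y.
Proof.
case: x y => ? ? [? ?] /=.
by rewrite addrC [X in X + _]mulrC [X in _ + X]mulrC addrC mulrC [X in _ + X]mulrC.
Qed.
Lemma Re_conj x : Re x^* = Re x. Proof. by case: x. Qed.
Lemma Im_conj x : Im x^* = - Im x. Proof. by case: x. Qed.

Lemma complex_eqP x y : Re x = Re y -> Im x = Im y -> x = y.
Proof. by case: x y => ? ? [? ?] /= -> ->. Qed.

Lemma normc_def' x : normc x = Num.sqrt (Re x ^+ 2 + Im x ^+ 2).
Proof. by case: x. Qed.

Lemma normc_ge0 x : 0 <= normc x.
Proof. by rewrite normc_def' sqrtr_ge0. Qed.

Lemma sqr_normcE x : normc x ^+ 2 = Re x ^+ 2 + Im x ^+ 2.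
Proof. by rewrite normc_def' sqr_sqrtr// addr_ge0 ?sqr_ge0. Qed.

Lemma normc_Re_le x : `|Re x| <= normc x.
Proof. by rewrite normc_def' -sqrtr_sqr ler_sqrt ?addr_ge0 ?sqr_ge0// lerDl sqr_ge0. Qed.

Lemma normc_Im_le x : `|Im x| <= normc x.
Proof. by rewrite normc_def' -sqrtr_sqr ler_sqrt ?addr_ge0 ?sqr_ge0// lerDr sqr_ge0. Qed.

Lemma normc_le_ReIm x : normc x <= `|Re x| + `|Im x|.
Proof.
rewrite -(ler_pXn2r (n := 2)) ?nnegrE ?normc_ge0 ?addr_ge0//.
rewrite sqr_normcE sqrrD !real_normK ?num_real//.
by rewrite addrAC lerDl mulrn_wge0// mulr_ge0.
Qed.

Lemma normcM x y : normc (x * y) = normc x * normc y.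
Proof. exact: ComplexField.Normc.normcM. Qed.

Lemma ler_normcD x y : normc (x + y) <= normc x + normc y.
Proof. exact: le_normcD. Qed.

Lemma normcN x : normc (- x) = normc x.
Proof. by rewrite !normc_def' ReN ImN !sqrrN. Qed.

Lemma normc_conj x : normc x^* = normc x.
Proof. by rewrite !normc_def' Re_conj Im_conj !sqrrN. Qed.

Lemma normcB x y : normc (x - y) = normc (y - x).
Proof. by rewrite -normcN opprB. Qed.

Lemma ler_normcB x y : normc (x - y) <= normc x + normc y.
Proof. by rewrite (le_trans (ler_normcD _ _))// normcN. Qed.

Lemma dist_normc x y : `|normc x - normc y| <= normc (x - y).
Proof.
rewrite ler_norml; have := ler_normcD (x - y) y; rewrite subrK.
by have := ler_normcD (y - x) x; rewrite subrK normcB; lra.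
Qed.

Lemma normc0 : normc (0 : R[i]) = 0.
Proof. exact: ComplexField.Normc.normc0. Qed.

Lemma normc1 : normc (1 : R[i]) = 1.
Proof. exact: ComplexField.Normc.normc1. Qed.

Lemma normc_eq0 x : (normc x == 0) = (x == 0).
Proof.
apply/eqP/eqP => [|->]; last exact: normc0.
exact: ComplexField.Normc.eq0_normc.
Qed.

Lemma normc_gt0 x : (0 < normc x) = (x != 0).
Proof. by rewrite lt_def normc_ge0 andbT normc_eq0. Qed.

Lemma normcX x n : normc (x ^+ n) = normc x ^+ n.
Proof. by elim: n => [|n ih]; rewrite ?expr0 ?normc1// !exprS normcM ih. Qed.

Lemma normcV x : normc x^-1 = (normc x)^-1.
Proof. exact: ComplexField.Normc.normcV. Qed.

Lemma normc_real a : normc (a%:C)%C = `|a|.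
Proof. by rewrite normc_def'/= expr0n addr0 sqrtr_sqr. Qed.

Lemma conj_real a : (a%:C)%C^* = (a%:C)%C :> R[i].
Proof. by apply: complex_eqP; rewrite ?Re_conj ?Im_conj//= oppr0. Qed.

Lemma mulJc x : x * x^* = ((normc x ^+ 2)%:C)%C.
Proof.
apply: complex_eqP; rewrite /= ?ReM ?ImM Re_conj Im_conj ?sqr_normcE.
  by rewrite mulrN opprK !expr2.
by rewrite mulrN addrC mulrC subrr.
Qed.

Lemma Re_realM a x : Re ((a%:C)%C * x) = a * Re x.
Proof. by rewrite ReM/= mul0r subr0. Qed.

Lemma Im_realM a x : Im ((a%:C)%C * x) = a * Im x.
Proof. by rewrite ImM/= mul0r addr0. Qed.

Lemma normc_norm x : ((normc x)%:C)%C = `|x| :> R[i].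
Proof. by rewrite normc_def normc_def'. Qed.

End complex_numbers.

Section complex_integral.
Context d (T : measurableType d) (R : realType).
Variable mu : {measure set T -> \bar R}.
Implicit Types (D : set T) (f g : T -> R[i]).

Definition cmeasurable D f :=
  measurable_fun D (fun x => Re (f x)) /\ measurable_fun D (fun x => Im (f x)).

Definition cintegrable D f :=
  mu.-integrable D (EFin \o (fun x => Re (f x))) /\
  mu.-integrable D (EFin \o (fun x => Im (f x))).

Definition cint D f : R[i] :=
  Complex (\int[mu]_(x in D) Re (f x)) (\int[mu]_(x in D) Im (f x)).

Lemma cmeasurable_cst D (c : R[i]) : cmeasurable D (fun=> c).
Proof. by split; exact: measurable_cst. Qed.

Lemma cmeasurableD D f g : cmeasurable D f -> cmeasurable D g ->
  cmeasurable D (fun x => f x + g x).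
Proof.
move=> [f1 f2] [g1 g2]; split.
  by under eq_fun do rewrite ReD; exact: measurable_funD.
by under eq_fun do rewrite ImD; exact: measurable_funD.
Qed.

Lemma cmeasurableM D f g : cmeasurable D f -> cmeasurable D g ->
  cmeasurable D (fun x => f x * g x).
Proof.
move=> [f1 f2] [g1 g2]; split.
  under eq_fun do rewrite ReM.
  by apply: measurable_funB; exact: measurable_funM.
under eq_fun do rewrite ImM.
by apply: measurable_funD; exact: measurable_funM.
Qed.

Lemma cmeasurable_conj D f : cmeasurable D f -> cmeasurable D (fun x => (f x)^*).
Proof.
move=> [f1 f2]; split.
  by under eq_fun do rewrite Re_conj.
by under eq_fun do rewrite Im_conj; exact: measurableT_comp.
Qed.

Lemma cmeasurableX D f n : cmeasurable D f -> cmeasurable D (fun x => f x ^+ n).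
Proof.
move=> mf; elim: n => [|n ih]; first exact: cmeasurable_cst.
by under eq_fun do rewrite exprS; exact: cmeasurableM.
Qed.

Lemma cmeasurable_sum D I (r : seq I) (F : I -> T -> R[i]) :
  (forall i, cmeasurable D (F i)) -> cmeasurable D (fun x => \sum_(i <- r) F i x).
Proof.
move=> mF; elim: r => [|i r ih].
  by under eq_fun do rewrite big_nil; exact: cmeasurable_cst.
by under eq_fun do rewrite big_cons; exact: cmeasurableD.
Qed.

Lemma cmeasurable_real D (h : T -> R) : measurable_fun D h ->
  cmeasurable D (fun x => ((h x)%:C)%C).
Proof. by move=> mh; split => //=; exact: measurable_cst. Qed.

Lemma measurable_normc D f : cmeasurable D f ->
  measurable_fun D (fun x => normc (f x)).
Proof.
move=> [f1 f2]; under eq_fun do rewrite normc_def'.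
apply: (@measurableT_comp _ _ _ _ _ _ (@Num.sqrt R)).
  exact: (continuous_measurable_fun (@sqrt_continuous R)).
by apply: measurable_funD; exact: measurable_funX.
Qed.

Lemma le_cintegrable D f (g : T -> R) : measurable D -> cmeasurable D f ->
  mu.-integrable D (EFin \o g) -> (forall x, D x -> normc (f x) <= g x) ->
  cintegrable D f.
Proof.
move=> mD [f1 f2] ig fg; split; apply: (le_integrable mD _ _ ig) => /=.
- exact/measurable_EFinP.
- move=> x Dx; rewrite lee_fin (le_trans (normc_Re_le _))//.
  by rewrite (le_trans (fg _ Dx))// ler_norm.
- exact/measurable_EFinP.
- move=> x Dx; rewrite lee_fin (le_trans (normc_Im_le _))//.
  by rewrite (le_trans (fg _ Dx))// ler_norm.
Qed.

Lemma eq_cint D f g : {in D, f =1 g} -> cint D f = cint D g.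
Proof. by move=> fg; congr Complex; apply: eq_Rintegral => x Dx; rewrite fg. Qed.

Lemma eq_cintegrable D f g : measurable D -> {in D, f =1 g} ->
  cintegrable D f -> cintegrable D g.
Proof.
move=> mD fg [f1 f2]; split; [move: f1|move: f2]; apply: eq_integrable => //;
by move=> x xD /=; rewrite fg.
Qed.

Lemma cintegrableZ D (c : R[i]) f : measurable D -> cintegrable D f ->
  cintegrable D (fun x => c * f x).
Proof.
move=> mD [f1 f2]; split.
- have := integrableB mD (integrableZl mD (Re c) f1) (integrableZl mD (Im c) f2).
  by apply: eq_integrable => // x _ /=; rewrite ReM EFinB.
- have := integrableD mD (integrableZl mD (Re c) f2) (integrableZl mD (Im c) f1).
  by apply: eq_integrable => // x _ /=; rewrite ImM EFinD.
Qed.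

Lemma cintD D f g : measurable D -> cintegrable D f -> cintegrable D g ->
  cint D (fun x => f x + g x) = cint D f + cint D g.
Proof.
move=> mD [f1 f2] [g1 g2]; apply: complex_eqP => /=.
  by under eq_Rintegral do rewrite ReD; rewrite RintegralD.
by under eq_Rintegral do rewrite ImD; rewrite RintegralD.
Qed.

Lemma integrable_mulrl D (c : R) (h : T -> R) : measurable D ->
  mu.-integrable D (EFin \o h) -> mu.-integrable D (EFin \o (fun x => c * h x)).
Proof. by move=> mD ih; have := integrableZl mD c ih; apply: eq_integrable. Qed.

Lemma cintZ D (c : R[i]) f : measurable D -> cintegrable D f ->
  cint D (fun x => c * f x) = c * cint D f.
Proof.
move=> mD [f1 f2]; apply: complex_eqP; rewrite ?ReM ?ImM/=.
  under eq_Rintegral do rewrite ReM.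
  by rewrite RintegralB ?RintegralZl//; exact: integrable_mulrl.
under eq_Rintegral do rewrite ImM.
by rewrite RintegralD ?RintegralZl//; exact: integrable_mulrl.
Qed.

Lemma cintB D f g : measurable D -> cintegrable D f -> cintegrable D g ->
  cint D (fun x => f x - g x) = cint D f - cint D g.
Proof.
move=> mD fi gi.
have E x : f x - g x = f x + (-1) * g x by rewrite mulN1r.
under eq_cint do rewrite E.
by rewrite cintD ?cintZ ?mulN1r//; exact: cintegrableZ.
Qed.

Lemma cint_conj D f : measurable D -> cintegrable D f ->
  cint D (fun x => (f x)^*) = (cint D f)^*.
Proof.
move=> mD [f1 f2]; apply: complex_eqP; rewrite ?Re_conj ?Im_conj/=.
  by under eq_Rintegral do rewrite Re_conj.
under eq_Rintegral do rewrite Im_conj -mulN1r.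
by rewrite RintegralZl// mulN1r.
Qed.

(** Real and imaginary parts are estimated separately, which costs the factor 2; the uses are
    smallness estimates, where a fixed constant is harmless. *)
Lemma normc_cint_le D f (g : T -> R) : measurable D -> cintegrable D f ->
  mu.-integrable D (EFin \o g) -> (forall x, D x -> normc (f x) <= g x) ->
  normc (cint D f) <= 2 * \int[mu]_(x in D) g x.
Proof.
move=> mD [f1 f2] ig fg; rewrite (le_trans (normc_le_ReIm _))//= mulr2n mulrDl !mul1r.
apply: lerD; (apply: (le_trans (le_normr_Rintegral _ _)) => //).
  apply: le_Rintegral => //=.
    exact: (integrable_norm f1).
  by move=> x Dx; exact: le_trans (normc_Re_le _) (fg _ Dx).
apply: le_Rintegral => //=.
  exact: (integrable_norm f2).
by move=> x Dx; exact: le_trans (normc_Im_le _) (fg _ Dx).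
Qed.

End complex_integral.

(** * Bisection of rectangles *)

Section bisection.
Variables (R : realType) (N : R -> R -> R -> R -> R).

Hypothesis N_quad : forall a c w v : R, 0 < w -> 0 < v ->
  N a (a + w) c (c + v) <=
    N a (a + w / 2) c (c + v / 2) + N (a + w / 2) (a + w) c (c + v / 2)
  + N a (a + w / 2) (c + v / 2) (c + v) + N (a + w / 2) (a + w) (c + v / 2) (c + v).

Hypothesis N_local : forall x y eps : R, 0 < eps -> exists2 del : R, 0 < del &
  forall a b c d, a <= x <= b -> c <= y <= d -> b - a < del -> d - c < del ->
    N a b c d <= eps * (b - a + (d - c)) ^+ 2.

(* In Goursat's lemma [N a b c d] is the modulus of the integral along the
   boundary of [a, b] x [c, d]. *)
Lemma rectangle_bisection (a b c d : R) : a < b -> c < d -> N a b c d <= 0.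
Proof.
move=> ab cd; rewrite leNgt; apply/negP => N0.
pose w := b - a; pose v := d - c.
have Ea : a + w = b by rewrite /w addrC subrK.
have Ec : c + v = d by rewrite /v addrC subrK.
have w0 : 0 < w by rewrite subr_gt0.
have v0 : 0 < v by rewrite subr_gt0.
have wv0 : 0 < w + v by rewrite addr_gt0.
(* Half of the value per squared half-perimeter, so that the strict invariant [P] holds for the
   initial rectangle. [P k p] concerns the rectangle of generation [k] with lower left corner
   [p]. *)
pose eps := N a b c d / (2 * (w + v) ^+ 2).
have eps0 : 0 < eps by rewrite divr_gt0// mulr_gt0// exprn_gt0.
pose P (k : nat) (p : R * R) := N p.1 (p.1 + w / 2 ^+ k) p.2 (p.2 + v / 2 ^+ k)
   > eps * (w / 2 ^+ k + v / 2 ^+ k) ^+ 2.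
pose nxt (k : nat) (p q : R * R) := [/\ P k.+1 q, (q.1 = p.1 \/ q.1 = p.1 + w / 2 ^+ k.+1) &
   (q.2 = p.2 \/ q.2 = p.2 + v / 2 ^+ k.+1)].
have half (x : R) k : x / 2 ^+ k.+1 = x / 2 ^+ k / 2.
  by rewrite exprSr invfM mulrA.
have step k p : P k p -> exists q, nxt k p q.
  move=> Pkp; rewrite /nxt.
  have wk0 : 0 < w / 2 ^+ k by rewrite divr_gt0// exprn_gt0.
  have vk0 : 0 < v / 2 ^+ k by rewrite divr_gt0// exprn_gt0.
  have := N_quad p.1 p.2 wk0 vk0; move: Pkp; rewrite /P !half.
  set W := w / 2 ^+ k; set V := v / 2 ^+ k => Pkp Nq.
  have E1 (x W' : R) : x + W' / 2 + W' / 2 = x + W' by lra.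
  (* If no quarter inherits the invariant, the four upper bounds add up to [eps * (W + V) ^+ 2],
     because halving the sides divides the squared size by four. *)
  apply: contrapT => /forallNP nq.
  have h x y : (x = p.1 \/ x = p.1 + W / 2) -> (y = p.2 \/ y = p.2 + V / 2) ->
      N x (x + W / 2) y (y + V / 2) <= eps * (W / 2 + V / 2) ^+ 2.
    by move=> hx hy; rewrite leNgt; apply/negP => H; apply: (nq (x, y)); split.
  have h1 := h _ _ (or_introl erefl) (or_introl erefl).
  have h2 := h _ _ (or_intror erefl) (or_introl erefl).
  have h3 := h _ _ (or_introl erefl) (or_intror erefl).
  have h4 := h _ _ (or_intror erefl) (or_intror erefl).
  rewrite !E1 in h2 h3 h4.
  have E2 : eps * (W / 2 + V / 2) ^+ 2 = eps * (W + V) ^+ 2 / 4 by field.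
  rewrite E2 in h1 h2 h3 h4; lra.
(* The default [p] is never reached: [step] provides a successor whenever the invariant holds. *)
pose f k p := if pselect (exists q, nxt k p q) is left e then sval (cid e) else p.
pose s := fix s k := if k is k'.+1 then f k' (s k') else (a, c).
have Ps k : P k (s k).
  elim: k => [|k ih] /=.
    rewrite /P /= expr0 !divr1 Ea Ec /eps.
    rewrite (_ : _ * _ = N a b c d / 2); last by field; rewrite gt_eqF.
    by rewrite ltr_pdivrMr// mulr2n mulrDr !mulr1 ltrDl.
  by rewrite /f; case: pselect => [e|[]]; [case: cid => q []|exact: step].
have ns k : nxt k (s k) (s k.+1).
  by rewrite /= /f; case: pselect => [e|[]]; [case: cid|exact: step].
have w2 k : 0 < w / 2 ^+ k by rewrite divr_gt0// exprn_gt0.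
have v2 k : 0 < v / 2 ^+ k by rewrite divr_gt0// exprn_gt0.
(* Nested intervals, one coordinate at a time: the supremum of the left endpoints lies in all of
   them. *)
have nest (u : nat -> R) (r : R) : 0 < r ->
   (forall k, u k.+1 = u k \/ u k.+1 = u k + r / 2 ^+ k.+1) ->
   exists x, forall k, u k <= x <= u k + r / 2 ^+ k.
  move=> r0 hu.
  have up k j : u k <= u (j + k)%N <= u k + r / 2 ^+ k - r / 2 ^+ (j + k).
    have rk i : 0 < r / 2 ^+ i by rewrite divr_gt0// exprn_gt0.
    elim: j => [|j]; first by rewrite add0n addrK lexx.
    rewrite addSn; move: (hu (j + k)%N) (rk (j + k).+1); rewrite half.
    by case=> -> ? /andP[? ?]; apply/andP; split; lra.
  have uk k j : u j <= u k + r / 2 ^+ k.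
    have rk i : 0 < r / 2 ^+ i by rewrite divr_gt0// exprn_gt0.
    have [kj|/ltnW jk] := leqP k j.
      have := up k (j - k)%N; rewrite subnK// => /andP[_ /le_trans]; apply.
      by rewrite gerBl ltW.
    have := up j (k - j)%N; rewrite subnK// => /andP[/le_trans + _]; apply.
    by rewrite lerDl ltW.
  have hs : has_sup (range u).
    split; first by exists (u 0%N), 0%N.
    by exists (u 0%N + r / 2 ^+ 0) => _ [k _ <-]; exact: uk.
  exists (sup (range u)) => k; apply/andP; split.
    by apply: sup_upper_bound => //; exists k.
  by apply: ge_sup => [|_ [j _ <-]]; [exists (u 0%N), 0%N|exact: uk].
have [x hx] := nest (fun k => (s k).1) w w0 (fun k => let: And3 _ h _ := ns k in h).
have [y hy] := nest (fun k => (s k).2) v v0 (fun k => let: And3 _ _ h := ns k in h).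
have [del del0 hdel] := N_local x y eps0.
have [k hk] : exists k : nat, w / 2 ^+ k < del /\ v / 2 ^+ k < del.
  exists (Num.truncn (w / del + v / del)).
  have D : w / del + v / del < 2 ^+ Num.truncn (w / del + v / del).
    apply: lt_le_trans (truncnS_gt _) _.
    by rewrite -natrX ler_nat ltn_expl.
  have ? : 0 < w / del by rewrite divr_gt0.
  have ? : 0 < v / del by rewrite divr_gt0.
  have e0 : (0 : R) < 2 ^+ Num.truncn (w / del + v / del) by rewrite exprn_gt0.
  by split; rewrite ltr_pdivrMr// mulrC -ltr_pdivrMr//; lra.
have E (p q : R) : p + q - p = q by rewrite addrAC subrr add0r.
have := hdel _ _ _ _ (hx k) (hy k); rewrite !E.
move=> /(_ hk.1 hk.2); rewrite leNgt => /negP; apply.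
exact: Ps.
Qed.

End bisection.

(** * Integrals over segments *)

Section interval_integrals.
Variable R : realType.
Local Notation mu := (@lebesgue_measure R).
Implicit Types (u v : R -> R[i]) (a b c : R).

Definition ccontinuous u :=
  continuous (fun x => Re (u x)) /\ continuous (fun x => Im (u x)).

Lemma ccontinuous_normcP u : ccontinuous u <->
  forall x eps, 0 < eps -> exists2 del, 0 < del &
    forall y, `|y - x| < del -> normc (u y - u x) < eps.
Proof.
split => [[u1 u2] x eps eps0|h].
- have e2 : 0 < eps / 2 by rewrite divr_gt0.
  have /cvgrPdist_lt/(_ _ e2) := u1 x.
  have /cvgrPdist_lt/(_ _ e2) := u2 x.
  move=> /nbhs_ballP[d2 /= d20 h2] /nbhs_ballP[d1 /= d10 h1].
  exists (Num.min d1 d2); first by rewrite lt_min d10.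
  move=> y; rewrite lt_min => /andP[y1 y2].
  rewrite (le_lt_trans (normc_le_ReIm _))// ReD ImD ReN ImN.
  have := h1 y; rewrite /ball/= distrC => /(_ y1).
  have := h2 y; rewrite /ball/= distrC => /(_ y2).
  by rewrite distrC [X in _ -> X < _ -> _]distrC; lra.
- split => x; apply/cvgrPdist_lt => eps eps0.
    have [del del0 hd] := h x _ eps0.
    apply/nbhs_ballP; exists del => //= y; rewrite /ball/= distrC => /hd.
    by apply: le_lt_trans; rewrite distrC -ReN -ReD normc_Re_le.
  have [del del0 hd] := h x _ eps0.
  apply/nbhs_ballP; exists del => //= y; rewrite /ball/= distrC => /hd.
  by apply: le_lt_trans; rewrite distrC -ImN -ImD normc_Im_le.
Qed.

Lemma ccontinuous_cst (z : R[i]) : ccontinuous (fun=> z).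
Proof. by split => x; exact: cvg_cst. Qed.

Lemma ccontinuousD u v : ccontinuous u -> ccontinuous v ->
  ccontinuous (fun x => u x + v x).
Proof.
move=> [u1 u2] [v1 v2]; split.
  by under eq_fun do rewrite ReD; move=> x; apply: cvgD; [exact: u1|exact: v1].
by under eq_fun do rewrite ImD; move=> x; apply: cvgD; [exact: u2|exact: v2].
Qed.

Lemma ccontinuousM u v : ccontinuous u -> ccontinuous v ->
  ccontinuous (fun x => u x * v x).
Proof.
move=> [u1 u2] [v1 v2]; split.
  under eq_fun do rewrite ReM.
  by move=> x; apply: cvgB; apply: cvgM; [exact: u1|exact: v1|exact: u2|exact: v2].
under eq_fun do rewrite ImM.
by move=> x; apply: cvgD; apply: cvgM; [exact: u1|exact: v2|exact: u2|exact: v1].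
Qed.

Lemma ccontinuousB u v : ccontinuous u -> ccontinuous v ->
  ccontinuous (fun x => u x - v x).
Proof.
move=> cu cv; have := ccontinuousD cu (ccontinuousM (ccontinuous_cst (-1)) cv).
by congr ccontinuous; apply/funext => t; rewrite mulN1r.
Qed.

Lemma ccontinuous_comp u (f : R -> R) : ccontinuous u -> continuous f ->
  ccontinuous (fun x => u (f x)).
Proof.
move=> [u1 u2] cf; split => x.
  exact: (@continuous_comp _ _ _ f (fun x => Re (u x)) x (cf x) (u1 (f x))).
exact: (@continuous_comp _ _ _ f (fun x => Im (u x)) x (cf x) (u2 (f x))).
Qed.

Lemma ccontinuous_real (f : R -> R) : continuous f ->
  ccontinuous (fun x => ((f x)%:C)%C).
Proof. by move=> cf; split => //= x; exact: cvg_cst. Qed.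

Lemma ccontinuous_normc u : ccontinuous u -> continuous (fun x => normc (u x)).
Proof.
move=> cu x; apply/cvgrPdist_lt => eps eps0.
have [del del0 h] := (ccontinuous_normcP u).1 cu x _ eps0.
apply/nbhs_ballP; exists del => //= y; rewrite /ball/= distrC => /h.
by apply: le_lt_trans; rewrite distrC dist_normc.
Qed.

Lemma continuous_integrable_itv (f : R -> R) a b : continuous f ->
  mu.-integrable `[a, b] (EFin \o f).
Proof.
move=> cf; apply: continuous_compact_integrable; first exact: segment_compact.
exact: continuous_subspaceT.
Qed.

Lemma ccontinuous_cintegrable u a b : ccontinuous u -> cintegrable mu `[a, b] u.
Proof. by move=> [u1 u2]; split; exact: continuous_integrable_itv. Qed.

Lemma ccontinuous_cmeasurable u : ccontinuous u -> cmeasurable setT u.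
Proof. by move=> [u1 u2]; split; exact: continuous_measurable_fun. Qed.

Lemma Rintegral_itv_cat (f : R -> R) a c b : continuous f -> a <= c -> c <= b ->
  \int[mu]_(x in `[a, b]) f x =
  \int[mu]_(x in `[a, c]) f x + \int[mu]_(x in `[c, b]) f x.
Proof.
move=> cf ac cb; apply/eqP; rewrite addrC -subr_eq; apply/eqP.
rewrite (@Rintegral_itvB _ f _ _ c) ?bnd_simp//; last exact: continuous_integrable_itv.
rewrite Rintegral_itv_obnd_cbnd//.
apply: (integrableS _ _ _ (continuous_integrable_itv c b cf)) => //.
by move=> x /=; rewrite !in_itv/= => /andP[/ltW -> ->].
Qed.

Lemma cint_itv_cat u a c b : ccontinuous u -> a <= c -> c <= b ->
  cint mu `[a, b] u = cint mu `[a, c] u + cint mu `[c, b] u.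
Proof.
by move=> [u1 u2] ac cb; apply: complex_eqP; rewrite ?ReD ?ImD/=; exact: Rintegral_itv_cat.
Qed.

Lemma Rintegral_itv_cst a b (k : R) : a <= b ->
  \int[mu]_(x in `[a, b]) k = k * (b - a).
Proof.
by move=> ab; rewrite Rintegral_cst//= lebesgue_measure_itv/= lte_fin; case: ltP => // ba;
   rewrite (_ : b = a) ?subrr//; apply/eqP; rewrite eq_le ab ba.
Qed.

Lemma normc_cint_itv_le u a b (M : R) : ccontinuous u -> a <= b ->
  (forall x, a <= x <= b -> normc (u x) <= M) ->
  normc (cint mu `[a, b] u) <= 2 * (M * (b - a)).
Proof.
move=> cu ab h; rewrite -(Rintegral_itv_cst M ab).
apply: normc_cint_le => //; first exact: ccontinuous_cintegrable.
  by apply: continuous_integrable_itv => x; exact: cvg_cst.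
Qed.

Lemma Rintegral_itv_id a b : a <= b ->
  \int[mu]_(x in `[a, b]) x = (b ^+ 2 - a ^+ 2) / 2.
Proof.
rewrite le_eqVlt => /predU1P[->|ab].
  by rewrite set_itv1 Rintegral_set1 subrr mul0r.
have c1 : {within `[a, b], continuous (fun x : R => x)}.
  by apply: continuous_subspaceT => x; exact: cvg_id.
have cF : continuous (fun x : R => x ^+ 2 / 2).
  by move=> x; apply: cvgM; [exact: exprn_continuous|exact: cvg_cst].
have F' x : is_derive (x : R) 1 (fun x : R => x ^+ 2 / 2) x.
  have -> : (fun x : R => x ^+ 2 / 2) = (2^-1 \*o (fun x : R => x ^+ 2)).
    by apply/funext => y /=; rewrite mulrC.
  apply: is_derive_eq; rewrite /GRing.scale/=; lra.
rewrite /Rintegral (continuous_FTC2 ab c1 (F := fun x => x ^+ 2 / 2)) ?mulrBl//.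
  split => [x _||]; first exact: ex_derive.
    by apply: cvg_at_right_filter; exact: cF.
  by apply: cvg_at_left_filter; exact: cF.
by move=> x _; rewrite derive1E; exact: derive_val.
Qed.

Lemma cint_itv_affine (p q : R[i]) a b : a <= b ->
  cint mu `[a, b] (fun x => p + q * (x%:C)%C) =
  p * ((b - a)%:C)%C + q * (((b ^+ 2 - a ^+ 2) / 2)%:C)%C.
Proof.
move=> ab.
have cid : ccontinuous (fun x : R => (x%:C)%C).
  by apply: ccontinuous_real => x; exact: cvg_id.
have ip (k : R[i]) : cintegrable mu `[a, b] (fun=> k).
  by apply: ccontinuous_cintegrable; exact: ccontinuous_cst.
rewrite cintD//; last by apply: cintegrableZ => //; exact: ccontinuous_cintegrable.
rewrite cintZ//; last exact: ccontinuous_cintegrable.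
congr (_ + _ * _); apply: complex_eqP => /=; rewrite ?ReM ?ImM/=.
- by rewrite Rintegral_itv_cst// mulr0 subr0.
- by rewrite Rintegral_itv_cst// mulr0 add0r.
- exact: Rintegral_itv_id.
- by rewrite Rintegral_itv_cst// mul0r.
Qed.

End interval_integrals.

(** * The complex exponential *)

Section complex_topology.
Variable R : realType.
Implicit Types (z w h : R[i]).

(** A positive element of [R[i]] is real, so the radius of a ball can be replaced by its real
    part. *)
Lemma ltc_normc z (e : R[i]) : 0 < e -> (`|z| < e) = (normc z < Re e).
Proof. by rewrite -normc_norm !ltcE/= => /andP[/eqP -> _]; rewrite eqxx. Qed.

Lemma nbhs_normcP z (P : set R[i]) : nbhs z P <->
  exists2 del : R, 0 < del & forall w, normc (w - z) < del -> P w.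
Proof.
split.
  move=> /nbhs_ballP[e /= e0 he]; have [re0 ie0] : 0 < Re e /\ Im e = 0.
    by move: e0; rewrite ltcE/= => /andP[/eqP -> ->].
  exists (Re e) => // w hw; apply: he; rewrite /ball/= ltc_normc//.
  by rewrite normcB.
move=> [del del0 h]; apply/nbhs_ballP; exists ((del%:C)%C); first by rewrite /= ltcR.
move=> w; rewrite /ball/= ltc_normc ?ltcR// => hw; apply: h.
by rewrite normcB.
Qed.

Lemma cvg_normcP (T : Type) (F : set_system T) (FF : Filter F) (f : T -> R[i]) z :
  f @ F --> z <-> forall eps : R, 0 < eps -> \forall x \near F, normc (f x - z) < eps.
Proof.
split => [fz eps eps0|h P].
  apply: (fz [set w | normc (w - z) < eps]); apply/nbhs_normcP.
  by exists eps.
by move=> /nbhs_normcP[del del0 hP]; near=> x; apply: hP; near: x; exact: h.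
Unshelve. all: by end_near. Qed.

Lemma continuous_normcP (f : R[i] -> R[i]) z : {for z, continuous f} <->
  forall eps : R, 0 < eps -> exists2 del : R, 0 < del &
    forall w, normc (w - z) < del -> normc (f w - f z) < eps.
Proof.
have E := @cvg_normcP _ (nbhs z) _ f (f z); split.
  by move=> /E h eps eps0; apply/nbhs_normcP; exact: h.
by move=> h; apply/E => eps eps0; apply/nbhs_normcP; exact: h.
Qed.

(** The division-free estimate covers [h = 0] and is the form that Goursat's argument integrates. *)
Lemma differentiable_normcP (f : R[i] -> R[i]) z : differentiable f z <->
  exists L : R[i], forall eps : R, 0 < eps -> exists2 del : R, 0 < del &
    forall h, normc h < del -> normc (f (z + h) - f z - L * h) <= eps * normc h.
Proof.
rewrite -derivable1_diffP; split.
- move=> fz; exists ('D_1 f z) => eps eps0.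
  have /cvg_normcP/(_ _ eps0) := fz.
  rewrite /dnbhs /within/= => /nbhs_normcP[del del0 hd].
  exists del => // h hh; have [->|h0] := eqVneq h 0.
    by rewrite addr0 mulr0 subrr subr0 normc0 mulr0.
  have := hd h; rewrite subr0 => /(_ hh h0); rewrite /GRing.scale/= mulr1 => hD.
  rewrite (addrC z) (_ : f _ - _ - _ = (h^-1 * (f (h + z) - f z) - 'D_1 f z) * h).
    by rewrite normcM ler_wpM2r ?normc_ge0 ?ltW.
  by rewrite mulrBl mulrAC mulVf// mul1r.
- move=> [L hL]; apply/cvg_ex; exists L; apply/cvg_normcP => eps eps0.
  have e2 : 0 < eps / 2 by rewrite divr_gt0.
  have [del del0 hd] := hL _ e2.
  rewrite /dnbhs /within/=; apply/nbhs_normcP; exists del => // h; rewrite subr0 => hh h0.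
  rewrite /GRing.scale/= mulr1.
  rewrite (_ : _ - L = h^-1 * (f (z + h) - f z - L * h)); last first.
    by rewrite [RHS]mulrBr (mulrC L) mulKf// (addrC z).
  rewrite normcM normcV mulrC ltr_pdivrMr ?normc_gt0//.
  rewrite (le_lt_trans (hd _ hh))// ltr_pM2r ?normc_gt0//.
  by rewrite ltr_pdivrMr// mulr2n mulrDr mulr1 ltrDl.
Qed.

End complex_topology.

Section complex_exponential.
Variable R : realType.
Implicit Types (z w : R[i]) (s t : R).

Definition cis t : R[i] := Complex (cos t) (sin t).

Definition cexp z : R[i] := ((expR (Re z))%:C)%C * cis (Im z).

Lemma cisD s t : cis (s + t) = cis s * cis t.
Proof. by apply: complex_eqP; rewrite ?ReM ?ImM/= ?cosD ?sinD// addrC. Qed.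

Lemma cis0 : cis 0 = 1.
Proof. by apply: complex_eqP; rewrite /= ?cos0 ?sin0. Qed.

Lemma normc_cis t : normc (cis t) = 1.
Proof. by rewrite normc_def'/= cos2Dsin2 sqrtr1. Qed.

Lemma cis_neq0 t : cis t != 0.
Proof. by rewrite -normc_eq0 normc_cis oner_eq0. Qed.

Lemma cisN t : cis (- t) = (cis t)^-1.
Proof.
by apply: (mulIf (cis_neq0 t)); rewrite -cisD addNr cis0 mulVf// cis_neq0.
Qed.

Lemma conj_cis t : (cis t)^* = cis (- t).
Proof. by apply: complex_eqP; rewrite ?Re_conj ?Im_conj/= ?cosN ?sinN. Qed.

Lemma cis_mulrn t k : cis (k%:R * t) = cis t ^+ k.
Proof.
elim: k => [|k ih]; first by rewrite mul0r cis0.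
by rewrite -nat1r mulrDl mul1r cisD ih exprS.
Qed.

Lemma cis_2pi : cis (2 * pi) = 1.
Proof. by apply: complex_eqP; rewrite /= mulr_natl ?cos2pi ?sin2pi. Qed.

Lemma cis_pi : cis pi = -1.
Proof. by apply: complex_eqP; rewrite /= ?cospi ?sinpi ?oppr0. Qed.

Lemma cis_period t : cis (t + 2 * pi) = cis t.
Proof. by rewrite cisD cis_2pi mulr1. Qed.

Lemma cexpD z w : cexp (z + w) = cexp z * cexp w.
Proof. by rewrite /cexp ReD ImD expRD cisD rmorphM/= mulrACA. Qed.

Lemma cexp0 : cexp 0 = 1.
Proof. by rewrite /cexp expR0 cis0 mulr1. Qed.

Lemma normc_cexp z : normc (cexp z) = expR (Re z).
Proof. by rewrite /cexp normcM normc_cis mulr1 normc_real ger0_norm// expR_ge0. Qed.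

Lemma ccontinuous_cis : ccontinuous cis.
Proof. by split => x; [exact: continuous_cos|exact: continuous_sin]. Qed.

Lemma is_derive_eps (f : R -> R) (x d : R) : is_derive x 1 f d ->
  forall eps : R, 0 < eps -> exists2 del : R, 0 < del &
    forall h : R, `|h| < del -> `|f (x + h) - f x - d * h| <= eps * `|h|.
Proof.
move=> [fx fd] eps eps0.
have : (fun h => h^-1 *: (f (h *: 1 + x) - f x)) @ 0^' --> d by rewrite -fd.
move=> /cvgrPdist_lt/(_ _ eps0); rewrite /dnbhs /within/= => /nbhs_ballP[del /= del0 hd].
exists del => // h hh; have [->|h0] := eqVneq h 0.
  by rewrite addr0 mulr0 subrr subr0 normr0 mulr0.
have := hd h; rewrite /ball/= sub0r normrN => /(_ hh h0).
rewrite /GRing.scale/= mulr1 => hD.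
rewrite (addrC x) (_ : f _ - _ - _ = (h^-1 * (f (h + x) - f x) - d) * h).
  by rewrite normrM ler_wpM2r// distrC ltW.
by rewrite mulrBl mulrAC mulVf// mul1r.
Qed.

(** The derivative at 0; the functional equation [cexpD] transports it to every point in
    [differentiable_cexp]. *)
Lemma cexp_eps (eps : R) : 0 < eps -> exists2 del : R, 0 < del &
  forall h : R[i], normc h < del -> normc (cexp h - 1 - h) <= eps * normc h.
Proof.
move=> eps0.
(* The error terms below cost [e], [2 * e], [2 * e] and [e] times the modulus, hence the 6; the
   bound [e <= 1] keeps [expR x] below 2. *)
pose e := Num.min (eps / 6) 1.
have e0 : 0 < e by rewrite lt_min divr_gt0/=.
have [d1 d10 h1] := is_derive_eps (is_derive_expR (0 : R)) e0.
have [d2 d20 h2] := is_derive_eps (is_derive_cos (0 : R)) e0.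
have [d3 d30 h3] := is_derive_eps (is_derive_sin (0 : R)) e0.
exists (Num.min (Num.min d1 d2) (Num.min d3 (e / 2))).
  by rewrite !lt_min d10 d20 d30 divr_gt0.
case=> x y; rewrite !lt_min => /andP[/andP[l1 l2] /andP[l3 l4]].
set H := Complex x y in l1 l2 l3 l4 *.
have xH : `|x| <= normc H := normc_Re_le H.
have yH : `|y| <= normc H := normc_Im_le H.
have e1 : e <= 1 by rewrite ge_min lexx orbT.
have e6 : 6 * e <= eps.
  have : e <= eps / 6 by rewrite ge_min lexx.
  by lra.
have := h1 x (le_lt_trans xH l1); rewrite add0r expR0 mul1r => k1.
have := h2 y (le_lt_trans yH l2); rewrite add0r cos0 sin0 oppr0 mul0r subr0 => k2.
have := h3 y (le_lt_trans yH l3); rewrite add0r sin0 cos0 mul1r subr0 => k3.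
have x2 : `|x| <= e / 2 := le_trans xH (ltW l4).
have k4 : `|expR x - 1| <= e.
  have : expR x - 1 = (expR x - 1 - x) + x by rewrite subrK.
  move=> ->; rewrite (le_trans (ler_normD _ _))//.
  have : e * `|x| <= `|x| by rewrite ler_piMl.
  by lra.
have k5 : expR x <= 2.
  by move: (ler_norm (expR x - 1)); lra.
rewrite (le_trans (normc_le_ReIm _))//.
have -> : Re (cexp H - 1 - H) = (expR x - 1 - x) + expR x * (cos y - 1).
  by rewrite !ReD !ReN Re_realM/=; ring.
have -> : Im (cexp H - 1 - H) = expR x * (sin y - y) + (expR x - 1) * y.
  by rewrite !ImD !ImN Im_realM/=; ring.
have k6 : `|expR x * (cos y - 1)| <= 2 * (e * `|y|).
  by rewrite normrM ger0_norm ?expR_ge0// ler_pM ?expR_ge0.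
have k7 : `|expR x * (sin y - y)| <= 2 * (e * `|y|).
  by rewrite normrM ger0_norm ?expR_ge0// ler_pM ?expR_ge0.
have k8 : `|(expR x - 1) * y| <= e * `|y| by rewrite normrM ler_wpM2r.
have k9 : e * `|x| <= e * normc H by rewrite ler_pM2l.
have k10 : e * `|y| <= e * normc H by rewrite ler_pM2l.
have k11 : 6 * e * normc H <= eps * normc H by rewrite ler_wpM2r ?normc_ge0.
have := ler_normD (expR x - 1 - x) (expR x * (cos y - 1)).
have := ler_normD (expR x * (sin y - y)) ((expR x - 1) * y).
by lra.
Qed.

Lemma differentiable_cexp z : differentiable cexp z.
Proof.
apply/differentiable_normcP; exists (cexp z) => eps eps0.
have e0 : 0 < eps / normc (cexp z) by rewrite divr_gt0// normc_cexp expR_gt0.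
have [del del0 hd] := cexp_eps e0; exists del => // h /hd.
rewrite -(ler_pM2l (_ : 0 < normc (cexp z))); last by rewrite normc_cexp expR_gt0.
rewrite mulrA mulrCA mulfV ?normc_cexp ?gt_eqF ?expR_gt0// mulr1 -normc_cexp -normcM.
by rewrite !mulrBr mulr1 -cexpD.
Qed.

Lemma cexp_cis s t : cexp (Complex s t) = ((expR s)%:C)%C * cis t.
Proof. by []. Qed.

Lemma cexp_real s : cexp (s%:C)%C = ((expR s)%:C)%C.
Proof. by rewrite /cexp/= cis0 mulr1. Qed.

(** The angle is [acos] in the upper half plane and its reflection in the lower one; the range
    [[0, 2 * pi]] is the one that [cmean_shift] accepts. *)
Lemma polar_form z : z != 0 -> exists s t, 0 <= t <= 2 * pi /\ z = cexp (Complex s t).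
Proof.
move=> z0; have n0 : 0 < normc z by rewrite normc_gt0.
pose x := Re z / normc z; pose y := Im z / normc z.
have xy : x ^+ 2 + y ^+ 2 = 1.
  by rewrite !exprMn -mulrDl -sqr_normcE exprVn mulfV// gt_eqF// exprn_gt0.
have x1 : -1 <= x <= 1.
  by rewrite -ler_norml -(ler_pXn2r (n := 2)) ?nnegrE// expr1n real_normK ?num_real// -xy lerDl sqr_ge0.
have [t [t0 ct st]] : exists t, [/\ 0 <= t <= 2 * pi, cos t = x & sin t = y].
  have a0 := acos_ge0 x1; have api := acos_lepi x1.
  have s2 : Num.sqrt (1 - x ^+ 2) = `|y| by rewrite -xy addrAC subrr add0r sqrtr_sqr.
  have [y0|y0] := leP 0 y.
    exists (acos x); rewrite acosK// ?sin_acos// s2 ger0_norm//; split => //.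
    by apply/andP; split => //; have := pi_ge0 R; lra.
  exists (2 * pi - acos x); split; first by apply/andP; split; have := pi_ge0 R; lra.
    by rewrite addrC mulr_natl cosD2pi cosN acosK.
  by rewrite addrC mulr_natl sinD2pi sinN sin_acos// s2 ltr0_norm// opprK.
exists (ln (normc z)), t; split => //.
rewrite cexp_cis lnK ?posrE// /cis ct st; apply: complex_eqP.
  by rewrite Re_realM/= mulrC divfK// gt_eqF.
by rewrite Im_realM/= mulrC divfK// gt_eqF.
Qed.

End complex_exponential.

(** * Measure-preserving maps and circle means *)

Section measure_preserving.
Context d (T : measurableType d) (R : realType) (mu : {measure set T -> \bar R}).

Definition preserving (f : T -> T) := measurable_fun setT f /\
  forall A, measurable A -> mu (f @^-1` A) = mu A.

Lemma preserving_comp f g : preserving f -> preserving g -> preserving (f \o g).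
Proof.
move=> [mf pf] [mg pg]; split; first exact: measurableT_comp.
move=> A mA; rewrite comp_preimage pg ?pf//.
by rewrite -[X in measurable X]setTI; exact: mf.
Qed.

Lemma preserving_id : preserving id.
Proof. by split => //; exact: measurable_id. Qed.

Section integral.
Variables (f : T -> T) (pf : preserving f).
Let mf : measurable_fun setT f := pf.1.

Let pushE (D : set T) (F : T -> \bar R) : measurable D ->
  (\int[pushforward mu f]_(x in D) F x = \int[mu]_(x in D) F x)%E.
Proof.
move=> mD; apply: (@eq_measure_integral _ _ _ _ mu) => A mA _.
exact: pf.2.
Qed.

Lemma preserving_ge0_integral (D : set T) (F : T -> \bar R) : measurable D ->
  measurable_fun D F -> (forall x, D x -> 0 <= F x)%E ->
  (\int[mu]_(x in f @^-1` D) F (f x) = \int[mu]_(x in D) F x)%E.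
Proof.
move=> mD mF F0; rewrite -[RHS]pushE//.
by rewrite (ge0_integral_pushforward mf)// => y; rewrite inE; exact: F0.
Qed.

Lemma preserving_integrable (D : set T) (F : T -> \bar R) : measurable D ->
  mu.-integrable D F -> mu.-integrable (f @^-1` D) (F \o f).
Proof.
move=> mD /integrableP[mF iF]; apply/integrableP.
have mfD : measurable (f @^-1` D) by rewrite -[X in measurable X]setTI; exact: mf.
split.
  by apply: (measurable_comp mD) => //; [move=> _ [x ? <-]|exact: measurable_funTS].
rewrite (preserving_ge0_integral mD (F := fun x => `|F x|%E))//.
exact: measurableT_comp.
Qed.

Lemma preserving_integral (D : set T) (F : T -> \bar R) : measurable D ->
  mu.-integrable D F ->
  (\int[mu]_(x in f @^-1` D) F (f x) = \int[mu]_(x in D) F x)%E.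
Proof.
move=> mD iF; rewrite [LHS]integralE [RHS]integralE.
have mF := measurable_int mu iF.
congr (_ - _)%E.
  rewrite -[RHS](preserving_ge0_integral mD (measurable_funepos mF))//.
  by apply: eq_integral => x _; rewrite funepos_comp.
rewrite -[RHS](preserving_ge0_integral mD (measurable_funeneg mF))//.
by apply: eq_integral => x _; rewrite funeneg_comp.
Qed.

Lemma preserving_cintegrable (D : set T) (F : T -> R[i]) : measurable D ->
  cintegrable mu D F -> cintegrable mu (f @^-1` D) (F \o f).
Proof.
by move=> mD [F1 F2]; split;
  [exact: (preserving_integrable mD F1)|exact: (preserving_integrable mD F2)].
Qed.

Lemma preserving_cint (D : set T) (F : T -> R[i]) : measurable D ->
  cintegrable mu D F ->
  cint mu (f @^-1` D) (F \o f) = cint mu D F.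
Proof.
move=> mD [F1 F2]; apply: complex_eqP; rewrite /= /Rintegral; congr fine.
  exact: (preserving_integral mD F1).
exact: (preserving_integral mD F2).
Qed.

End integral.

End measure_preserving.

Section lebesgue_translation.
Variable R : realType.
Local Notation mu := (@lebesgue_measure R).

(** Lebesgue measure is determined by its values on half-open intervals, whose lengths are
    translation-invariant. *)
Lemma preserving_addr (c : R) : preserving mu (fun x => x + c).
Proof.
pose f : measurableTypeR R -> measurableTypeR R := fun x => x + c.
have mf : measurable_fun setT f.
  by apply: measurable_funD => //; exact: measurable_cst.
split => // A mA; apply/esym.
have := @lebesgue_measure_unique R (pushforward mu f); apply => //.
move=> _ [[a b] _ <-].
have E : f @^-1` `]a, b]%classic = `]a - c, b - c]%classic.
  by apply/seteqP; split => x /=; rewrite !in_itv/= ltrBlDr lerBrDr.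
transitivity (mu `]a - c, b - c]%classic); last by rewrite -E.
by rewrite !lebesgue_measure_itv/= !lte_fin ltrD2r -!EFinB opprB addrA subrK.
Qed.

Lemma preimage_addr_itvcc (c a b : R) :
  (fun x => x + c) @^-1` `[a + c, b + c] = `[a, b]%classic.
Proof. by apply/seteqP; split => x /=; rewrite !in_itv/= !lerD2r. Qed.

Lemma cint_itv_addr (u : R -> R[i]) (c a b : R) : ccontinuous u ->
  cint mu `[a, b] (fun x => u (x + c)) = cint mu `[a + c, b + c] u.
Proof.
move=> cu.
have := preserving_cint (preserving_addr c) _ (ccontinuous_cintegrable (a + c) (b + c) cu).
by rewrite preimage_addr_itvcc => ->.
Qed.

End lebesgue_translation.

Section circle_mean.
Variable R : realType.
Local Notation mu := (@lebesgue_measure R).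
Implicit Types (u v : R -> R[i]).

Definition cmean u : R[i] := (((2 * pi)^-1)%:C)%C * cint mu `[0, 2 * pi] u.

Let pi2_gt0 : 0 < 2 * pi :> R. Proof. by rewrite mulr_gt0// pi_gt0. Qed.

Lemma eq_cmean u v : u =1 v -> cmean u = cmean v.
Proof. by move=> uv; congr (_ * _); apply: eq_cint => x _; rewrite uv. Qed.

Lemma cmean_cst (c : R[i]) : cmean (fun=> c) = c.
Proof.
apply: complex_eqP; rewrite ?Re_realM ?Im_realM/= Rintegral_itv_cst ?ltW// subr0.
  by rewrite mulrC mulfK// gt_eqF.
by rewrite mulrC mulfK// gt_eqF.
Qed.

Lemma cmeanZ (c : R[i]) u : ccontinuous u -> cmean (fun t => c * u t) = c * cmean u.
Proof.
by move=> cu; rewrite /cmean cintZ 1?mulrCA//; exact: ccontinuous_cintegrable.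
Qed.

Lemma cmeanB u v : ccontinuous u -> ccontinuous v ->
  cmean (fun t => u t - v t) = cmean u - cmean v.
Proof.
by move=> cu cv; rewrite /cmean cintB// ?mulrBr//; exact: ccontinuous_cintegrable.
Qed.

Lemma normc_cmean_le u (M : R) : ccontinuous u ->
  (forall t, 0 <= t <= 2 * pi -> normc (u t) <= M) -> normc (cmean u) <= 2 * M.
Proof.
move=> cu uM; have i0 : 0 <= (2 * pi)^-1 :> R by rewrite invr_ge0 ltW.
rewrite /cmean normcM normc_real ger0_norm// [leLHS]mulrC ler_pdivrMr//.
have := normc_cint_itv_le cu (ltW pi2_gt0) uM.
by rewrite subr0 mulrA.
Qed.

(** Cut the shifted interval at [2 * pi] and move the excess back by periodicity. *)
Lemma cmean_shift u c : ccontinuous u -> (forall t, u (t + 2 * pi) = u t) ->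
  0 <= c <= 2 * pi -> cmean (fun t => u (t + c)) = cmean u.
Proof.
move=> cu pu /andP[c0 c2]; congr (_ * _).
rewrite cint_itv_addr// add0r.
rewrite (@cint_itv_cat _ _ _ (2 * pi)) ?lerDl//.
rewrite [RHS](@cint_itv_cat _ _ _ c)// addrC; congr (_ + _).
rewrite (addrC _ c) -[X in `[X, _]](add0r (2 * pi)) -cint_itv_addr//.
by apply: eq_cint => x _; rewrite pu.
Qed.

End circle_mean.

Section goursat.
Variable R : realType.
Local Notation mu := (@lebesgue_measure R).
Implicit Types (F : R[i] -> R[i]).

Definition entire F := forall z, differentiable F z.

Lemma entire_continuous F : entire F -> forall z, {for z, continuous F}.
Proof. by move=> eF z; exact: differentiable_continuous. Qed.

Lemma ccontinuous_compc (F : R[i] -> R[i]) (u : R -> R[i]) :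
  (forall z, {for z, continuous F}) -> ccontinuous u ->
  ccontinuous (fun t => F (u t)).
Proof.
move=> cF /ccontinuous_normcP cu; apply/ccontinuous_normcP => x eps eps0.
have [d1 d10 h1] := (continuous_normcP F (u x)).1 (cF _) _ eps0.
have [d2 d20 h2] := cu x _ d10.
by exists d2 => // y /h2 /h1.
Qed.

Lemma ccontinuous_hline t : ccontinuous (fun s : R => Complex s t).
Proof. by split => //= x; [exact: cvg_id|exact: cvg_cst]. Qed.

Lemma ccontinuous_vline s : ccontinuous (fun t : R => Complex s t).
Proof. by split => //= x; [exact: cvg_cst|exact: cvg_id]. Qed.

(** The integral of [F(z) dz] along the counterclockwise boundary of [[a, b] x [c, d]]; the factor
    [i] comes from [dz = i dt] on the vertical sides. *)
Definition cauchy_rect F (a b c d : R) : R[i] :=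
  cint mu `[a, b] (fun s => F (Complex s c)) - cint mu `[a, b] (fun s => F (Complex s d))
  + 'i%C * (cint mu `[c, d] (fun t => F (Complex b t)) - cint mu `[c, d] (fun t => F (Complex a t))).

(** Goursat's argument subtracts the first-order expansion of [F], whose boundary integral must
    vanish exactly; for an affine map this is a polynomial identity in the corners. *)
Lemma cauchy_rect_affine (p q : R[i]) (a b c d : R) : a <= b -> c <= d ->
  cauchy_rect (fun z => p + q * z) a b c d = 0.
Proof.
move=> ab cd; rewrite /cauchy_rect.
have H t : cint mu `[a, b] (fun s => p + q * Complex s t) =
    cint mu `[a, b] (fun s => (p + q * Complex 0 t) + q * (s%:C)%C).
  apply: eq_cint => s _; rewrite -addrA -mulrDr; congr (_ + _ * _).
  by apply: complex_eqP; rewrite ?ReD ?ImD/= ?add0r ?addr0.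
have V s : cint mu `[c, d] (fun t => p + q * Complex s t) =
    cint mu `[c, d] (fun t => (p + q * (s%:C)%C) + q * 'i%C * (t%:C)%C).
  apply: eq_cint => t _; rewrite -addrA -mulrA -mulrDr; congr (_ + _ * _).
  by apply: complex_eqP; rewrite ?ReD ?ImD ?ReM ?ImM/=; ring.
rewrite !H !V !cint_itv_affine//.
case: p q {H V} => [p1 p2] [q1 q2]; apply: complex_eqP;
  rewrite ?(ReD, ReN, ImD, ImN, ReM, ImM)/=; by field.
Qed.

End goursat.

(** * Cauchy's theorem and Taylor series *)

Section cauchy.
Variable R : realType.
Local Notation mu := (@lebesgue_measure R).
Implicit Types (F g : R[i] -> R[i]).

Let ccH F t : (forall z, {for z, continuous F}) -> ccontinuous (fun s : R => F (Complex s t)).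
Proof. by move=> cF; apply: ccontinuous_compc => //; exact: ccontinuous_hline. Qed.

Let ccV F s : (forall z, {for z, continuous F}) -> ccontinuous (fun t : R => F (Complex s t)).
Proof. by move=> cF; apply: ccontinuous_compc => //; exact: ccontinuous_vline. Qed.

Let ciH F t a b : (forall z, {for z, continuous F}) ->
  cintegrable mu `[a, b] (fun s : R => F (Complex s t)).
Proof. by move=> cF; exact/ccontinuous_cintegrable/ccH. Qed.

Let ciV F s a b : (forall z, {for z, continuous F}) ->
  cintegrable mu `[a, b] (fun t : R => F (Complex s t)).
Proof. by move=> cF; exact/ccontinuous_cintegrable/ccV. Qed.

Lemma cauchy_rectB F G a b c d : (forall z, {for z, continuous F}) ->
  (forall z, {for z, continuous G}) ->
  cauchy_rect (fun z => F z - G z) a b c d = cauchy_rect F a b c d - cauchy_rect G a b c d.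
Proof.
move=> cF cG; rewrite /cauchy_rect !cintB//; try exact: ciH; try exact: ciV.
by ring.
Qed.

Lemma cauchy_rect_le F a b c d (M : R) : (forall z, {for z, continuous F}) ->
  a <= b -> c <= d ->
  (forall s t, a <= s <= b -> c <= t <= d -> normc (F (Complex s t)) <= M) ->
  normc (cauchy_rect F a b c d) <= 4 * M * (b - a + (d - c)).
Proof.
move=> cF ab cd FM.
have iM : normc ('i%C : R[i]) = 1 by rewrite normc_def'/= expr0n/= add0r expr1n sqrtr1.
have aa : a <= a <= b by rewrite lexx.
have bb : a <= b <= b by rewrite lexx andbT.
have cc : c <= c <= d by rewrite lexx.
have dd : c <= d <= d by rewrite lexx andbT.
have h1 := normc_cint_itv_le (ccH c cF) ab (fun s hs => FM s c hs cc).
have h2 := normc_cint_itv_le (ccH d cF) ab (fun s hs => FM s d hs dd).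
have h3 := normc_cint_itv_le (ccV b cF) cd (fun t ht => FM b t bb ht).
have h4 := normc_cint_itv_le (ccV a cF) cd (fun t ht => FM a t aa ht).
rewrite /cauchy_rect (le_trans (ler_normcD _ _))// normcM iM mul1r.
rewrite (le_trans (lerD (ler_normcB _ _) (ler_normcB _ _)))//.
by lra.
Qed.

Lemma cauchy_rect_quad F (a c w v : R) : (forall z, {for z, continuous F}) ->
  0 < w -> 0 < v ->
  cauchy_rect F a (a + w) c (c + v) =
    cauchy_rect F a (a + w / 2) c (c + v / 2)
  + cauchy_rect F (a + w / 2) (a + w) c (c + v / 2)
  + cauchy_rect F a (a + w / 2) (c + v / 2) (c + v)
  + cauchy_rect F (a + w / 2) (a + w) (c + v / 2) (c + v).
Proof.
move=> cF w0 v0.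
have H t : cint mu `[a, a + w] (fun s => F (Complex s t)) =
   cint mu `[a, a + w / 2] (fun s => F (Complex s t)) +
   cint mu `[a + w / 2, a + w] (fun s => F (Complex s t)).
  by apply: cint_itv_cat; [exact: ccH|lra|lra].
have V s : cint mu `[c, c + v] (fun t => F (Complex s t)) =
   cint mu `[c, c + v / 2] (fun t => F (Complex s t)) +
   cint mu `[c + v / 2, c + v] (fun t => F (Complex s t)).
  by apply: cint_itv_cat; [exact: ccV|lra|lra].
by rewrite /cauchy_rect !H !V; ring.
Qed.

(** Goursat's lemma. Near a point, [F] differs from its first-order expansion by at most [eps] times
    the distance; integrated along the boundary this gives [eps] times the squared half-perimeter,
    which is the local hypothesis of [rectangle_bisection]. *)
Lemma cauchy_rect_eq0 F a b c d : entire F -> a < b -> c < d ->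
  cauchy_rect F a b c d = 0.
Proof.
move=> eF ab cd; have cF := entire_continuous eF.
apply/eqP; rewrite -normc_eq0 eq_le normc_ge0 andbT.
apply: (@rectangle_bisection _ (fun a b c d => normc (cauchy_rect F a b c d))) => //.
  move=> a' c' w v w0 v0; rewrite (cauchy_rect_quad _ _ cF w0 v0).
  by do 3 (apply: (le_trans (ler_normcD _ _)); rewrite lerD2r).
(* The quarter compensates the constant 4 of [cauchy_rect_le]. *)
move=> x y eps eps0; have e4 : 0 < eps / 4 by rewrite divr_gt0.
have [L hL] := (differentiable_normcP F (Complex x y)).1 (eF _).
have [del del0 hd] := hL _ e4.
(* Both sides being shorter than [del / 2], the whole rectangle is within [del] of [(x, y)]. *)
exists (del / 2); first by rewrite divr_gt0.
move=> a' b' c' d' /andP[ax xb] /andP[cy yd] bad dcd.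
pose A z := (F (Complex x y) - L * Complex x y) + L * z.
have dA : entire A.
  move=> z; apply/differentiable_normcP; exists L => e e0.
  exists 1 => // h _; rewrite /A mulrDr.
  rewrite (_ : _ - _ - _ = 0) ?normc0 ?mulr_ge0 ?normc_ge0 ?ltW//.
  by ring.
have cA := entire_continuous dA.
have E : cauchy_rect F a' b' c' d' = cauchy_rect (fun z => F z - A z) a' b' c' d'.
  rewrite cauchy_rectB// [X in _ - X]cauchy_rect_affine ?subr0//.
    exact: le_trans ax xb.
  exact: le_trans cy yd.
have cFA z : {for z, continuous (fun z => F z - A z)}.
  exact/differentiable_continuous/(differentiableB (eF z) (dA z)).
rewrite E; set p := b' - a' + (d' - c').
have p0 : 0 <= p by rewrite /p; lra.
have := @cauchy_rect_le (fun z => F z - A z) a' b' c' d' (eps / 4 * p) cFA (le_trans ax xb) (le_trans cy yd).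
rewrite -/p (_ : 4 * (eps / 4 * p) * p = eps * p ^+ 2); last by field.
apply => s t /andP[as_ sb] /andP[ct td].
pose h : R[i] := Complex (s - x) (t - y).
have hp : normc h <= p.
  rewrite (le_trans (normc_le_ReIm _))//= /p lerD// ler_norml; apply/andP; split; lra.
have hdel : normc h < del by apply: le_lt_trans hp _; rewrite /p; lra.
have xyh : Complex x y + h = Complex s t.
  by apply: complex_eqP; rewrite ?ReD ?ImD/= addrC subrK.
have := hd _ hdel; rewrite xyh /A -xyh.
rewrite (_ : F (Complex x y + h) - (_ + _) = F (Complex x y + h) - F (Complex x y) - L * h); last by ring.
move=> /le_trans; apply.
by rewrite ler_pM2l.
Qed.

(** On a rectangle one period high the horizontal sides cancel, so Cauchy's theorem equates the two
    vertical ones. *)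
Lemma periodic_strip F a b c : entire F ->
  (forall z, F (z + Complex 0 (2 * pi)) = F z) ->
  cint mu `[c, c + 2 * pi] (fun t => F (Complex a t)) =
  cint mu `[c, c + 2 * pi] (fun t => F (Complex b t)).
Proof.
move=> eF pF; wlog ab : a b / a < b.
  have [ab|ba|-> //] := ltgtP a b => h; first exact: h.
  by rewrite (h b a).
have cc : c < c + 2 * pi by rewrite ltrDl mulr_gt0 ?pi_gt0.
have := cauchy_rect_eq0 eF ab cc; rewrite /cauchy_rect.
have -> : (fun s => F (Complex s (c + 2 * pi))) = (fun s => F (Complex s c)).
  apply/funext => s; rewrite -[RHS]pF; congr F.
  by apply: complex_eqP; rewrite ?ReD ?ImD/= ?addr0.
rewrite subrr add0r => /eqP; rewrite mulf_eq0 subr_eq0 => /orP[|/eqP -> //].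
by move=> /eqP[] /eqP; rewrite oner_eq0.
Qed.

Lemma cmean_strip F s t : entire F ->
  (forall z, F (z + Complex 0 (2 * pi)) = F z) -> 0 <= t <= 2 * pi ->
  cmean (fun x => F (Complex s (x + t))) = cmean (fun x => F (Complex 0 x)).
Proof.
move=> eF pF t02; have cF := entire_continuous eF.
rewrite (@cmean_shift _ (fun x => F (Complex s x)))//; last 2 first.
- exact: ccV.
- move=> x; rewrite -[RHS]pF; congr F.
  by apply: complex_eqP; rewrite ?ReD ?ImD/= ?addr0.
congr (_ * _); rewrite -[X in `[_, X]](add0r (2 * pi)).
exact: periodic_strip.
Qed.

End cauchy.

(** * Taylor coefficients as circle means *)

Section taylor.
Variable R : realType.
Implicit Types (g : R[i] -> R[i]) (r s t : R) (z : R[i]).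

Let pi2_gt0 : 0 < 2 * pi :> R. Proof. by rewrite mulr_gt0// pi_gt0. Qed.

Lemma cis_natM_2pi (k : nat) : cis (k%:R * (2 * pi) : R) = 1.
Proof. by rewrite cis_mulrn cis_2pi expr1n. Qed.

Lemma cis_natNM_2pi (k : nat) : cis (- k%:R * (2 * pi) : R) = 1.
Proof. by rewrite mulNr cisN cis_natM_2pi invr1. Qed.

Lemma ccontinuous_cisM r : ccontinuous (fun t => cis (r * t)).
Proof.
apply: (@ccontinuous_comp _ (@cis R) (fun t => r * t)); first exact: ccontinuous_cis.
by move=> x; apply: cvgM; [exact: cvg_cst|exact: cvg_id].
Qed.

Lemma ccontinuous_circle g z : (forall z, {for z, continuous g}) ->
  ccontinuous (fun t => g (z * cis t)).
Proof.
move=> cg; apply: ccontinuous_compc => //.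
by apply: ccontinuousM; [exact: ccontinuous_cst|exact: ccontinuous_cis].
Qed.

(** The Fourier coefficient of index [-r] of [g] on the circle through [z], with the angle counted
    from [z]. The real [r] treats both signs at once; integrality enters as
    [cis (r * (2 * pi)) = 1]. *)
Definition circle_coef g r z := cmean (fun t => g (z * cis t) * cis (r * t)).

Lemma entire_cst (c : R[i]) : entire (fun=> c).
Proof. by move=> z; exact: differentiable_cst. Qed.

(** The integrand lifts through the exponential to [g (cexp z) * cexp (r z)], which is entire with
    period [2 pi i]; [cmean_strip] then slides the circle of radius [expR s] to the unit circle. *)
Lemma circle_coef_cexp g r s t : entire g -> cis (r * (2 * pi)) = 1 ->
  0 <= t <= 2 * pi ->
  cexp ((r%:C)%C * Complex s t) * circle_coef g r (cexp (Complex s t)) =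
  circle_coef g r 1.
Proof.
move=> eg r2 t02.
pose G z := g (cexp z) * cexp ((r%:C)%C * z).
have eG : entire G.
  by move=> z; apply: differentiableM; apply: differentiable_comp => //; exact: differentiable_cexp.
have cper z : cexp (z + Complex 0 (2 * pi)) = cexp z.
  by rewrite cexpD cexp_cis expR0 mul1r cis_2pi mulr1.
have pG z : G (z + Complex 0 (2 * pi)) = G z.
  rewrite /G cper mulrDr cexpD; congr (_ * _).
  rewrite (_ : (r%:C)%C * Complex 0 (2 * pi) = Complex 0 (r * (2 * pi))); last first.
    by apply: complex_eqP; rewrite ?Re_realM ?Im_realM//= mulr0.
  by rewrite cexp_cis expR0 mul1r r2 mulr1.
have H := @cmean_strip _ G s t eG pG t02.
have cg := entire_continuous eg.
rewrite /circle_coef -cmeanZ; last first.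
  by apply: ccontinuousM; [exact: ccontinuous_circle|exact: ccontinuous_cisM].
have e0 (y : R) : cexp (Complex 0 y) = cis y by rewrite cexp_cis expR0 mul1r.
have rx x : (r%:C)%C * Complex 0 x = Complex 0 (r * x).
  by apply: complex_eqP; rewrite ?Re_realM ?Im_realM//= mulr0.
transitivity (cmean (fun x => G (Complex s (x + t)))); last rewrite H.
  apply: eq_cmean => x; rewrite /G.
  have -> : Complex s (x + t) = Complex s t + Complex 0 x.
    by apply: complex_eqP; rewrite ?ReD ?ImD/= ?addr0 1?addrC.
  by rewrite mulrDr !cexpD rx !e0 mulrCA.
by apply: eq_cmean => x; rewrite /G rx !e0 mul1r.
Qed.

Lemma circle_coef_real g r s : entire g -> cis (r * (2 * pi)) = 1 ->
  circle_coef g r (((expR s)%:C)%C) = ((expR (- (r * s)))%:C)%C * circle_coef g r 1.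
Proof.
move=> eg r2; have t0 : (0 : R) <= 0 <= (2 * pi : R).
  by apply/andP; split => //; exact: ltW.
have := circle_coef_cexp s eg r2 t0.
rewrite (_ : Complex s 0 = (s%:C)%C)// -rmorphM/= !cexp_real => <-.
by rewrite mulrA -rmorphM/= -expRD addNr expR0 mul1r.
Qed.

(** The coefficient of the constant 1 is the same on every circle, yet passing to the radius
    [expR r^-1] multiplies it by [expR (-1)]; so it vanishes. *)
Lemma cmean_cis r : cis (r * (2 * pi)) = 1 -> r != 0 ->
  cmean (fun t => cis (r * t)) = 0.
Proof.
move=> r2 r0.
have H z : circle_coef (fun=> 1) r z = cmean (fun t => cis (r * t)).
  by apply: eq_cmean => t; rewrite mul1r.
have := circle_coef_real r^-1 (entire_cst 1) r2.
rewrite !H mulfV// => /eqP; rewrite -subr_eq0 -[X in X - _]mul1r -mulrBl mulf_eq0.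
case/orP => [|/eqP //]; rewrite subr_eq0 => /eqP/(congr1 (@complex.Re R))/= e.
by have := @expR_lt1 R (-1); rewrite -e ltxx ltrN10.
Qed.

(** As the circle shrinks to 0, the coefficient of [g] tends to that of the constant [g 0]. Combined
    with the scaling law it yields [coef0] and [circle_coef_neg]. *)
Lemma circle_coef0 g : (forall z, {for z, continuous g}) ->
  forall r eps, 0 < eps -> exists2 del : R, 0 < del & forall z, normc z < del ->
    normc (circle_coef g r z - g 0 * cmean (fun t => cis (r * t))) <= 2 * eps.
Proof.
move=> cg r eps eps0.
have [del del0 hd] := (continuous_normcP g 0).1 (cg 0) _ eps0.
exists del => // z zd; rewrite /circle_coef -cmeanZ; last exact: ccontinuous_cisM.
have c1 : ccontinuous (fun t => g (z * cis t) * cis (r * t)).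
  by apply: ccontinuousM; [exact: ccontinuous_circle|exact: ccontinuous_cisM].
have c2 : ccontinuous (fun t => g 0 * cis (r * t)).
  by apply: ccontinuousM; [exact: ccontinuous_cst|exact: ccontinuous_cisM].
rewrite -cmeanB//; apply: normc_cmean_le.
  exact: ccontinuousB.
move=> t _; rewrite -mulrBl normcM normc_cis mulr1 ltW// hd//.
by rewrite subr0 normcM normc_cis mulr1.
Qed.

Lemma small_expR (del : R) : 0 < del -> exists s, forall s', s' <= s -> expR s' < del.
Proof.
move=> d0; exists (ln (del / 2)) => s' /=; rewrite -ler_expR lnK ?posrE ?divr_gt0//.
by move=> /le_lt_trans; apply; lra.
Qed.

Definition coef g (m : nat) := circle_coef g (- m%:R) 1.

Lemma coef0 g : entire g -> coef g 0 = g 0.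
Proof.
move=> eg; apply/eqP; rewrite -subr_eq0 -normc_eq0 eq_le normc_ge0 andbT.
apply/ler_addgt0Pr => e e0; rewrite add0r.
have e2 : 0 < e / 2 by rewrite divr_gt0.
have [del del0 hd] := circle_coef0 (entire_continuous eg) (- 0%:R) e2.
have [s hs] := small_expR del0.
have := hd (((expR s)%:C)%C); rewrite normc_real ger0_norm ?expR_ge0// => /(_ (hs _ (lexx _))).
rewrite circle_coef_real//; last by rewrite oppr0 mul0r cis0.
rewrite oppr0 mul0r oppr0 expR0 mul1r /coef oppr0.
rewrite (@eq_cmean _ _ (fun=> 1)) ?cmean_cst ?mulr1; last first.
  by move=> t; rewrite mul0r cis0.
by move=> /le_trans; apply; lra.
Qed.

Lemma circle_coefE g (m : nat) z : entire g ->
  circle_coef g (- m%:R) z = z ^+ m * coef g m.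
Proof.
move=> eg; have [->|z0] := eqVneq z 0.
  rewrite /circle_coef (@eq_cmean _ _ (fun t => g 0 * cis (- m%:R * t))); last first.
    by move=> t; rewrite mul0r.
  rewrite cmeanZ; last exact: ccontinuous_cisM.
  case: m => [|m].
    rewrite expr0 mul1r coef0// (@eq_cmean _ _ (fun=> 1)) ?cmean_cst ?mulr1//.
    by move=> t; rewrite oppr0 mul0r cis0.
  by rewrite cmean_cis ?cis_natNM_2pi ?oppr_eq0 ?pnatr_eq0// mulr0 expr0n mul0r.
have [s [t [t02 ->]]] := polar_form z0.
rewrite /coef -(circle_coef_cexp s eg (cis_natNM_2pi m) t02) mulrA.
rewrite (_ : cexp _ ^+ m * _ = 1) ?mul1r//.
have -> : cexp (Complex s t) ^+ m = cexp ((m%:R%:C)%C * Complex s t).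
  elim: m => [|m ih]; first by rewrite expr0 mul0r cexp0.
  by rewrite exprSr ih -cexpD -[X in _ * _ + X]mul1r -mulrDl -natr1 rmorphD/= rmorph1.
by rewrite -cexpD -mulrDl -rmorphD/= subrr mul0r cexp0.
Qed.

(** On a small circle the coefficient is the one at radius 1 multiplied by a large factor, but it
    must also be small since the mean of [cis (k * t)] is 0. *)
Lemma circle_coef_neg g (k : nat) : entire g -> (0 < k)%N -> circle_coef g k%:R 1 = 0.
Proof.
move=> eg k0; apply/eqP; rewrite -normc_eq0 eq_le normc_ge0 andbT.
apply/ler_addgt0Pr => e e0; rewrite add0r.
have [del del0 hd] := circle_coef0 (entire_continuous eg) k%:R e0.
have [s hs] := small_expR del0.
(* With [s' <= -1] the growth factor is at least [expR 1 >= 2], which absorbs the 2 in the bound of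
   [circle_coef0]. *)
pose s' := Num.min s (-1).
have s'0 : s' < 0 by rewrite gt_min ltrN10 orbT.
have s'1 : s' <= -1 by rewrite ge_min lexx orbT.
have := hd (((expR s')%:C)%C); rewrite normc_real ger0_norm ?expR_ge0//.
rewrite hs ?ge_min ?lexx// => /(_ isT).
rewrite cmean_cis ?cis_natM_2pi ?pnatr_eq0 -?lt0n// mulr0 subr0.
rewrite circle_coef_real ?cis_natM_2pi// normcM normc_real ger0_norm ?expR_ge0// => h.
have e2 : 2 <= expR (- (k%:R * s')).
  have : expR 1 <= expR (- (k%:R * s')).
    rewrite ler_expR -mulrN.
    have k1 : (1 : R) <= k%:R by rewrite ler1n.
    by nra.
  by have := @expR_ge1Dx R 1; lra.
have n0 := normc_ge0 (circle_coef g k%:R 1).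
rewrite -(ler_pM2l (_ : (0 : R) < 2))//; apply: le_trans h.
by rewrite ler_wpM2r.
Qed.

End taylor.

(** * The Riemann-Lebesgue lemma *)

Section riemann_lebesgue.
Variable R : realType.
Local Notation mu := (@lebesgue_measure R).
Implicit Types u : R -> R[i].

Let pi2_gt0 : 0 < 2 * pi :> R. Proof. by rewrite mulr_gt0// pi_gt0. Qed.

Let shift_modulus u : ccontinuous u ->
  (fun k => \int[mu]_(t in `[0, 2 * pi]) normc (u t - u (t + pi / k.+1%:R))) @ \oo --> 0.
Proof.
move=> cu; pose nu t := normc (u t).
have cnu : continuous nu := ccontinuous_normc cu.
(* The shifts are at most [pi], so [[0, 3 * pi]] contains every point where [u] is evaluated; its
   maximum there dominates. *)
have pi3 : (0 : R) <= 3 * pi by rewrite mulr_ge0// pi_ge0.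
have [x0 _ Bu] := EVT_max pi3 (continuous_subspaceT cnu).
pose B := nu x0.
have cshift k : ccontinuous (fun t => u t - u (t + pi / k.+1%:R)).
  apply: ccontinuousB => //; apply: (@ccontinuous_comp _ u) => // x.
  by apply: cvgD; [exact: cvg_id|exact: cvg_cst].
have H := @dominated_cvg _ _ R mu `[0, 2 * pi] _
  (fun k t => (normc (u t - u (t + pi / k.+1%:R)))%:E) (cst 0%E) (cst (2 * B)%:E).
suff : (\int[mu]_(t in `[0%R, (2 * pi)%R]) (normc (u t - u (t + pi / k.+1%:R)))%:E @[k --> \oo] --> (0 : \bar R))%E.
  by move=> /fine_cvg.
rewrite -[X in _ --> X](integral0 mu `[0, 2 * pi]); apply: H => //.
- move=> k; apply/measurable_EFinP; apply: (measurable_funS measurableT) => //.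
  exact: continuous_measurable_fun (ccontinuous_normc (cshift k)).
- move=> t _; rewrite [X in _ --> X](_ : _ = (0 : R)%:E)//; apply/fine_cvgP; split; first by near=> k.
  apply/cvgrPdist_lt => eps eps0.
  have [del del0 hd] := (ccontinuous_normcP u).1 cu t _ eps0.
  near=> k; rewrite sub0r normrN ger0_norm ?normc_ge0//= normcB hd//.
  rewrite addrAC subrr add0r ger0_norm ?divr_ge0 ?pi_ge0//.
  rewrite ltr_pdivrMr// mulrC -ltr_pdivrMr//.
  apply: lt_le_trans (truncnS_gt _) _; rewrite ler_nat ltnS.
  by near: k; exact: nbhs_infty_ge.
- by apply: (@continuous_integrable_itv _ (fun=> 2 * B)) => x; exact: cvg_cst.
- move=> k t /=; rewrite in_itv/= => /andP[t0 t2]; rewrite lee_fin ger0_norm ?normc_ge0//.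
  have k1 : pi / k.+1%:R <= (pi : R).
    by rewrite ler_pdivrMr// ler_peMr ?pi_ge0// ler1n.
  have k0 : 0 <= pi / k.+1%:R :> R by rewrite divr_ge0// pi_ge0.
  have e3 : 3 * pi = 2 * pi + pi :> R by ring.
  have n1 : normc (u t) <= B.
    by apply: Bu; rewrite in_itv/= t0/= (le_trans t2)// e3 lerDl pi_ge0.
  have n2 : normc (u (t + pi / k.+1%:R)) <= B.
    by apply: Bu; rewrite in_itv/= addr_ge0//= e3 lerD.
  have e2 : 2 * B = B + B by ring.
  by rewrite /cst e2 (le_trans (ler_normcB _ _))// lerD.
Unshelve. all: end_near. Qed.

(** Shifting by [pi / k.+1] changes the sign of the character, so twice the coefficient is the mean
    of [u t - u (t + pi / k.+1)] against it, and [shift_modulus] applies. The boolean selects the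
    sign of the frequency. *)
Lemma riemann_lebesgue u (sg : bool) : ccontinuous u -> (forall t, u (t + 2 * pi) = u t) ->
  forall eps, 0 < eps -> \forall k \near \oo,
    normc (cmean (fun t => u t * cis ((-1) ^+ sg * k.+1%:R * t))) < eps.
Proof.
move=> cu pu eps eps0.
have /cvgrPdist_lt/(_ _ (_ : 0 < eps * pi)) := shift_modulus cu.
rewrite mulr_gt0 ?pi_gt0// => /(_ isT); apply: filterS => k.
rewrite sub0r normrN => Hk.
set r := (-1) ^+ sg * k.+1%:R.
have r2 : cis (r * (2 * pi)) = 1.
  by rewrite /r; case: (sg); rewrite ?expr1 ?expr0 ?mulN1r ?mul1r ?cis_natNM_2pi ?cis_natM_2pi.
pose h : R := pi / k.+1%:R.
have rh : cis (r * h) = -1.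
  rewrite /r /h -mulrA [_%:R * _]mulrC divfK ?pnatr_eq0//.
  by case: (sg); rewrite ?expr1 ?expr0 ?mulN1r ?mul1r ?cisN cis_pi// invrN1.
have h02 : 0 <= h <= 2 * pi.
  have : h <= pi by rewrite ler_pdivrMr// ler_peMr ?pi_ge0// ler1n.
  have : 0 <= h by rewrite divr_ge0// pi_ge0.
  by have := pi_ge0 R; lra.
have cush : ccontinuous (fun t => u (t + h)).
  by apply: (@ccontinuous_comp _ u) => // x; apply: cvgD; [exact: cvg_id|exact: cvg_cst].
have cr := ccontinuous_cisM r.
have c1 := ccontinuousM cu cr; have c2 := ccontinuousM cush cr.
set c := cmean _.
have E : c = - cmean (fun t => u (t + h) * cis (r * t)).
  rewrite /c -(cmean_shift c1 _ h02); last first.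
    by move=> t; rewrite pu mulrDr cisD r2 mulr1.
  rewrite -mulN1r -cmeanZ//; apply: eq_cmean => t.
  by rewrite mulrDr cisD rh mulrN1 mulrN mulN1r.
have D : 2 * c = cmean (fun t => (u t - u (t + h)) * cis (r * t)).
  under eq_cmean do rewrite mulrBl.
  by rewrite cmeanB// -/c mulr2n mulrDl mul1r {2}E.
have cd : ccontinuous (fun t => u t - u (t + h)) by exact: ccontinuousB.
have : normc (2 * c) < 2 * eps.
  rewrite D /cmean normcM normc_real ger0_norm ?invr_ge0 ?(ltW pi2_gt0)//.
  rewrite mulrC ltr_pdivrMr//.
  have cc := ccontinuousM cd cr.
  have := @normc_cint_le _ _ _ mu `[0, 2 * pi] _ (fun t => normc (u t - u (t + h)))
    (measurable_itv _) (ccontinuous_cintegrable 0 (2 * pi) cc)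
    (continuous_integrable_itv 0 (2 * pi) (ccontinuous_normc cd)).
  move=> H; apply: le_lt_trans (H _) _.
    by move=> t _; rewrite normcM normc_cis mulr1.
  have := le_lt_trans (ler_norm _) Hk; rewrite -/h.
  set I := Rintegral _ _ _ => HI.
  rewrite (_ : 2 * eps * (2 * pi) = 2 * (2 * (eps * pi))); last by ring.
  rewrite ltr_pM2l//; have := mulr_gt0 eps0 (pi_gt0 R); lra.
rewrite normcM (_ : normc 2 = 2) ?ltr_pM2l//.
by rewrite -[2](rmorph_nat (real_complex R)) normc_real ger0_norm.
Qed.

End riemann_lebesgue.

(** * Convergence of the Taylor series *)

Section taylor_convergence.
Variable R : realType.
Implicit Types g : R[i] -> R[i].

(** Differentiability at 1 is what extends the difference quotient continuously to that point. *)
Lemma difference_quotient g : entire g -> exists q : R[i] -> R[i],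
  (forall z, {for z, continuous q}) /\ forall z, g z - g 1 = (z - 1) * q z.
Proof.
move=> eg; have [L hL] := (differentiable_normcP g 1).1 (eg 1).
pose q z := if z == 1 then L else (g z - g 1) / (z - 1).
exists q; split; last first.
  move=> z; rewrite /q; case: eqVneq => [->|z1]; first by rewrite !subrr mul0r.
  by rewrite mulrC divfK// subr_eq0.
move=> z; apply/continuous_normcP => eps eps0; have [->|z1] := eqVneq z 1.
  have e2 : 0 < eps / 2 by rewrite divr_gt0.
  have [del del0 hd] := hL _ e2; exists del => // w wd.
  rewrite /q eqxx; case: eqVneq => [_|w1]; first by rewrite subrr normc0.
  have n0 : 0 < normc (w - 1) by rewrite normc_gt0 subr_eq0.
  have := hd _ wd; rewrite (addrC 1) subrK => h.
  rewrite (_ : _ - L = (g w - g 1 - L * (w - 1)) / (w - 1)); last first.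
    by rewrite [RHS]mulrBl mulfK// subr_eq0.
  rewrite normcM normcV ltr_pdivrMr//; apply: le_lt_trans h _.
  by rewrite ltr_pM2r//; lra.
have cq : {for z, continuous (fun z => (g z - g 1) * (z - 1)^-1)}.
  apply: differentiable_continuous; apply: differentiableM.
    exact: (differentiableB (eg z) (differentiable_cst (g 1) z)).
  apply: differentiableV; last by rewrite subr_eq0.
  have dz : differentiable (id : R[i] -> R[i]) z by [].
  exact: (differentiableB dz (differentiable_cst (1 : R[i]) z)).
have [del del0 hd] := (continuous_normcP _ z).1 cq _ eps0.
exists (Num.min del (normc (z - 1))).
  by rewrite lt_min del0 normc_gt0 subr_eq0.
move=> w; rewrite lt_min => /andP[wd wz].
have w1 : w != 1 by apply: contraTneq wz => ->; rewrite normcB ltxx.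
by rewrite /q (negbTE z1) (negbTE w1) hd.
Qed.

(* With [g z - g 1 = q z * (z - 1)] and [q] continuous, the difference between the
   partial sum and [g 1] telescopes to a single Fourier coefficient of [q] on the
   circle, which the Riemann-Lebesgue lemma sends to 0. *)
Lemma coef_sum_cvg g : entire g -> forall eps, 0 < eps ->
  \forall N \near \oo, normc (\sum_(m < N) coef g m - g 1) < eps.
Proof.
move=> eg; have [q [cq gq]] := difference_quotient eg.
have cg := entire_continuous eg.
pose u t := q (cis t).
have cu : ccontinuous u by apply: ccontinuous_compc => //; exact: ccontinuous_cis.
have pu t : u (t + 2 * pi) = u t by rewrite /u cis_period.
pose c r := cmean (fun t => u t * cis (r * t)).
have tele r : circle_coef g r 1 - g 1 * cmean (fun t => cis (r * t)) = c (r + 1) - c r.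
  have cr := ccontinuous_cisM r; have cr1 := ccontinuous_cisM (r + 1).
  have d1 := ccontinuousM (ccontinuous_circle 1 cg) cr.
  have d2 := ccontinuousM (ccontinuous_cst (g 1)) cr.
  have d3 := ccontinuousM cu cr1; have d4 := ccontinuousM cu cr.
  rewrite /circle_coef /c -cmeanZ// -!cmeanB//.
  apply: eq_cmean => t; rewrite -mulrBl mul1r gq.
  have -> : (r + 1) * t = r * t + t by ring.
  by rewrite cisD /u; ring.
have RL sg := riemann_lebesgue sg cu pu.
(* By [tele] and [circle_coef_neg], [c] is constant on the positive integers; the Riemann-Lebesgue
   lemma forces that constant to be 0. *)
have ck (k : nat) : c k.+1%:R = c 1.
  elim: k => // k <-; apply/eqP; rewrite -subr_eq0 -natr1 -tele.
  by rewrite circle_coef_neg// cmean_cis ?cis_natM_2pi ?pnatr_eq0// mulr0 subr0.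
have c1 : c 1 = 0.
  apply/eqP; rewrite -normc_eq0 eq_le normc_ge0 andbT.
  apply/ler_addgt0Pr => e e0; rewrite add0r ltW//.
  have [N _ hN] := RL false e e0.
  have := hN N (leqnn N); rewrite expr0.
  by under eq_cmean do rewrite mul1r; rewrite -/(c _) ck.
have S N : \sum_(m < N.+1) coef g m - g 1 = - c (- N%:R).
  elim: N => [|N ih].
    rewrite big_ord1 /coef oppr0; have := tele 0; rewrite add0r c1 sub0r.
    rewrite (@eq_cmean _ _ (fun=> 1)) ?cmean_cst ?mulr1//.
    by move=> t; rewrite mul0r cis0.
  rewrite big_ord_recr/= addrAC ih /coef; have := tele (- N.+1%:R).
  rewrite cmean_cis ?cis_natNM_2pi ?oppr_eq0 ?pnatr_eq0// mulr0 subr0 => ->.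
  by rewrite -natr1 opprD subrK addrA addNr add0r.
move=> eps eps0; have [N _ hN] := RL true eps eps0.
exists N.+2 => // -[|[|k]]//= kN; rewrite S normcN.
by have := hN k kN; rewrite expr1; under eq_cmean do rewrite mulN1r; rewrite -/(c _).
Qed.

End taylor_convergence.

(** * Unitary changes of variables *)

Section product_preserving.
Context d1 d2 (T1 : measurableType d1) (T2 : measurableType d2) (R : realType).
Variables (mu : {sigma_finite_measure set T1 -> \bar R})
          (nu : {sigma_finite_measure set T2 -> \bar R}).

Lemma prodm1E (A : set (T1 * T2)) :
  prodm mu nu A = (\int[mu]_x nu (xsection A x))%E.
Proof. by []. Qed.

Lemma prodm2E (A : set (T1 * T2)) : measurable A ->
  prodm mu nu A = (\int[nu]_y mu (ysection A y))%E.
Proof.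
move=> mA; rewrite -[RHS]/((mu \x^ nu)%E A).
by apply: product_measure_unique => // B C mB mC/=; rewrite product_measure2E.
Qed.

(** Slice by slice: the section of the preimage over [x] is the preimage under [phi x] of the
    section. *)
Lemma preserving_skew1 (phi : T1 -> T2 -> T2) :
  measurable_fun setT (fun p : T1 * T2 => phi p.1 p.2) ->
  (forall x, preserving nu (phi x)) ->
  preserving (prodm mu nu) (fun p => (p.1, phi p.1 p.2)).
Proof.
move=> mphi pphi; have mf : measurable_fun setT (fun p : T1 * T2 => (p.1, phi p.1 p.2)).
  exact: measurable_fun_pair.
split => // A mA; rewrite /= !prodm1E; apply: eq_integral => x _.
rewrite -((pphi x).2 (xsection A x)); last exact: measurable_xsection.
congr (nu _); apply/seteqP; split => y; rewrite /xsection/= !inE//.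
Qed.

Lemma preserving_skew2 (psi : T2 -> T1 -> T1) :
  measurable_fun setT (fun p : T1 * T2 => psi p.2 p.1) ->
  (forall y, preserving mu (psi y)) ->
  preserving (prodm mu nu) (fun p => (psi p.2 p.1, p.2)).
Proof.
move=> mpsi ppsi; have mf : measurable_fun setT (fun p : T1 * T2 => (psi p.2 p.1, p.2)).
  exact: measurable_fun_pair.
split => // A mA; rewrite /= !prodm2E//; last by rewrite -[X in measurable X]setTI; exact: mf.
apply: eq_integral => y _.
rewrite -((ppsi y).2 (ysection A y)); last exact: measurable_ysection.
congr (mu _); apply/seteqP; split => x; rewrite /ysection/= !inE//.
Qed.

End product_preserving.

Section consm_preserving.
Context d (T : measurableType d) (R : realType) (n : nat).
Variables (mu : {sigma_finite_measure set T -> \bar R})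
          (nu : {sigma_finite_measure set (n.-tuple T) -> \bar R}).

Lemma tuncons_K : cancel (@tuncons d T n) (@tcons d T n).
Proof. by move=> t; rewrite /tcons /tuncons/= -tuple_eta. Qed.

Lemma preserving_consm (f : T * n.-tuple T -> T * n.-tuple T) :
  preserving (prodm mu nu) f ->
  preserving (consm mu nu) (@tcons d T n \o f \o @tuncons d T n).
Proof.
move=> [mf pf]; split.
  apply: measurableT_comp; last exact: measurable_tuncons.
  by apply: measurableT_comp => //; exact: measurable_tcons.
move=> A mA; have mA' : measurable (@tcons d T n @^-1` A).
  by rewrite -[X in measurable X]setTI; exact: measurable_tcons.
rewrite /= /consm /pushforward; have /= <- := pf _ mA'.
congr (prodm mu nu _); apply/seteqP; split => x /=; rewrite tconsK//.
Qed.

End consm_preserving.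

Section plane_maps.
Variable R : realType.
Local Notation RR := (measurableTypeR R * measurableTypeR R)%type.
Local Notation leb2 := (prodm (@lebesgue_measure R) (@lebesgue_measure R)).
Implicit Types (c : R[i]) (p q : RR).

Definition toC p : R[i] := Complex p.1 p.2.
Definition ofC c : RR := (Re c, Im c).

Lemma ofCK : cancel ofC toC. Proof. by case. Qed.
Lemma toCK : cancel toC ofC. Proof. by case. Qed.

Lemma measurable_ofC d (T : measurableType d) (f : T -> R[i]) :
  cmeasurable setT f -> measurable_fun setT (fun x => ofC (f x)).
Proof. by move=> [f1 f2]; exact: measurable_fun_pair. Qed.

Lemma cmeasurable_toC d (T : measurableType d) (f : T -> RR) :
  measurable_fun setT f -> cmeasurable setT (fun x => toC (f x)).
Proof.
by move=> mf; split => /=; [exact: (measurableT_comp measurable_fst)|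
  exact: (measurableT_comp measurable_snd)].
Qed.

Lemma preserving_eq d (T : measurableType d) (mu : {measure set T -> \bar R}) f g :
  f =1 g -> preserving mu f -> preserving mu g.
Proof. by move=> /funext ->. Qed.

Lemma preserving_translation c : preserving leb2 (fun p => ofC (toC p + c)).
Proof.
have h1 : preserving leb2 (fun p => (p.1, p.2 + Im c)).
  apply: (@preserving_skew1 _ _ (measurableTypeR R) (measurableTypeR R) R lebesgue_measure lebesgue_measure (fun=> fun y => y + Im c)).
    by apply: measurable_funD => //; exact: measurable_cst.
  by move=> _; exact: preserving_addr.
have h2 : preserving leb2 (fun p => (p.1 + Re c, p.2)).
  apply: (@preserving_skew2 _ _ (measurableTypeR R) (measurableTypeR R) R lebesgue_measure lebesgue_measure (fun=> fun y => y + Re c)).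
    by apply: measurable_funD => //; exact: measurable_cst.
  by move=> _; exact: preserving_addr.
apply: preserving_eq (preserving_comp h1 h2) => -[x y] /=.
by rewrite /ofC ReD ImD.
Qed.

(** For [c = cos theta + i sin theta] off the real line, the rotation is a product of three shears;
    the repeated coefficient [(a - 1) / b] is [- tan (theta / 2)]. Of the two real cases, 1 is the
    identity and -1 is the square of [i]. *)
Lemma preserving_rotation c : normc c = 1 -> preserving leb2 (fun p => ofC (c * toC p)).
Proof.
have sh1 (k : R) : preserving leb2 (fun p => (p.1, p.2 + k * p.1)).
  apply: (@preserving_skew1 _ _ (measurableTypeR R) (measurableTypeR R) R lebesgue_measure lebesgue_measure (fun x y => y + k * x)).
    by apply: measurable_funD => //; apply: measurable_funM => //; exact: measurable_cst.
  by move=> x; exact: preserving_addr.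
have sh2 (k : R) : preserving leb2 (fun p => (p.1 + k * p.2, p.2)).
  apply: (@preserving_skew2 _ _ (measurableTypeR R) (measurableTypeR R) R lebesgue_measure lebesgue_measure (fun x y => y + k * x)).
    by apply: measurable_funD => //; apply: measurable_funM => //; exact: measurable_cst.
  by move=> x; exact: preserving_addr.
have H : forall c, normc c = 1 -> Im c != 0 -> preserving leb2 (fun p => ofC (c * toC p)).
  move=> [a b] /(congr1 (fun x => x ^+ 2)); rewrite sqr_normcE/= expr1n => ab b0.
  have := preserving_comp (sh2 ((a - 1) / b)) (preserving_comp (sh1 b) (sh2 ((a - 1) / b))).
  apply: preserving_eq => -[x y]; rewrite /ofC/=.
  have E : b ^+ 2 = 1 - a ^+ 2 by rewrite -ab addrAC subrr add0r.
  congr pair.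
    have -> : x + (a - 1) / b * y + (a - 1) / b * (y + b * (x + (a - 1) / b * y)) =
      a * x + (a ^+ 2 - 1) / b * y by field.
    by rewrite -opprB -E mulNr mulNr expr2 mulfK.
  by field.
move=> c1; have [b0|b0] := eqVneq (Im c) 0; last exact: H.
have a2 : Re c ^+ 2 = 1.
  by move: c1 => /(congr1 (fun x => x ^+ 2)); rewrite sqr_normcE b0 expr0n addr0 expr1n.
have hi : preserving leb2 (fun p => ofC ('i%C * toC p)).
  by apply: H; rewrite ?oner_neq0// normc_def'/= expr0n add0r expr1n sqrtr1.
move/eqP: a2; rewrite sqrf_eq1 => /orP[/eqP a1|/eqP a1].
  apply: preserving_eq (preserving_id leb2) => p /=.
  by rewrite (_ : c = 1) ?mul1r ?toCK//; exact: complex_eqP.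
apply: preserving_eq (preserving_comp hi hi) => p /=.
rewrite ofCK mulrA (_ : c = 'i%C * 'i%C)//.
by apply: complex_eqP; rewrite ?ReM ?ImM/= ?a1 ?b0; ring.
Qed.

End plane_maps.

Section rows.
Variable R : realType.
Local Notation C := R[i].
Local Notation RR := (measurableTypeR R * measurableTypeR R)%type.

(** Prepends a coordinate at index 0, so as to correspond to [tcons] under [Cn_of]. *)
Definition rcons0 n (z : C) (v : 'rV[C]_n) : 'rV[C]_n.+1 :=
  \row_j oapp (v 0) z (unlift ord0 j).

Definition rtl n (v : 'rV[C]_n.+1) : 'rV[C]_n := \row_k v 0 (lift ord0 k).

Lemma rcons0_hd n z (v : 'rV[C]_n) : rcons0 z v 0 0 = z.
Proof. by rewrite mxE unlift_none. Qed.

Lemma rcons0_lift n z (v : 'rV[C]_n) k : rcons0 z v 0 (lift ord0 k) = v 0 k.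
Proof. by rewrite mxE liftK. Qed.

Lemma rtlK n z (v : 'rV[C]_n) : rtl (rcons0 z v) = v.
Proof. by apply/rowP => k; rewrite mxE rcons0_lift. Qed.

Lemma rcons0_eta n (v : 'rV[C]_n.+1) : rcons0 (v 0 0) (rtl v) = v.
Proof. by apply/rowP => k; rewrite mxE; case: unliftP => [j|] ->//=; rewrite mxE. Qed.

Lemma rcons0D n a b (u v : 'rV[C]_n) : rcons0 a u + rcons0 b v = rcons0 (a + b) (u + v).
Proof. by apply/rowP => k; rewrite !mxE; case: unliftP => [j _|_]//=; rewrite mxE. Qed.

Lemma rcons0Z n c a (u : 'rV[C]_n) : c *: rcons0 a u = rcons0 (c * a) (c *: u).
Proof. by apply/rowP => k; rewrite !mxE; case: unliftP => [j _|_]//=; rewrite mxE. Qed.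

Lemma cdot_rcons0 n a b (u v : 'rV[C]_n) :
  cdot (rcons0 a u) (rcons0 b v) = a * b^* + cdot u v.
Proof.
rewrite /cdot big_ord_recl !rcons0_hd; congr (_ + _).
by apply: eq_bigr => k _; rewrite !rcons0_lift.
Qed.

Lemma cdotZl n c (u w : 'rV[C]_n) : cdot (c *: u) w = c * cdot u w.
Proof. by rewrite /cdot mulr_sumr; apply: eq_bigr => k _; rewrite mxE mulrA. Qed.

Lemma conj_cdot n (u v : 'rV[C]_n) : (cdot u v)^* = cdot v u.
Proof.
by rewrite /cdot rmorph_sum/=; apply: eq_bigr => k _; rewrite rmorphM/= conjCK mulrC.
Qed.

Lemma cdot0l n (w : 'rV[C]_n) : cdot 0 w = 0.
Proof. by rewrite -(scale0r (0 : 'rV[C]_n)) cdotZl mul0r. Qed.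

Lemma cdotZr n c (u w : 'rV[C]_n) : cdot u (c *: w) = c^* * cdot u w.
Proof. by rewrite -conj_cdot cdotZl rmorphM/= conj_cdot. Qed.

Lemma normsq_rcons0 n a (u : 'rV[C]_n) : normsq (rcons0 a u) = normc a ^+ 2 + normsq u.
Proof. by rewrite /normsq cdot_rcons0 ReD mulJc. Qed.

Lemma normsq_ge0 n (u : 'rV[C]_n) : 0 <= normsq u.
Proof.
elim: n u => [|n ih] u; first by rewrite /normsq /cdot big_ord0.
by rewrite -(rcons0_eta u) normsq_rcons0 addr_ge0// sqr_ge0.
Qed.

Lemma cdot_normsq n (u : 'rV[C]_n) : cdot u u = ((normsq u)%:C)%C.
Proof.
apply: complex_eqP => //=; have := congr1 (@complex.Im R) (conj_cdot u u).
by rewrite Im_conj; lra.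
Qed.

Lemma Cn_of_tcons n (x : RR) (t : n.-tuple RR) :
  Cn_of (tcons (x, t)) = rcons0 (toC x) (Cn_of t).
Proof.
apply/rowP => k; rewrite !mxE; case: unliftP => [j|] ->/=; last by rewrite tnth0.
by rewrite mxE tnthS.
Qed.

Lemma Cn_of_tuncons n (t : n.+1.-tuple RR) :
  Cn_of t = rcons0 (toC (tuncons t).1) (Cn_of (tuncons t).2).
Proof. by rewrite -Cn_of_tcons -surjective_pairing tuncons_K. Qed.

End rows.

Section unitary_maps.
Variable R : realType.
Local Notation C := R[i].
Local Notation RR := (measurableTypeR R * measurableTypeR R)%type.
Local Notation leb2 := (prodm (@lebesgue_measure R) (@lebesgue_measure R)).

(** Integrals are taken over tuples of real pairs while linear algebra happens on row vectors; a
    unitary map is therefore a pair [T], [L] intertwined by [Cn_of]. *)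
Definition unitary_map n (T : n.-tuple RR -> n.-tuple RR) (L : 'rV[C]_n -> 'rV[C]_n) :=
  [/\ preserving (lebesgueC R n) T, forall t, Cn_of (T t) = L (Cn_of t),
      forall a u v, L (a *: u + v) = a *: L u + L v &
      forall u v, cdot (L u) (L v) = cdot u v].

Lemma unitary_map_id n : @unitary_map n id id.
Proof. by split => //; exact: preserving_id. Qed.

Lemma unitary_map_comp n T1 L1 T2 L2 : @unitary_map n T1 L1 -> unitary_map T2 L2 ->
  unitary_map (T1 \o T2) (L1 \o L2).
Proof.
move=> [p1 c1 l1 d1] [p2 c2 l2 d2]; split.
- exact: preserving_comp.
- by move=> t /=; rewrite c1 c2.
- by move=> a u v /=; rewrite l2 l1.
- by move=> u v /=; rewrite d1 d2.
Qed.

Lemma unitary_map_cons n T L : @unitary_map n T L ->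
  @unitary_map n.+1 (fun t => tcons ((tuncons t).1, T (tuncons t).2))
                    (fun v => rcons0 (v 0 0) (L (rtl v))).
Proof.
move=> [p c l d]; split.
- apply: (@preserving_consm _ _ R n leb2 (lebesgueC R n) (fun p => (p.1, T p.2))).
  apply: (@preserving_skew1 _ _ _ _ R leb2 (lebesgueC R n) (fun=> T)) => //.
  by apply: measurableT_comp; [exact: p.1|exact: measurable_snd].
- by move=> t; rewrite Cn_of_tcons c [in RHS]Cn_of_tuncons rcons0_hd rtlK.
- move=> a u v; rewrite rcons0Z rcons0D -l; congr rcons0; first by rewrite !mxE.
  by congr L; apply/rowP => k; rewrite !mxE.
- move=> u v; rewrite cdot_rcons0 d -cdot_rcons0.
  by rewrite !rcons0_eta.
Qed.

Lemma unitary_map_phase n (c : C) : normc c = 1 ->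
  @unitary_map n.+1 (fun t => tcons (ofC (c * toC (tuncons t).1), (tuncons t).2))
                    (fun v => rcons0 (c * v 0 0) (rtl v)).
Proof.
move=> c1; have [mr pr] := preserving_rotation c1; split.
- apply: (@preserving_consm _ _ R n leb2 (lebesgueC R n) (fun p => (ofC (c * toC p.1), p.2))).
  apply: (@preserving_skew2 _ _ _ _ R leb2 (lebesgueC R n) (fun=> fun x => ofC (c * toC x))) => //.
  by apply: (measurableT_comp mr); exact: measurable_fst.
- by move=> t; rewrite Cn_of_tcons ofCK [in RHS]Cn_of_tuncons rcons0_hd rtlK.
- move=> a u v; rewrite rcons0Z rcons0D; congr rcons0; first by rewrite !mxE; ring.
  by apply/rowP => k; rewrite !mxE.
- move=> u v; rewrite cdot_rcons0 rmorphM/= mulrACA mulJc c1 expr1n mul1r.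
  by rewrite -cdot_rcons0 !rcons0_eta.
Qed.

Lemma measurable_head n : measurable_fun setT (fun t : n.+1.-tuple RR => (tuncons t).1).
Proof. exact: (measurableT_comp measurable_fst (@measurable_tuncons _ _ n)). Qed.

Lemma measurable_tail n : measurable_fun setT (fun t : n.+1.-tuple RR => (tuncons t).2).
Proof. exact: (measurableT_comp measurable_snd (@measurable_tuncons _ _ n)). Qed.

Let shear12 n (c : C) (t : n.+2.-tuple RR) : n.+2.-tuple RR :=
  tcons (ofC (toC (tuncons t).1 + c * toC (tuncons (tuncons t).2).1), (tuncons t).2).

Let shear21 n (c : C) (t : n.+2.-tuple RR) : n.+2.-tuple RR :=
  tcons ((tuncons t).1, tcons (ofC (toC (tuncons (tuncons t).2).1 + c * toC (tuncons t).1),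
                               (tuncons (tuncons t).2).2)).

Let preserving_shear12 n c : preserving (lebesgueC R n.+2) (@shear12 n c).
Proof.
apply: (@preserving_consm _ _ R n.+1 leb2 (lebesgueC R n.+1)
  (fun p => (ofC (toC p.1 + c * toC (tuncons p.2).1), p.2))).
apply: (@preserving_skew2 _ _ _ _ R leb2 (lebesgueC R n.+1)
  (fun s x => ofC (toC x + c * toC (tuncons s).1))).
  apply: measurable_ofC; apply: cmeasurableD.
    by apply: cmeasurable_toC; exact: measurable_fst.
  apply: cmeasurableM; first exact: cmeasurable_cst.
  apply: cmeasurable_toC; apply: (measurableT_comp (@measurable_head n)).
  exact: measurable_snd.
by move=> s; exact: preserving_translation.
Qed.

Let preserving_shear21 n c : preserving (lebesgueC R n.+2) (@shear21 n c).
Proof.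
apply: (@preserving_consm _ _ R n.+1 leb2 (lebesgueC R n.+1)
  (fun p => (p.1, tcons (ofC (toC (tuncons p.2).1 + c * toC p.1), (tuncons p.2).2)))).
apply: (@preserving_skew1 _ _ _ _ R leb2 (lebesgueC R n.+1)
  (fun x s => tcons (ofC (toC (tuncons s).1 + c * toC x), (tuncons s).2))).
  apply: (measurableT_comp (@measurable_tcons _ _ n)).
  apply: measurable_fun_pair.
    apply: measurable_ofC; apply: cmeasurableD.
      apply: cmeasurable_toC; apply: (measurableT_comp (@measurable_head n)).
      exact: measurable_snd.
    apply: cmeasurableM; first exact: cmeasurable_cst.
    by apply: cmeasurable_toC; exact: measurable_fst.
  apply: (measurableT_comp (@measurable_tail n)).
  exact: measurable_snd.
move=> x.
apply: (@preserving_consm _ _ R n leb2 (lebesgueC R n)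
  (fun p => (ofC (toC p.1 + c * toC x), p.2))).
apply: (@preserving_skew2 _ _ _ _ R leb2 (lebesgueC R n)
  (fun _ y => ofC (toC y + c * toC x))).
  apply: measurable_ofC; apply: cmeasurableD.
    by apply: cmeasurable_toC; exact: measurable_fst.
  exact: cmeasurable_cst.
by move=> s; exact: preserving_translation.
Qed.

(* A rotation of the first two coordinates is a product of three shears as
   soon as its off-diagonal entry [b] does not vanish. *)
Lemma unitary_map_rotation n (a : C) (b : R) : normc a ^+ 2 + b ^+ 2 = 1 -> b != 0 ->
  exists T, @unitary_map n.+2 T (fun v =>
    rcons0 (a * v 0 0 - (b%:C)%C * rtl v 0 0)
           (rcons0 ((b%:C)%C * v 0 0 + a^* * rtl v 0 0) (rtl (rtl v)))).
Proof.
move=> ab b0; pose bc : C := (b%:C)%C.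
have bc0 : bc != 0 by apply: contraNneq b0 => /(congr1 (@complex.Re R))/= ->.
have aab : a * a^* = 1 - bc ^+ 2.
  by rewrite mulJc -rmorphXn/= -[1](rmorph1 (real_complex R)) -rmorphB/= -ab addrK.
(* The two right-hand shears give the second row [bc x + a^* y]; the left-hand one then gives the
   first row [a x - bc y], through [a * a^* - 1 = - bc ^+ 2]. *)
exists (@shear12 n ((a - 1) / bc) \o (@shear21 n bc \o @shear12 n ((a^* - 1) / bc))).
split.
- apply: preserving_comp (preserving_shear12 _ _) _.
  exact: preserving_comp (preserving_shear21 _ _) (preserving_shear12 _ _).
- move=> t; rewrite /= /shear12 /shear21 !tconsK/= !Cn_of_tcons !ofCK.
  rewrite [in RHS]Cn_of_tuncons rcons0_hd !rtlK [in RHS]Cn_of_tuncons rcons0_hd !rtlK.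
  set x := toC _; set y := toC _.
  congr (rcons0 _ (rcons0 _ _)).
    have -> : a * x - bc * y = a * x + (a * a^* - 1) / bc * y.
      by rewrite aab; field.
    by field.
  by field.
- move=> k u v; rewrite !rcons0Z !rcons0D; congr (rcons0 _ (rcons0 _ _)).
  + by rewrite !mxE; ring.
  + by rewrite !mxE; ring.
  + by apply/rowP => j; rewrite !mxE.
- move=> u v; rewrite !cdot_rcons0 -[in RHS](rcons0_eta u) -[in RHS](rcons0_eta v) cdot_rcons0.
  rewrite -[in X in _ + X = _]/(cdot (rtl (rtl u)) (rtl (rtl v))).
  rewrite -[X in _ = _ + X](_ : cdot (rcons0 (rtl u 0 0) (rtl (rtl u))) (rcons0 (rtl v 0 0) (rtl (rtl v))) = _);
    last by rewrite !rcons0_eta.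
  rewrite cdot_rcons0 !(rmorphB, rmorphD, rmorphM)/= !conjCK conj_real -/bc.
  set x := u 0 0; set y := rtl u 0 0; set x' := (v 0 0)^*; set y' := (rtl v 0 0)^*.
  rewrite !addrA; congr (_ + _).
  transitivity ((a * a^* + bc ^+ 2) * (x * x' + y * y')); first by ring.
  by rewrite aab; ring.
Qed.

(** By induction on the dimension: with [r] the norm of [p] and [r'] that of its tail, a rotation of
    the first two coordinates sends [(r, 0, 0)] to [(p_0, r', 0)], and the map given by induction
    sends [(r', 0)] to the tail of [p]. The case [r = 0] takes the identity; for [r' = 0], where the
    shear decomposition breaks down, a phase replaces the rotation. *)
Lemma unitary_map_to n (p : 'rV[C]_n.+1) : exists T L, @unitary_map n.+1 T L /\
  L (rcons0 (((Num.sqrt (normsq p))%:C)%C) 0) = p.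
Proof.
elim: n p => [|n ih] p.
  have E (z : C) (v : 'rV[C]_0) : rcons0 z v = rcons0 z 0.
    by congr rcons0; apply/rowP => -[].
  have [p0|p0] := eqVneq (p 0 0) 0.
    exists id, id; split; first exact: unitary_map_id.
    rewrite -[in RHS](rcons0_eta p) [in RHS]E -[in LHS](rcons0_eta p) normsq_rcons0 p0.
    by rewrite normc0 expr0n add0r /normsq /cdot big_ord0 sqrtr0.
  have n0 : normc (p 0 0) != 0 by rewrite normc_eq0.
  pose c : C := p 0 0 / ((normc (p 0 0))%:C)%C.
  have c1 : normc c = 1 by rewrite normcM normcV normc_real ger0_norm ?normc_ge0// divff.
  do 2 eexists; split; first exact: (unitary_map_phase 0 c1).
  rewrite /= rcons0_hd rtlK -[in RHS](rcons0_eta p) [in RHS]E.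
  rewrite -[in normsq _](rcons0_eta p) normsq_rcons0 [X in _ + X](_ : _ = 0) ?addr0; last first.
    by rewrite /normsq /cdot big_ord0.
  rewrite sqrtr_sqr ger0_norm ?normc_ge0// /c divfK//.
  by rewrite -normc_eq0 normc_real ger0_norm ?normc_ge0.
have [T' [L' [uT' Lp']]] := ih (rtl p).
set r' := Num.sqrt _ in Lp'.
pose r := Num.sqrt (normsq p).
have r'2 : r' ^+ 2 = normsq (rtl p) by rewrite sqr_sqrtr// normsq_ge0.
have r2 : r ^+ 2 = normc (p 0 0) ^+ 2 + r' ^+ 2.
  by rewrite sqr_sqrtr ?normsq_ge0// r'2 -normsq_rcons0 rcons0_eta.
have [r0|r0] := eqVneq r 0.
  exists id, id; split; first exact: unitary_map_id.
  have /eqP : normc (p 0 0) ^+ 2 + r' ^+ 2 = 0 by rewrite -r2 r0 expr0n.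
  rewrite paddr_eq0 ?sqr_ge0// !sqrf_eq0 normc_eq0 => /andP[/eqP p0 /eqP r'0].
  rewrite -/r r0 -[RHS]rcons0_eta p0 -Lp' r'0; case: uT' => _ _ l _.
  rewrite (_ : rcons0 _ _ = 0 :> 'rV[C]_n.+1); last first.
    by apply/rowP => k; rewrite !mxE; case: unliftP => //= *; rewrite mxE.
  suff -> : L' 0 = 0 by [].
  by have := l (-1) 0 0; rewrite scaler0 addr0 => ->; rewrite scaleN1r addNr.
pose a : C := p 0 0 / (r%:C)%C; pose b := r' / r.
have rr : (0 : R) <= r by rewrite sqrtr_ge0.
have ab : normc a ^+ 2 + b ^+ 2 = 1.
  rewrite normcM normcV normc_real ger0_norm// !exprMn -mulrDl -r2 exprVn divff//.
  by rewrite sqrf_eq0.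
have rc0 : (r%:C)%C != 0 :> C by rewrite -normc_eq0 normc_real ger0_norm.
have [b0|b0] := eqVneq b 0.
  have c1 : normc a = 1.
    move: ab; rewrite b0 expr0n addr0 => /eqP; rewrite sqrf_eq1 => /orP[/eqP //|/eqP h].
    by have := normc_ge0 a; rewrite h; lra.
  do 2 eexists; split.
    exact: unitary_map_comp (unitary_map_cons uT') (unitary_map_phase n.+1 c1).
  have r'0 : r' = 0 by move: b0 => /eqP; rewrite mulf_eq0 invr_eq0 (negbTE r0) orbF => /eqP.
  rewrite /= !rcons0_hd !rtlK -/r /a divfK// -[RHS]rcons0_eta; congr rcons0.
  rewrite -Lp' r'0; congr L'.
  by apply/rowP => k; rewrite !mxE; case: unliftP => //= *; rewrite mxE.
have [G uG] := unitary_map_rotation n ab b0.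
do 2 eexists; split; first exact: unitary_map_comp (unitary_map_cons uT') uG.
rewrite /= !rcons0_hd !rtlK -/r mxE !mulr0 subr0 addr0 /a divfK//.
rewrite -[RHS]rcons0_eta; congr rcons0; rewrite -Lp'; congr L'.
rewrite -rmorphM/= divfK//; congr rcons0.
by apply/rowP => k; rewrite !mxE.
Qed.

End unitary_maps.

(** * Polar coordinates *)

Section image_measure.
Context d d' (T1 : measurableType d) (T2 : measurableType d') (R : realType).
Variables (m : {measure set T1 -> \bar R}) (f : T1 -> T2).
Hypothesis mf : measurable_fun setT f.

Definition image_measure : {measure set T2 -> \bar R} :=
  measure_function_pushforward__canonical__measure_function_Measure m mf.

Lemma ge0_integral_image (D : set T2) (F : T2 -> \bar R) : measurable D ->
  measurable_fun D F -> (forall x, D x -> 0 <= F x)%E ->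
  (\int[image_measure]_(x in D) F x = \int[m]_(x in f @^-1` D) F (f x))%E.
Proof.
move=> mD mF F0; apply: (@ge0_integral_pushforward _ _ _ _ _ f mf m D F) => //.
by move=> y; rewrite inE; exact: F0.
Qed.

End image_measure.

Section planar_polar.
Variable R : realType.
Local Notation RR := (measurableTypeR R * measurableTypeR R)%type.
Local Notation leb := (@lebesgue_measure R).
Local Notation leb2 := (prodm (@lebesgue_measure R) (@lebesgue_measure R)).
Local Open Scope ereal_scope.

Lemma lebesgue_measure_scale (c : R) (A : set (measurableTypeR R)) : (0 < c)%R -> measurable A ->
  leb A = c%:E * leb ((fun x : R => c * x)%R @^-1` A).
Proof.
move=> c0 mA; pose f : measurableTypeR R -> measurableTypeR R := fun x => (c * x)%R.
have mf : measurable_fun setT f by apply: measurable_funM => //; exact: measurable_cst.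
have nc : (0 <= c)%R by exact: ltW.
have := @lebesgue_measure_unique R (mscale (NngNum nc) (pushforward leb f)); apply => //.
move=> _ [[a b] _ <-]; rewrite /mscale /pushforward.
transitivity (c%:E * leb `](a / c)%R, (b / c)%R]%classic); last first.
  congr (_ * leb _); apply/seteqP; split => x /=; rewrite /f !in_itv/=.
    by rewrite ltr_pdivrMr// ler_pdivlMr// mulrC.
  by rewrite ltr_pdivrMr// ler_pdivlMr// mulrC.
rewrite !lebesgue_measure_itv/= !lte_fin ltr_pM2r ?invr_gt0//.
case: ifP => _; last by rewrite mule0.
by rewrite -!EFinB -EFinM mulrBr !(mulrC c) !divfK ?gt_eqF.
Qed.

Lemma ge0_integral_scale (c : R) (F : R -> \bar R) : (0 < c)%R ->
  measurable_fun (setT : set (measurableTypeR R)) F -> (forall x, 0 <= F x) ->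
  \int[leb]_x F x = c%:E * \int[leb]_x F (c * x)%R.
Proof.
move=> c0 mF F0; pose f : measurableTypeR R -> measurableTypeR R := fun x => (c * x)%R.
have mf : measurable_fun setT f by apply: measurable_funM => //; exact: measurable_cst.
have nc : (0 <= c)%R by exact: ltW.
transitivity (\int[mscale (NngNum nc) (image_measure leb mf)]_x F x).
  by apply: eq_measure_integral => A mA _; rewrite /= (lebesgue_measure_scale c0 mA).
by rewrite ge0_integral_mscale// ge0_integral_image.
Qed.

Definition sqn (p : RR) : R := (p.1 ^+ 2 + p.2 ^+ 2)%R.

Lemma measurable_sqn : measurable_fun setT (sqn : RR -> measurableTypeR R).
Proof.
apply: measurable_funD; apply: measurable_funX.
  exact: (@measurable_fst _ _ (measurableTypeR R) (measurableTypeR R)).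
exact: (@measurable_snd _ _ (measurableTypeR R) (measurableTypeR R)).
Qed.

(** Discs are indexed by the squared radius, in which their area is linear. *)
Let disc (s : R) : set RR := sqn @^-1` `]-oo, s].

Let mdisc s : measurable (disc s).
Proof. by rewrite -[X in measurable X]setTI; exact: measurable_sqn. Qed.

Let disc_scale (s : R) : (0 < s)%R -> leb2 (disc s) = s%:E * leb2 (disc 1).
Proof.
move=> s0; pose r := Num.sqrt s; have r0 : (0 < r)%R by rewrite sqrtr_gt0.
have r2 : (r ^+ 2 = s)%R by rewrite sqr_sqrtr// ltW.
have mg : measurable_fun setT (fun x : measurableTypeR R => leb (xsection (disc s) x)).
  exact: measurable_fun_xsection.
rewrite !prodm1E (ge0_integral_scale r0)//.
have E (x : R) : leb (xsection (disc s) (r * x)%R) = r%:E * leb (xsection (disc 1) x).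
  rewrite (lebesgue_measure_scale r0); last exact: measurable_xsection.
  congr (_ * leb _); apply/seteqP; split => y; rewrite /xsection/= !inE /disc/= !in_itv/= /sqn/=.
    by rewrite !exprMn r2 -mulrDr ger_pMr.
  by rewrite !exprMn r2 -mulrDr ger_pMr.
rewrite [X in _ * X](_ : _ = \int[leb]_x (r%:E * leb (xsection (disc 1) x))); last first.
  by apply: eq_integral => x _; exact: E.
rewrite ge0_integralZl//; last 2 first.
- exact: measurable_fun_xsection.
- by rewrite lee_fin ltW.
by rewrite muleA -EFinM -expr2 r2.
Qed.

(** Comparison with an inscribed square here and a circumscribed one below makes the area of the
    unit disc positive and finite, so that it can be divided by. *)
Let disc1_ge1 : 1 <= leb2 (disc 1).
Proof.
pose Q := (`[(-(2^-1))%R, (2^-1:R)%R] : set (measurableTypeR R))%classic.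
have mQ : measurable Q by exact: measurable_itv.
have lQ : leb Q = 1.
  rewrite /Q lebesgue_measure_itv/= lte_fin (_ : - _ < _ :> R)%R; last by lra.
  by rewrite -EFinB; congr EFin; field.
have -> : 1 = leb2 (Q `*` Q).
  transitivity (leb Q * leb Q); first by rewrite lQ mule1.
  by apply/esym; exact: (product_measure1E leb leb mQ mQ).
apply: le_measure; rewrite ?inE//; first exact: measurableX.
have aux (x : R) : (- 2^-1 <= x <= 2^-1 -> x ^+ 2 <= 2^-1)%R.
  by move=> /andP[? ?]; nra.
move=> [x y] [/=]; rewrite /disc/= !in_itv/= /sqn/= => /aux hx /aux hy.
by rewrite (le_trans (lerD hx hy))//; lra.
Qed.

Let disc1_lty : leb2 (disc 1) < +oo.
Proof.
pose Q := (`[(-1)%R, (1:R)%R] : set (measurableTypeR R))%classic.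
have mQ : measurable Q by exact: measurable_itv.
have lQ : leb Q = 2%:E.
  rewrite /Q lebesgue_measure_itv/= lte_fin (_ : - _ < _ :> R)%R; last by lra.
  by rewrite -EFinB; congr EFin; ring.
apply: (@le_lt_trans _ _ (leb2 (Q `*` Q))).
  apply: le_measure; rewrite ?inE//; first exact: measurableX.
  have aux (x y : R) : (x ^+ 2 + y ^+ 2 <= 1 -> -1 <= x <= 1)%R.
    by move=> h; have := sqr_ge0 y; move=> y0; apply/andP; split; nra.
  move=> [x y]; rewrite /disc/= !in_itv/= /sqn/= => h.
  by split; [exact: aux h|apply: (aux _ x); rewrite addrC].
have -> : leb2 (Q `*` Q) = leb Q * leb Q by exact: (product_measure1E leb leb mQ mQ).
by rewrite lQ -EFinM ltry.
Qed.

(* The area of the unit disc; its value [pi] is read off at the end from a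
   Gaussian integral. *)
Let A : R := fine (leb2 (disc 1)).

Let AE : leb2 (disc 1) = A%:E.
Proof. by rewrite fineK// ge0_fin_numE. Qed.

Let A1 : (1 <= A)%R. Proof. by rewrite -lee_fin -AE. Qed.

Let A0 : (0 < A)%R. Proof. exact: lt_le_trans A1. Qed.

Let discE (s : R) : leb2 (disc s) = (A * Num.max s 0)%:E.
Proof.
have [s0|s0|->] := ltgtP s 0%R.
- rewrite mulr0 (_ : disc s = set0) ?measure0//; apply/seteqP; split => // -[x y].
  rewrite /disc/= in_itv/= /sqn/= leNgt => /negP; apply.
  by rewrite (lt_le_trans s0)// addr_ge0 ?sqr_ge0.
- by rewrite disc_scale// AE -EFinM mulrC.
- rewrite mulr0; apply/eqP; rewrite eq_le measure_ge0 andbT.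
  apply/lee_addgt0Pr => e e0; rewrite add0e.
  have eA : (0 < e / A)%R by rewrite divr_gt0.
  apply: (@le_trans _ _ (leb2 (disc (e / A)%R))).
    apply: le_measure; rewrite ?inE// => p; rewrite /disc/= !in_itv/= => /le_trans; apply.
    exact: ltW.
  by rewrite disc_scale// AE -EFinM divfK ?gt_eqF.
Qed.

Let mneg : measurable (`]-oo, 0%R[ : set (measurableTypeR R)). Proof. exact: measurable_itv. Qed.

Let iA0 : (0 <= A^-1)%R. Proof. by rewrite invr_ge0 ltW. Qed.

(** The uniqueness of Lebesgue measure concerns measures on the whole line, whereas [sqn] only
    charges the nonnegative half; the first summand supplies the negative half. *)
Let decomposition (X : set (measurableTypeR R)) : measurable X ->
  leb X = leb (X `&` `]-oo, 0%R[%classic) + A^-1%:E * leb2 (sqn @^-1` X).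
Proof.
move=> mX.
have := @lebesgue_measure_unique R (measure_add (mrestr leb mneg)
   (mscale (NngNum iA0) (image_measure leb2 measurable_sqn))).
have E (Y : set (measurableTypeR R)) : measure_add (mrestr leb mneg)
     (mscale (NngNum iA0) (image_measure leb2 measurable_sqn)) Y =
   leb (Y `&` `]-oo, 0%R[%classic) + A^-1%:E * leb2 (sqn @^-1` Y).
  by rewrite measure_addE.
move=> H; rewrite -E; apply: H => // _ [[a b] _ <-].
apply: esym; apply: etrans (E _) _ => /=.
have [ab|ba] := ltP a b; last first.
  by rewrite set_itv_ge ?bnd_simp -?leNgt// set0I preimage_set0 !measure0 mule0 adde0.
have -> : sqn @^-1` `]a, b]%classic = disc b `\` disc a.
  apply/seteqP; split => p /=; rewrite /disc/= !in_itv/=.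
    by move=> /andP[ap ->]; split => //; apply/negP; rewrite -ltNge.
  by move=> [-> /negP]; rewrite -ltNge => ->.
have bay : leb2 (disc b) < +oo by rewrite discE ltry.
rewrite measureD//.
have -> : disc b `&` disc a = disc a.
  apply/seteqP; split => p /=; rewrite /disc/= !in_itv/=; first by case.
  by move=> pa; split => //; rewrite (le_trans pa)// ltW.
rewrite /= !discE.
have -> : leb (`]a, b] `&` `]-oo, 0%R[) = (Num.min b 0 - Num.min a 0)%R%:E.
  have [b0|b0] := ltP b 0%R.
    have a0 : (a < 0)%R by apply: lt_trans b0.
    have -> : `]a, b]%classic `&` `]-oo, 0%R[%classic = `]a, b]%classic.
      apply/seteqP; split => x /=; rewrite !in_itv/=; first by case.
      by move=> /andP[-> xb]; split; rewrite ?xb// (le_lt_trans xb).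
    by rewrite lebesgue_measure_itv/= lte_fin ab (min_idPl (ltW a0)).
  have -> : `]a, b]%classic `&` `]-oo, 0%R[%classic = `]a, 0%R[%classic.
    apply/seteqP; split => x /=; rewrite !in_itv/=; first by move=> [/andP[-> _] ->].
    by move=> /andP[-> x0]; split => //; rewrite (le_trans (ltW x0)).
  rewrite lebesgue_measure_itv/= lte_fin; have [a0|a0] := ltP a 0%R; first by [].
  by rewrite subrr.
rewrite lebesgue_measure_itv/= lte_fin ab -!EFinB -EFinM -EFinD; congr EFin.
rewrite -mulrBr mulKf ?gt_eqF//.
have mm (x : R) : (Num.min x 0 + Num.max x 0 = x)%R by rewrite addr_min_max addr0.
by rewrite -[in RHS](mm a) -[in RHS](mm b); lra.
Qed.

Let planarA (H : R -> \bar R) : measurable_fun (`[0%R, +oo[ : set (measurableTypeR R)) H ->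
  (forall x, (0 <= x)%R -> 0 <= H x) ->
  \int[leb2]_p H (sqn p) = A%:E * \int[leb]_(x in `[0%R, +oo[) H x.
Proof.
move=> mH H0; have mD : measurable (`[0%R, +oo[ : set (measurableTypeR R)).
  exact: measurable_itv.
have H0' (x : R) : x \in `[0%R, +oo[ -> 0 <= H x by rewrite in_itv/= andbT; exact: H0.
have -> : \int[leb2]_p H (sqn p) = \int[leb2]_(p in sqn @^-1` `[0%R, +oo[) H (sqn p).
  congr integral; apply/seteqP; split => // p _ /=.
  by rewrite in_itv/= andbT addr_ge0 ?sqr_ge0.
have nA : (0 <= A)%R by exact: ltW.
rewrite -(@ge0_integral_image _ _ RR (measurableTypeR R) R leb2 sqn measurable_sqn _ _ mD mH H0').
rewrite -(ge0_integral_mscale leb mD (NngNum nA) mH H0').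
have := @eq_measure_integral _ _ R (`[0%R, +oo[%classic : set (measurableTypeR R))
  (mscale (NngNum nA) leb) (image_measure leb2 measurable_sqn) H.
apply => X mX XD.
rewrite /= /mscale/=; change (leb2 (sqn @^-1` X) = A%:E * leb X).
rewrite (decomposition mX) (_ : X `&` _ = set0) ?measure0 ?add0e; last first.
  apply/seteqP; split => // x [/XD/=]; rewrite !in_itv/= andbT => x0.
  by rewrite ltNge x0.
by rewrite muleA -EFinM divff ?gt_eqF// mul1e.
Qed.

Let gauss2 : \int[leb2]_p (expR (- sqn p))%:E = pi%:E.
Proof.
have mf : measurable_fun setT (fun p : RR => (expR (- sqn p))%:E).
  apply/measurable_EFinP; apply: measurableT_comp => //.
  by apply: measurable_funN; exact: measurable_sqn.
rewrite /prodm fubini_tonelli1//.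
have E (x y : R) : (expR (- sqn (x, y)))%:E = (gauss_fun x)%:E * (gauss_fun y)%:E.
  by rewrite /gauss_fun -EFinM -expRD /sqn/= opprD.
have g0 (x : R) : 0 <= (gauss_fun x)%:E by rewrite lee_fin gauss_fun_ge0.
have mg : measurable_fun (setT : set (measurableTypeR R)) (fun x => (gauss_fun x)%:E).
  by apply/measurable_EFinP; exact: measurable_gauss_fun.
rewrite /fubini_F.
transitivity (\int[leb]_x ((gauss_fun x)%:E * (Num.sqrt pi : R)%:E)).
  apply: eq_integral => x _.
  rewrite -(@integralT_gauss R) -(ge0_integralZl leb measurableT mg)//.
  by apply: eq_integral => y _; rewrite E.
have sp : 0 <= (Num.sqrt pi : R)%:E by rewrite lee_fin sqrtr_ge0.
apply: (etrans (ge0_integralZr leb measurableT mg (fun x _ => g0 x) sp)).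
by rewrite integralT_gauss -EFinM -expr2 sqr_sqrtr// pi_ge0.
Qed.

Let exp_mean : \int[leb]_(x in `[0%R, +oo[) (expR (- x))%:E = 1.
Proof.
rewrite -(@integral_exponential_pdf R 1)// [LHS]integral_mkcond.
apply: eq_integral => x _; rewrite /exponential_pdf !patchE; case: ifPn => // _.
by rewrite mul1r mulN1r.
Qed.

Lemma planar_polar (H : R -> \bar R) :
  measurable_fun (`[0%R, +oo[ : set (measurableTypeR R)) H ->
  (forall x, (0 <= x)%R -> 0 <= H x) ->
  \int[leb2]_p H (sqn p) = pi%:E * \int[leb]_(x in `[0%R, +oo[) H x.
Proof.
have AP : A = pi.
  have := gauss2; rewrite (planarA (H := fun x => (expR (- x))%:E)).
  - by rewrite exp_mean mule1 => -[].
  - apply: (measurable_funS measurableT) => //.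
    apply/measurable_EFinP; apply: continuous_measurable_fun => x.
    have h := @continuous_comp _ _ _ (fun x : R => - x)%R (@expR R) x.
    by apply: h; [exact: opp_continuous|exact: continuous_expR].
  - by move=> x _; rewrite lee_fin expR_ge0.
by rewrite -AP; exact: planarA.
Qed.

End planar_polar.

(** * Beta integrals and radial moments *)

Section beta_integral.
Variable R : realType.
Local Notation leb := (@lebesgue_measure R).

Let cbeta (u : R) m k : continuous (fun s : R => s ^+ m * (u - s) ^+ k).
Proof.
move=> s; apply: cvgM; first exact: exprn_continuous.
apply: (@continuous_comp _ _ _ (fun s => u - s) (fun x => x ^+ k)).
  by apply: cvgB; [exact: cvg_cst|exact: cvg_id].
exact: exprn_continuous.
Qed.

Definition beta_int m k (u : R) := \int[leb]_(s in `[0, u]) (s ^+ m * (u - s) ^+ k).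

Let ibeta (u : R) m k : leb.-integrable `[0, u] (EFin \o (fun s : R => s ^+ m * (u - s) ^+ k)).
Proof. exact: continuous_integrable_itv. Qed.

Let ftc (u : R) (f F : R -> R) : 0 < u -> continuous f -> (forall x : R, is_derive x 1 F (f x)) ->
  \int[leb]_(s in `[0, u]) f s = F u - F 0.
Proof.
move=> u0 cf dF; have cF : continuous F.
  by move=> x; apply/differentiable_continuous/derivable1_diffP; exact: ex_derive.
rewrite /Rintegral (continuous_FTC2 u0 (continuous_subspaceT cf) (F := F))//.
  split => [x _||]; first exact: ex_derive.
    by apply: cvg_at_right_filter; exact: cF.
  by apply: cvg_at_left_filter; exact: cF.
by move=> x _; rewrite derive1E; exact: derive_val.
Qed.

Let dbeta (u s : R) m k : is_derive (s : R) 1 (fun s : R => s ^+ m.+1 * (u - s) ^+ k.+1)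
  (m.+1%:R * (s ^+ m * (u - s) ^+ k.+1) - k.+1%:R * (s ^+ m.+1 * (u - s) ^+ k)).
Proof.
have d1 := is_deriveX m.+1 (is_derive_id s (1 : R)).
have d2 := is_deriveX k.+1 (is_deriveB (is_derive_cst u s (1 : R)) (is_derive_id s (1 : R))).
have := is_deriveM d1 d2.
have -> : id ^+ m.+1 * (cst u - id) ^+ k.+1 = (fun s : R => s ^+ m.+1 * (u - s) ^+ k.+1).
  by apply/funext => x; rewrite mulrfctE !exprfctE.
move=> /is_derive_eq; apply; rewrite !exprfctE /GRing.scale/=.
by rewrite (_ : (cst u - id) s = u - s)//; ring.
Qed.

Let dpow (s : R) m : is_derive (s : R) 1 (fun s : R => s ^+ m.+1 / m.+1%:R) (s ^+ m).
Proof.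
have d1 := is_deriveX m.+1 (is_derive_id s (1 : R)).
have := is_deriveM d1 (is_derive_cst (m.+1%:R^-1 : R) s (1 : R)).
have -> : id ^+ m.+1 * cst m.+1%:R^-1 = (fun s : R => s ^+ m.+1 / m.+1%:R).
  by apply/funext => x; rewrite mulrfctE !exprfctE.
move=> /is_derive_eq; apply; rewrite !exprfctE /GRing.scale/=.
by rewrite mulr0 add0r mulr1 mulKf// pnatr_eq0.
Qed.

(** Integration by parts: [s ^+ m.+1 * (u - s) ^+ k.+1] vanishes at both ends of [[0, u]]. *)
Lemma beta_intS m k (u : R) : 0 < u ->
  m.+1%:R * beta_int m k.+1 u = k.+1%:R * beta_int m.+1 k u.
Proof.
move=> u0.
pose F (s : R) := s ^+ m.+1 * (u - s) ^+ k.+1.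
pose f (s : R) := m.+1%:R * (s ^+ m * (u - s) ^+ k.+1) - k.+1%:R * (s ^+ m.+1 * (u - s) ^+ k).
have dF (s : R) : is_derive (s : R) 1 F (f s).
  exact: dbeta.
have cf : continuous f.
  by move=> s; apply: cvgB; apply: cvgM; try exact: cvg_cst; exact: cbeta.
have := ftc u0 cf dF; rewrite /F expr0n mul0r subrr expr0n mulr0 subrr.
rewrite /f RintegralB//; last 2 first.
- exact: integrable_mulrl (ibeta u m k.+1).
- exact: integrable_mulrl (ibeta u m.+1 k).
by rewrite !RintegralZl//; move/eqP; rewrite subr_eq0 => /eqP.
Qed.

Lemma beta_intE m k (u : R) : 0 <= u ->
  beta_int m k u = m`!%:R * k`!%:R / (m + k).+1`!%:R * u ^+ (m + k).+1.
Proof.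
rewrite le_eqVlt => /predU1P[<-|u0].
  by rewrite /beta_int set_itv1 Rintegral_set1 expr0n mulr0.
elim: k m => [|k ih] m.
  pose F (s : R) := s ^+ m.+1 / m.+1%:R.
  have dF (s : R) : is_derive (s : R) 1 F (s ^+ m * (u - s) ^+ 0).
    by have := dpow s m; rewrite expr0 mulr1.
  rewrite /beta_int (ftc u0 (@cbeta u m 0) dF) /F expr0n mul0r subr0 addn0.
  have fm : (m`!%:R : R) != 0 by rewrite pnatr_eq0 -lt0n fact_gt0.
  by rewrite factS natrM fact0 mulr1 invfM mulrCA mulfV// mulr1 mulrC.
have m0 : (m.+1%:R : R) != 0 by rewrite pnatr_eq0.
apply: (mulfI m0); rewrite beta_intS// ih addSnnS.
have f0 : ((m + k.+1).+1`!%:R : R) != 0 by rewrite pnatr_eq0 -lt0n fact_gt0.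
move: f0; move: ((m + k.+1).+1`!%:R : R) => Q Q0.
by rewrite (factS m) (factS k) !natrM; field.
Qed.

End beta_integral.

Section radial_moments.
Variable R : realType.
Local Notation RR := (measurableTypeR R * measurableTypeR R)%type.
Local Notation leb := (@lebesgue_measure R).
Local Notation leb2 := (prodm (@lebesgue_measure R) (@lebesgue_measure R)).
Local Notation D := (`[0%R, +oo[%classic : set (measurableTypeR R)).
Local Open Scope ereal_scope.

Let mD : measurable D. Proof. exact: measurable_itv. Qed.

Let DE (s : R) : (s \in D) = (0 <= s)%R.
Proof. by apply/idP/idP; rewrite inE/= in_itv/= andbT. Qed.

Section convolution.
Variables (h : measurableTypeR R -> \bar R).
Hypotheses (mh : measurable_fun setT h) (h0 : forall s, 0 <= h s).

(** The double integral of [convolution_moment] in the variables [s] and [u = s + r], on the region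
    [0 <= s <= u]. Integrating in [u] first gives back the iterated integral, integrating in [s]
    first a Beta integral; Tonelli's theorem equates them. *)
Let F m k (p : RR) : \bar R :=
  if (0 <= p.1)%R && (p.1 <= p.2)%R
  then (p.1 ^+ m * (p.2 - p.1) ^+ k)%R%:E * h p.2 else 0.

Let m1 : measurable_fun setT (fst : RR -> measurableTypeR R). Proof. exact: measurable_fst. Qed.
Let m2 : measurable_fun setT (snd : RR -> measurableTypeR R). Proof. exact: measurable_snd. Qed.

Let mF m k : measurable_fun setT (F m k).
Proof.
apply: measurable_fun_ifT.
- apply: measurable_and; apply: measurable_fun_ler.
  + exact: measurable_cst.
  + exact: m1.
  + exact: m1.
  + exact: m2.
- apply: emeasurable_funM; last exact: (measurableT_comp mh m2).
  apply/measurable_EFinP; apply: measurable_funM.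
    exact: (measurable_funX m m1).
  by apply: (measurable_funX k); exact: measurable_funB.
- exact: measurable_cst.
Qed.

Let F0 m k p : 0 <= F m k p.
Proof.
rewrite /F; case: ifP => // /andP[p0 p12]; apply: mule_ge0 => //.
by rewrite lee_fin mulr_ge0// exprn_ge0// subr_ge0.
Qed.

Let mshift s : measurable_fun (setT : set (measurableTypeR R)) (fun r : measurableTypeR R => h (r + s)%R).
Proof. exact: (measurableT_comp mh (preserving_addr s).1). Qed.

Let innerF m k s : \int[leb]_u F m k (s, u) =
  if (0 <= s)%R then (s ^+ m)%R%:E * \int[leb]_(r in D) ((r ^+ k)%R%:E * h (s + r)%R) else 0.
Proof.
case: ifP => s0; last first.
  by rewrite integral0_eq// => u _; rewrite /F/= s0.
rewrite -(preserving_ge0_integral (preserving_addr s) measurableT)//; last first.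
  exact: measurableT_comp (mF m k) (measurable_pair1 s).
rewrite preimage_setT -ge0_integralZl//.
- rewrite [RHS]integral_mkcond; apply: eq_integral => r _.
  rewrite patchE /F/= s0/= lerDr; case: ifPn => r0.
    by rewrite mem_set/= ?in_itv/= ?r0// addrK EFinM muleA addrC.
  by rewrite memNset//= in_itv/= (negbTE r0).
- apply: emeasurable_funM; first exact/measurable_EFinP/(measurable_funS measurableT).
  apply: (measurable_funS measurableT) => //.
  by under eq_fun do rewrite addrC; exact: mshift.
- by move=> r; rewrite /= in_itv/= andbT => r0; rewrite mule_ge0// lee_fin exprn_ge0.
- by rewrite lee_fin exprn_ge0.
Qed.

Let outerF m k u : \int[leb]_s F m k (s, u) =
  if (0 <= u)%R then (beta_int m k u)%:E * h u else 0.
Proof.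
case: ifP => u0; last first.
  rewrite integral0_eq// => s _; rewrite /F/=; case: ifP => // /andP[s0 su].
  by move: u0; rewrite (le_trans s0 su).
have i : leb.-integrable `[0%R, u] (EFin \o (fun s : R => s ^+ m * (u - s) ^+ k)%R).
  apply: continuous_integrable_itv => s; apply: cvgM; first exact: exprn_continuous.
  apply: (@continuous_comp _ _ _ (fun s => u - s)%R (fun x => x ^+ k)%R).
    by apply: cvgB; [exact: cvg_cst|exact: cvg_id].
  exact: exprn_continuous.
transitivity (\int[leb]_(s in `[0%R, u]) ((s ^+ m * (u - s) ^+ k)%R%:E * h u)).
  rewrite [RHS]integral_mkcond; apply: eq_integral => s _; rewrite patchE /F/=.
  have -> : (s \in `[0%R, u]%classic) = (0 <= s)%R && (s <= u)%R.
    by apply/idP/idP; rewrite inE/= in_itv.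
  by [].
rewrite ge0_integralZr//.
- congr (_ * _); rewrite /beta_int /Rintegral fineK//.
  exact: integrable_fin_num i.
- exact: measurable_int i.
- move=> s; rewrite /= in_itv/= => /andP[s0 su].
  by rewrite lee_fin mulr_ge0// exprn_ge0// subr_ge0.
Qed.

Lemma measurable_convolution k : measurable_fun D
  (fun s : measurableTypeR R => \int[leb]_(r in D) ((r ^+ k)%R%:E * h (s + r)%R)).
Proof.
have := @measurable_fun_fubini_tonelli_F _ _ _ _ R leb (F 0 k) (mF 0 k) (F0 0 k).
move=> /(measurable_funS measurableT (@subsetT _ D)).
apply: eq_measurable_fun => s; rewrite inE/= in_itv/= andbT => s0.
by rewrite /fubini_F innerF s0 expr0 mul1e.
Qed.

Lemma convolution_moment m k :
  \int[leb]_(s in D) ((s ^+ m)%R%:E * \int[leb]_(r in D) ((r ^+ k)%R%:E * h (s + r)%R)) =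
  (m`!%:R * k`!%:R / (m + k).+1`!%:R)%R%:E * \int[leb]_(u in D) ((u ^+ (m + k).+1)%R%:E * h u).
Proof.
transitivity (\int[leb]_s \int[leb]_u F m k (s, u)).
  rewrite integral_mkcond; apply: eq_integral => s _; rewrite patchE innerF.
  by rewrite DE.
rewrite fubini_tonelli// -ge0_integralZl//.
- rewrite [RHS]integral_mkcond; apply: eq_integral => u _; rewrite patchE outerF.
  rewrite DE; case: ifPn => // hu.
  by rewrite beta_intE// EFinM muleA.
- apply: emeasurable_funM; first exact/measurable_EFinP/(measurable_funS measurableT).
  exact: (measurable_funS measurableT).
- by move=> r; rewrite /= in_itv/= andbT => r0; rewrite mule_ge0// lee_fin exprn_ge0.
Qed.

End convolution.

Lemma ge0_integral_consm d (T : measurableType d) n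
    (mu : {sigma_finite_measure set T -> \bar R})
    (nu : {sigma_finite_measure set (n.-tuple T) -> \bar R})
    (G : n.+1.-tuple T -> \bar R) :
  measurable_fun setT G -> (forall t, 0 <= G t) ->
  \int[consm mu nu]_t G t = \int[mu]_x \int[nu]_t G (tcons (x, t)).
Proof.
move=> mG G0.
have mT := @measurable_tcons _ T n.
transitivity (\int[image_measure (prodm mu nu) mT]_t G t).
  by apply: eq_measure_integral.
rewrite ge0_integral_image// preimage_setT /prodm fubini_tonelli1//.
exact: measurableT_comp.
Qed.

Lemma measurable_normsq n :
  measurable_fun setT (fun t : n.-tuple RR => normsq (Cn_of t) : measurableTypeR R).
Proof.
elim: n => [|n ih].
  under eq_fun do rewrite /normsq /cdot big_ord0.
  exact: measurable_cst.
under eq_fun do rewrite Cn_of_tuncons normsq_rcons0.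
apply: measurable_funD; last exact: (measurableT_comp ih (@measurable_tail R n)).
apply: measurable_funX; apply: measurable_normc; apply: cmeasurable_toC.
exact: measurable_head.
Qed.

Lemma normc_toC_sqr (p : RR) : (normc (toC p) ^+ 2 = sqn p)%R.
Proof. by rewrite sqr_normcE. Qed.

Let measurable_moment n m (h : measurableTypeR R -> \bar R) : measurable_fun setT h ->
  measurable_fun setT (fun t : n.+1.-tuple RR =>
    (normc (toC (tuncons t).1) ^+ (2 * m))%R%:E * h (normsq (Cn_of t))).
Proof.
move=> mh; apply: emeasurable_funM; last exact: (measurableT_comp mh (@measurable_normsq _)).
apply/measurable_EFinP; apply: measurable_funX.
by apply: measurable_normc; apply: cmeasurable_toC; exact: measurable_head.
Qed.

(** Induction on the dimension. [planar_polar] handles the first coordinate, the induction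
    hypothesis at [m = 0] with the shifted weight [h (sqn x + _)] handles the others, and
    [convolution_moment] merges the two radial variables into one. The shift is why [h] is
    arbitrary. *)
Lemma radial_moment n m (h : measurableTypeR R -> \bar R) :
  measurable_fun setT h -> (forall s, 0 <= h s) ->
  \int[lebesgueC R n.+1]_t
     ((normc (toC (tuncons t).1) ^+ (2 * m))%R%:E * h (normsq (Cn_of t))) =
  (pi ^+ n.+1 * m`!%:R / (m + n)`!%:R)%R%:E *
    \int[leb]_(s in D) ((s ^+ (m + n))%R%:E * h s).
Proof.
elim: n m h => [|n ih] m h mh h0; (rewrite ge0_integral_consm;
  [|exact: measurable_moment|by move=> t; rewrite mule_ge0// lee_fin exprn_ge0// normc_ge0]).
- transitivity (\int[leb2]_p ((sqn p ^+ m)%R%:E * h (sqn p))).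
    apply: eq_integral => x _; rewrite integral_dirac//; last first.
      have m1 := measurableT_comp (@measurable_tcons _ RR 0) (measurable_pair1 x).
      exact: (measurableT_comp (@measurable_moment 0 m h mh) m1).
    rewrite diracE mem_set// mul1e tconsK/= exprM normc_toC_sqr.
    by rewrite Cn_of_tcons normsq_rcons0 normc_toC_sqr /normsq /cdot big_ord0 addr0.
  rewrite (planar_polar (H := fun s => (s ^+ m)%R%:E * h s)).
  + by rewrite addn0 expr1 mulfK// pnatr_eq0 -lt0n fact_gt0.
  + apply: emeasurable_funM; first exact/measurable_EFinP/(measurable_funS measurableT).
    exact: (measurable_funS measurableT).
  + by move=> s s0; rewrite mule_ge0// lee_fin exprn_ge0.
pose cn := (pi ^+ n.+1 / n`!%:R : R)%R.
have cn0 : (0 <= cn)%R by rewrite divr_ge0// exprn_ge0// pi_ge0.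
pose J (s : R) := \int[leb]_(r in D) ((r ^+ n)%R%:E * h (s + r)%R).
have J0 s : 0 <= J s.
  apply: integral_ge0 => r; rewrite /= in_itv/= andbT => r0.
  by rewrite mule_ge0// lee_fin exprn_ge0.
have mJ : measurable_fun D J by exact: measurable_convolution.
transitivity (\int[leb2]_p ((sqn p ^+ m)%R%:E * (cn%:E * J (sqn p)))).
  apply: eq_integral => x _.
  have mhx : measurable_fun setT (fun s : measurableTypeR R => h (sqn x + s)%R).
    by under eq_fun do rewrite addrC; exact: (measurableT_comp mh (preserving_addr (sqn x)).1).
  have := ih 0%N (fun s => h (sqn x + s)%R) mhx (fun s => h0 _).
  rewrite add0n fact0 mulr1 -/(J (sqn x)) -/cn => <-.
  rewrite -ge0_integralZl//.
  - apply: eq_integral => t _; rewrite tconsK/= exprM normc_toC_sqr muln0 expr0 mul1e.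
    by rewrite Cn_of_tcons normsq_rcons0 normc_toC_sqr.
  - apply: emeasurable_funM; last exact: (measurableT_comp mhx (@measurable_normsq _)).
    by under eq_fun do rewrite muln0 expr0; exact: measurable_cst.
  - by move=> t _; rewrite mule_ge0// lee_fin exprn_ge0// normc_ge0.
  - by rewrite lee_fin exprn_ge0// addr_ge0 ?sqr_ge0.
rewrite (planar_polar (H := fun s => (s ^+ m)%R%:E * (cn%:E * J s))).
- rewrite (_ : \int[leb]_(x in D) _ = \int[leb]_(s in D) (cn%:E * ((s ^+ m)%R%:E * J s))); last first.
    by apply: eq_integral => s _; rewrite muleCA.
  rewrite ge0_integralZl//.
  + rewrite convolution_moment// addnS !muleA -!EFinM; congr (_%:E * _).
    have fn : (n`!%:R : R)%R != 0%R by rewrite pnatr_eq0 -lt0n fact_gt0.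
    have fmn : ((m + n).+1`!%:R : R)%R != 0%R by rewrite pnatr_eq0 -lt0n fact_gt0.
    move: fn fmn; rewrite /cn; move: (n`!%:R)%R => a; move: ((m + n).+1`!%:R)%R => b.
    by rewrite (exprS pi n.+1); move: (pi ^+ n.+1)%R => P a0 b0; field; rewrite a0 b0.
  + by apply: emeasurable_funM => //; exact/measurable_EFinP/(measurable_funS measurableT).
  + by move=> s; rewrite /= in_itv/= andbT => s0; rewrite mule_ge0// lee_fin exprn_ge0.
- apply: emeasurable_funM; first exact/measurable_EFinP/(measurable_funS measurableT).
  by apply: emeasurable_funM => //; exact: measurable_cst.
- by move=> s s0; rewrite !mule_ge0// lee_fin exprn_ge0.
Qed.

End radial_moments.

(** * Averaging over rotations *)

Section circle_average.
Variable R : realType.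
Local Notation leb := (@lebesgue_measure R).

Lemma lt0_2pi : (0 : R) < 2 * pi. Proof. by rewrite mulr_gt0// pi_gt0. Qed.

Local Notation P := (uniform_prob lt0_2pi).

(** Relates circle means to a probability measure [P], whose mass 1 lets integrability pass to the
    product with [mu]. *)
Lemma integral_circle (u : R -> R) : continuous u ->
  (\int[P]_x (u x)%:E = ((2 * pi)^-1 * \int[leb]_(x in `[0%R, (2 * pi)%R]) u x)%:E)%E.
Proof.
move=> cu; have mu : measurable_fun (setT : set (measurableTypeR R)) (EFin \o u).
  by apply/measurable_EFinP; exact: continuous_measurable_fun.
have iu := continuous_integrable_itv 0 (2 * pi) cu.
rewrite integralE !integral_uniform//; last 2 first.
- exact: measurable_funeneg.
- exact: measurable_funepos.
rewrite subr0 -muleBr//; last first.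
  by rewrite fin_num_adde_defl// fin_numN; exact/integrable_fin_num/integrable_funeneg.
rewrite EFinM; congr (_ * _)%E.
by rewrite -integralE /Rintegral fineK//; exact: integrable_fin_num iu.
Qed.

Let circle_setT : P setT = 1%E. Proof. exact: (probability_setT P). Qed.

Section average.
Context d (T : measurableType d) (mu : {sigma_finite_measure set T -> \bar R}).
Variable S : R -> T -> T.
Hypothesis mS : measurable_fun setT (fun p : T * measurableTypeR R => S p.2 p.1).
Hypothesis pS : forall r, preserving mu (S r).

Section real.
Variable f : T -> R.
Hypothesis fi : mu.-integrable setT (EFin \o f).

Let g (p : T * measurableTypeR R) : \bar R := (f (S p.2 p.1))%:E.

Let mg : measurable_fun setT g.
Proof. exact: (measurableT_comp (measurable_int mu fi) mS). Qed.

Let gi : (mu \x P)%E.-integrable setT g.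
Proof.
apply/integrable21ltyP => //.
rewrite (eq_integral (fun=> \int[mu]_t `|(f t)%:E|)%E); last first.
  move=> x _; rewrite /g/= -[RHS](preserving_ge0_integral (pS x) measurableT)//.
  have mf := measurable_int mu fi.
  exact: (measurableT_comp (@abse_measurable R setT) mf).
rewrite integral_cst//; have /= -> := circle_setT; rewrite mule1.
by case/integrableP : fi.
Qed.

Lemma average_integrable : mu.-integrable setT (fun t => \int[P]_r (f (S r t))%:E)%E.
Proof. exact: (integrable_fubini_F gi). Qed.

(** For each fixed [r], the integral of [f (S r t)] over [t] equals that of [f]; Fubini turns the
    average of this constant into the integral of the averages. *)
Lemma average_integral :
  (\int[mu]_t (f t)%:E = \int[mu]_t \int[P]_r (f (S r t))%:E)%E.
Proof.
rewrite [RHS](integral12_prod_meas1 gi) -(integral21_prod_meas1 gi).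
transitivity (\int[P]_r (cst (\int[mu]_t (f t)%:E) r))%E; last first.
  apply: eq_integral => r _; rewrite /cst -(preserving_integral (pS r) measurableT fi).
  by rewrite preimage_setT.
by rewrite integral_cst//; have /= -> := circle_setT; rewrite mule1.
Qed.

End real.

Variable F : T -> R[i].
Hypothesis Fi : cintegrable mu setT F.
Hypothesis cF : forall t, ccontinuous (fun r => F (S r t)).

Let cmeanE t : cmean (fun r => F (S r t)) =
  Complex (fine (\int[P]_r (Re (F (S r t)))%:E)) (fine (\int[P]_r (Im (F (S r t)))%:E)).
Proof.
have [c1 c2] := cF t.
rewrite (integral_circle c1) (integral_circle c2)/=.
by apply: complex_eqP; rewrite ?Re_realM ?Im_realM.
Qed.

Let fineE (u : R -> R) : continuous u ->
  ((fine (\int[P]_x (u x)%:E))%:E = \int[P]_x (u x)%:E)%E.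
Proof. by move=> cu; rewrite integral_circle. Qed.

Lemma average_cintegrable : cintegrable mu setT (fun t => cmean (fun r => F (S r t))).
Proof.
case: Fi => F1 F2; split.
  apply: eq_integrable (average_integrable F1) => // t _.
  rewrite -[RHS]/((Re (cmean (fun r => F (S r t))))%:E) cmeanE/= fineE//.
  by have [] := cF t.
apply: eq_integrable (average_integrable F2) => // t _.
rewrite -[RHS]/((Im (cmean (fun r => F (S r t))))%:E) cmeanE/= fineE//.
by have [] := cF t.
Qed.

Lemma average_cint : cint mu setT F = cint mu setT (fun t => cmean (fun r => F (S r t))).
Proof.
case: Fi => F1 F2; apply: complex_eqP; rewrite -?[Re (cint _ _ _)]/(Rintegral _ _ _)
  -?[Im (cint _ _ _)]/(Rintegral _ _ _) /Rintegral; congr fine.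
  rewrite (average_integral F1); apply: eq_integral => t _.
  by rewrite cmeanE/= fineE//; have [] := cF t.
rewrite (average_integral F2); apply: eq_integral => t _.
by rewrite cmeanE/= fineE//; have [] := cF t.
Qed.

End average.

End circle_average.

(** * Measurability of continuous functions *)

Section continuous_measurable.
Variables (R : realType) (n : nat).
Local Notation C := R[i].
Local Notation RR := (measurableTypeR R * measurableTypeR R)%type.

Lemma continuous_rowP (f : 'rV[C]_n -> C) z : {for z, continuous f} ->
  forall eps : R, 0 < eps -> exists2 del : R, 0 < del &
    forall w : 'rV[C]_n, (forall j, normc (w 0 j - z 0 j) < del) -> normc (f w - f z) < eps.
Proof.
move=> cf eps eps0; have /cvg_normcP/(_ _ eps0) := cf.
move=> /nbhs_ballP[e /= e0 he].
have re0 : 0 < Re e by move: e0; rewrite ltcE => /andP[].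
exists (Re e) => // w hw; apply: he; split => // i j.
by rewrite (ord1 i) /ball/= ltc_normc// normcB.
Qed.

(* Sampling on the grid of mesh [1 / (k + 1)]: a function of the grid point is
   measurable because the grid is countable. *)
Let code (k : nat) (t : n.-tuple RR) : n.-tuple (int * int) :=
  map_tuple (fun p : RR => (Num.floor (k.+1%:R * p.1), Num.floor (k.+1%:R * p.2))) t.

Let decode (k : nat) (v : n.-tuple (int * int)) : 'rV[C]_n :=
  \row_j Complex ((tnth v j).1%:~R / k.+1%:R) ((tnth v j).2%:~R / k.+1%:R).

Let measurable_code k v : measurable [set t | code k t = v].
Proof.
pose cell (c : int) : set (measurableTypeR R) :=
  `[(c%:~R / k.+1%:R : R), ((c + 1)%:~R / k.+1%:R)[%classic.
have cellE c (x : R) : Num.floor (k.+1%:R * x) = c <-> cell c x.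
  rewrite /cell /= in_itv/= ler_pdivrMr// ltr_pdivlMr// (mulrC x); split.
    by move=> <-; exact: floor_itv.
  exact: floor_def.
rewrite (_ : [set t | _] = \bigcap_(j in [set: 'I_n])
    ((fun t : n.-tuple RR => tnth t j) @^-1` (cell (tnth v j).1 `*` cell (tnth v j).2))).
  apply: fin_bigcap_measurable; first exact: finite_finset.
  move=> j _; rewrite -[X in measurable X]setTI; apply: measurable_tnth => //.
  by apply: measurableX; exact: measurable_itv.
apply/seteqP; split => [t /= <- j _ /=|t tv /=].
  by rewrite tnth_map/=; split; apply/cellE.
apply/eq_from_tnth => j; rewrite tnth_map; have [/= /cellE -> /cellE ->] := tv j I.
by rewrite -surjective_pairing.
Qed.

Let measurable_coded k (g : n.-tuple (int * int) -> R) :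
  measurable_fun setT (g \o code k).
Proof.
move=> _ B mB; rewrite setTI.
rewrite (_ : _ @^-1` B = \bigcup_v (if g v \in B then [set t | code k t = v] else set0)).
  apply: countable_bigcupT_measurable => // v.
  by case: ifP => // _; exact: measurable_code.
apply/seteqP; split => [t /= Bt|t [v _]].
  by exists (code k t) => //; rewrite mem_set.
by case: ifPn => [/set_mem Bv /= tv|_ []]; rewrite /= tv.
Qed.

Let decode_cvg (t : n.-tuple RR) (del : R) : 0 < del ->
  \forall k \near \oo, forall j, normc (decode k (code k t) 0 j - Cn_of t 0 j) < del.
Proof.
move=> del0; have h (x : R) k : `|(Num.floor (k.+1%:R * x))%:~R / k.+1%:R - x| <= k.+1%:R^-1.
  have /andP[h1 h2] := floor_itv (k.+1%:R * x).
  have k0 : (0 : R) < k.+1%:R by [].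
  rewrite -[X in _ - X](mulKf (lt0r_neq0 k0)) (mulrC _^-1) -mulrBl normrM.
  rewrite [X in _ * X]ger0_norm ?invr_ge0// ler_piMl ?invr_ge0//.
  by rewrite intrD in h2; rewrite ler_norml; apply/andP; split; lra.
near=> k; move=> j; rewrite !mxE tnth_map.
apply: le_lt_trans (normc_le_ReIm _) _; rewrite ReD ImD ReN ImN/=.
apply: le_lt_trans (lerD (h _ _) (h _ _)) _.
have -> : k.+1%:R^-1 + k.+1%:R^-1 = 2 / k.+1%:R :> R by ring.
rewrite ltr_pdivrMr// mulrC -ltr_pdivrMr//.
apply: lt_le_trans (truncnS_gt _) _; rewrite ler_nat ltnS.
by near: k; exact: nbhs_infty_ge.
Unshelve. all: end_near. Qed.

(** The functions sampled at grid points are measurable and converge pointwise by continuity. This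
    links the product sigma-algebra of the tuples with the topology of row vectors. *)
Lemma continuous_cmeasurable (f : 'rV[C]_n -> C) : (forall z, {for z, continuous f}) ->
  cmeasurable setT (fun t : n.-tuple RR => f (Cn_of t)).
Proof.
move=> cf.
have cv t (eps : R) : 0 < eps ->
    \forall k \near \oo, normc (f (decode k (code k t)) - f (Cn_of t)) < eps.
  move=> eps0; have [del del0 hd] := continuous_rowP (cf (Cn_of t)) eps0.
  by near=> k; apply: hd; near: k; exact: decode_cvg.
split.
  apply: (@measurable_fun_cvg _ _ _ _ (fun k t => Re (f (decode k (code k t))))).
    by move=> k; exact: (@measurable_coded k (fun v => Re (f (decode k v)))).
  move=> t _; apply/cvgrPdist_lt => eps eps0.
  near=> k; rewrite distrC -ReN -ReD; apply: le_lt_trans (normc_Re_le _) _.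
  by near: k; exact: cv.
apply: (@measurable_fun_cvg _ _ _ _ (fun k t => Im (f (decode k (code k t))))).
  by move=> k; exact: (@measurable_coded k (fun v => Im (f (decode k v)))).
move=> t _; apply/cvgrPdist_lt => eps eps0.
near=> k; rewrite distrC -ImN -ImD; apply: le_lt_trans (normc_Im_le _) _.
by near: k; exact: cv.
Unshelve. all: end_near. Qed.

End continuous_measurable.

Section tuple_rotation.
Variable R : realType.
Local Notation C := R[i].
Local Notation RR := (measurableTypeR R * measurableTypeR R)%type.
Local Notation leb2 := (prodm (@lebesgue_measure R) (@lebesgue_measure R)).

Definition rot n (c : C) (t : n.-tuple RR) : n.-tuple RR :=
  map_tuple (fun p => ofC (c * toC p)) t.

Lemma Cn_of_rot n c (t : n.-tuple RR) : Cn_of (rot c t) = c *: Cn_of t.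
Proof.
apply/rowP => j; rewrite !mxE tnth_map/=.
by rewrite -[LHS]/(toC (ofC _)) ofCK.
Qed.

Lemma preserving_rot n c : normc c = 1 -> preserving (lebesgueC R n) (rot c).
Proof.
move=> c1; elim: n => [|n ih].
  by apply: preserving_eq (preserving_id _) => t; rewrite [LHS]tuple0 [RHS]tuple0.
have [mr pr] := preserving_rotation c1.
have h1 : preserving (prodm leb2 (lebesgueC R n)) (fun p => (p.1, rot c p.2)).
  apply: (@preserving_skew1 _ _ _ _ R leb2 (lebesgueC R n) (fun=> rot c)) => //.
  by apply: measurableT_comp; [exact: ih.1|exact: measurable_snd].
have h2 : preserving (prodm leb2 (lebesgueC R n)) (fun p => (ofC (c * toC p.1), p.2)).
  apply: (@preserving_skew2 _ _ _ _ R leb2 (lebesgueC R n) (fun=> fun x => ofC (c * toC x))) => //.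
  by apply: (measurableT_comp mr); exact: measurable_fst.
apply: preserving_eq (preserving_consm (preserving_comp h1 h2)) => t.
rewrite -[in RHS](tuncons_K t) /comp; move: (tuncons t) => [x s].
exact: val_inj.
Qed.

Lemma measurable_rot n : measurable_fun setT
  (fun p : n.-tuple RR * measurableTypeR R => rot (cis p.2) p.1).
Proof.
apply/measurable_fun_tnthP => j.
rewrite (_ : _ \o _ = fun p => ofC (cis p.2 * toC (tnth p.1 j))); last first.
  by apply/funext => p /=; rewrite tnth_map.
apply: measurable_ofC; apply: cmeasurableM.
  have [c1 c2] := ccontinuous_cmeasurable (@ccontinuous_cis R).
  by split; [exact: (measurableT_comp c1 measurable_snd)|exact: (measurableT_comp c2 measurable_snd)].
apply: cmeasurable_toC.
exact: (measurableT_comp (measurable_tnth j) measurable_fst).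
Qed.

End tuple_rotation.

(** * Pairing with monomials *)

Section monomial_pairing.
Variables (R : realType) (n : nat) (psi : R -> R).
Local Notation C := R[i].
Local Notation RR := (measurableTypeR R * measurableTypeR R)%type.
Local Notation leb := (@lebesgue_measure R).
Local Notation D := (`[0%R, +oo[%classic : set (measurableTypeR R)).
Local Notation lebC := (lebesgueC R n.+1).
Implicit Types (f g : 'rV[C]_n.+1 -> C) (t : n.+1.-tuple RR) (p : 'rV[C]_n.+1).

Hypothesis mpsi : measurable_fun D psi.
Hypothesis ipsi : forall m, leb.-integrable D (EFin \o (fun s : R => s ^+ m * expR (- psi s))).

(** [radial_moment] takes a weight on the whole line, while [psi] is controlled on the half-line
    only; [Num.max s 0] extends it. *)
Let h (s : measurableTypeR R) : \bar R := (expR (- psi (Num.max s 0)))%:E.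

Let mh : measurable_fun setT h.
Proof.
apply/measurable_EFinP; apply: (@measurableT_comp _ _ _ _ _ _ (@expR R)); first exact: measurable_expR.
apply: measurable_funN.
have mD : measurable D by exact: measurable_itv.
apply: (@measurable_comp _ _ _ _ _ _ D psi setT (fun s : R => Num.max s 0)) => //.
  by move=> _ [s _ <-]; rewrite /= in_itv/= andbT le_max lexx orbT.
by apply: measurable_maxr; [exact: measurable_id|exact: measurable_cst].
Qed.

Let h0 s : (0 <= h s)%E. Proof. by rewrite lee_fin expR_ge0. Qed.

Let w t : R := weight psi (Cn_of t).

Lemma weight_ge0 (z : 'rV[C]_n.+1) : 0 <= weight psi z. Proof. exact: expR_ge0. Qed.

Let hE t : h (normsq (Cn_of t)) = (w t)%:E.
Proof. by rewrite /h /w /weight; case: leP (normsq_ge0 (Cn_of t)). Qed.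

Lemma measurable_weight : measurable_fun setT (fun t => weight psi (Cn_of t)).
Proof.
apply/measurable_EFinP; have := measurableT_comp mh (@measurable_normsq R n.+1).
by apply: eq_measurable_fun => t _ /=; rewrite hE.
Qed.

(** The weighted integral of the [2m]-th power of the modulus of one coordinate in dimension [n.+1],
    for Lebesgue measure before normalization: see [integral_head_moment]. *)
Definition Lmoment m : R := pi ^+ n.+1 * m`!%:R / (m + n)`!%:R * cmoment psi (m + n).

Lemma integral_head_moment m :
  (\int[lebC]_t (normc (toC (tuncons t).1) ^+ (2 * m) * weight psi (Cn_of t))%:E =
   (Lmoment m)%:E)%E.
Proof.
have := radial_moment n m mh h0.
under eq_integral do rewrite hE -EFinM.
move=> ->; rewrite /Lmoment [in RHS]EFinM; congr (_ * _)%E.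
rewrite /cmoment /Rintegral fineK; last exact: integrable_fin_num (ipsi (m + n)).
apply: eq_integral => s; rewrite inE/= in_itv/= andbT => s0.
by rewrite /h; case: leP s0 => // _ _; rewrite -EFinM.
Qed.

Definition sqint f := lebC.-integrable setT
  (EFin \o (fun t => normc (f (Cn_of t)) ^+ 2 * weight psi (Cn_of t))).

Definition meas f := cmeasurable setT (fun t => f (Cn_of t)).

Definition Lpair f g := cint lebC setT
  (fun t => f (Cn_of t) * (g (Cn_of t))^* * ((weight psi (Cn_of t))%:C)%C).

Lemma Lpair_cintegrable f g : meas f -> meas g -> sqint f -> sqint g ->
  cintegrable lebC setT
    (fun t => f (Cn_of t) * (g (Cn_of t))^* * ((weight psi (Cn_of t))%:C)%C).
Proof.
move=> mf mg f2 g2.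
apply: (@le_cintegrable _ _ _ _ _ _ (fun t => normc (f (Cn_of t)) ^+ 2 * weight psi (Cn_of t) +
  normc (g (Cn_of t)) ^+ 2 * weight psi (Cn_of t))) => //.
- apply: cmeasurableM; first by apply: cmeasurableM => //; exact: cmeasurable_conj.
  by apply: cmeasurable_real; exact: measurable_weight.
- have := integrableD measurableT f2 g2; apply: eq_integrable => //.
- move=> t _; rewrite !normcM normc_conj normc_real ger0_norm ?weight_ge0//.
  rewrite -mulrDl ler_wpM2r ?weight_ge0//.
  have := normc_ge0 (f (Cn_of t)); have := normc_ge0 (g (Cn_of t)).
  by set a := normc _; set b := normc _; nra.
Qed.

Lemma sqint_measurable f : meas f ->
  measurable_fun setT (fun t => normc (f (Cn_of t)) ^+ 2 * weight psi (Cn_of t)).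
Proof.
move=> mf; apply: measurable_funM; last exact: measurable_weight.
by apply: measurable_funX; exact: measurable_normc.
Qed.

Lemma meas_monomial p m : meas (fun z => cdot z p ^+ m).
Proof.
apply: cmeasurableX; rewrite /cdot; apply: cmeasurable_sum => j.
apply: cmeasurableM; last exact: cmeasurable_cst.
have -> : (fun t : n.+1.-tuple RR => Cn_of t 0 j) = fun t => toC (tnth t j).
  by apply/funext => t; rewrite mxE.
by apply: cmeasurable_toC; exact: measurable_tnth.
Qed.

Let Cn_of_hd t : Cn_of t 0 0 = toC (tuncons t).1.
Proof. by rewrite Cn_of_tuncons rcons0_hd. Qed.

(** A unitary change of variables turns [cdot z p] into the norm of [p] times the first coordinate,
    whose moments are known. *)
Lemma sqint_monomial p m : sqint (fun z => cdot z p ^+ m).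
Proof.
have [T [L [[pT cT lL dL] Lp]]] := unitary_map_to p.
set r := Num.sqrt _ in Lp.
have E z : cdot (L z) p = z 0 0 * (r%:C)%C.
  by rewrite -Lp dL -[in LHS](rcons0_eta z) cdot_rcons0 conj_real -conj_cdot cdot0l conjC0 addr0.
have mm := sqint_measurable (meas_monomial p m).
apply/integrableP; split; first exact/measurable_EFinP.
pose G t := (normc (cdot (Cn_of t) p ^+ m) ^+ 2 * weight psi (Cn_of t))%:E.
have G0 t : (0 <= G t)%E by rewrite lee_fin mulr_ge0 ?weight_ge0 ?sqr_ge0.
rewrite (eq_integral G); last first.
  by move=> t _; rewrite /= ger0_norm// mulr_ge0 ?weight_ge0 ?sqr_ge0.
rewrite -(preserving_ge0_integral pT measurableT)//; last exact/measurable_EFinP.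
rewrite preimage_setT.
rewrite (eq_integral (fun t => (normc (r%:C)%C ^+ (2 * m))%:E *
   (normc (toC (tuncons t).1) ^+ (2 * m) * weight psi (Cn_of t))%:E)%E); last first.
  move=> t _; rewrite /G cT -EFinM E; congr EFin.
  rewrite /weight (_ : normsq (L _) = normsq (Cn_of t)); last by rewrite /normsq dL.
  rewrite normcX normcM -exprM mulnC exprMn Cn_of_hd.
  by rewrite [in RHS]mulrA; congr (_ * _); rewrite mulrC.
rewrite ge0_integralZl//.
- by rewrite integral_head_moment -EFinM ltry.
- apply/measurable_EFinP; apply: measurable_funM; last exact: measurable_weight.
  by apply: measurable_funX; apply: measurable_normc; apply: cmeasurable_toC; exact: measurable_head.
- by move=> t _; rewrite lee_fin mulr_ge0 ?weight_ge0// exprn_ge0// normc_ge0.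
- by rewrite lee_fin exprn_ge0// normc_ge0.
Qed.

Lemma unitary_map_rot k c : normc c = 1 -> @unitary_map R k (rot c) (fun v => c *: v).
Proof.
move=> c1; split; first exact: preserving_rot.
- exact: Cn_of_rot.
- by move=> a u v; rewrite scalerDr !scalerA mulrC.
- by move=> u v; rewrite cdotZl cdotZr mulrA mulJc c1 expr1n mul1r.
Qed.

(** The form in which holomorphy enters the one-variable arguments: restriction to complex affine
    lines. *)
Definition slice_entire f := forall p q, entire (fun l : C => f (p + l *: q)).

Lemma cmean_entire (F : C -> C) : entire F -> cmean (fun x => F (cis x)) = F 0.
Proof.
move=> eF; rewrite -coef0// /coef /circle_coef; apply: eq_cmean => x.
by rewrite oppr0 mul0r cis0 mulr1 mul1r.
Qed.

Let head_rot (r : R) t := tcons ((ofC (cis r * toC (tuncons t).1)), (tuncons t).2).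
Let tail_rot (r : R) t := tcons ((tuncons t).1, rot (cis r) (tuncons t).2).

Let measurable_head_rot : measurable_fun setT
  (fun q : n.+1.-tuple RR * measurableTypeR R => head_rot q.2 q.1).
Proof.
apply: (measurableT_comp (@measurable_tcons _ _ n)); apply: measurable_fun_pair.
  apply: measurable_ofC; apply: cmeasurableM.
    have [c1 c2] := ccontinuous_cmeasurable (@ccontinuous_cis R).
    by split; [exact: (measurableT_comp c1 measurable_snd)|exact: (measurableT_comp c2 measurable_snd)].
  apply: cmeasurable_toC; exact: (measurableT_comp (@measurable_head R n) measurable_fst).
exact: (measurableT_comp (@measurable_tail R n) measurable_fst).
Qed.

Let measurable_tail_rot : measurable_fun setT
  (fun q : n.+1.-tuple RR * measurableTypeR R => tail_rot q.2 q.1).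
Proof.
apply: (measurableT_comp (@measurable_tcons _ _ n)); apply: measurable_fun_pair.
  exact: (measurableT_comp (@measurable_head R n) measurable_fst).
apply: (@measurableT_comp _ _ _ _ _ _ (fun q : n.-tuple RR * measurableTypeR R => rot (cis q.2) q.1)
  _ (fun q : n.+1.-tuple RR * measurableTypeR R => ((tuncons q.1).2, q.2))).
  exact: measurable_rot.
apply: measurable_fun_pair; last exact: measurable_snd.
exact: (measurableT_comp (@measurable_tail R n) measurable_fst).
Qed.

(* A unitary change of variables makes [cdot z p] a multiple of the first
   coordinate; averaging over the rotations of the other coordinates, then of the
   first one, leaves only the [m]-th Taylor coefficient of [f] along [p]. *)
Lemma monomial_pairing f p m : (forall z, {for z, continuous f}) ->
  slice_entire f -> sqint f ->
  Lpair f (fun z => cdot z p ^+ m) =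
  ((Lmoment m)%:C)%C * coef (fun l : C => f (l *: p)) m.
Proof.
move=> cf sf f2.
have mf : meas f by exact: continuous_cmeasurable.
have i1 := Lpair_cintegrable mf (meas_monomial p m) f2 (sqint_monomial p m).
have [T [L [[pT cT lL dL] Lp]]] := unitary_map_to p.
set r := Num.sqrt _ in Lp.
have LD u v : L (u + v) = L u + L v by have := lL 1 u v; rewrite !scale1r.
have L0 : L 0 = 0 by apply: (addrI (L 0)); rewrite -LD !addr0.
have LZ a u : L (a *: u) = a *: L u by have := lL a u 0; rewrite L0 !addr0.
have rcD (x : C) (v : 'rV[C]_n) : rcons0 x v = rcons0 x 0 + rcons0 0 v.
  by rewrite rcons0D addr0 add0r.
have rcZ (x c : C) : rcons0 (c * x) (0 : 'rV[C]_n) = c *: rcons0 x 0.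
  by rewrite rcons0Z scaler0.
have E z : cdot (L z) p = z 0 0 * (r%:C)%C.
  by rewrite -Lp dL -[in LHS](rcons0_eta z) cdot_rcons0 conj_real -conj_cdot cdot0l conjC0 addr0.
pose x t := toC (tuncons t).1.
pose W t : C := ((weight psi (Cn_of t))%:C)%C.
pose F2 t := f (L (Cn_of t)) * ((x t * (r%:C)%C) ^+ m)^* * W t.
have W_unitary T' L' t : @unitary_map R n.+1 T' L' -> W (T' t) = W t.
  by move=> [_ cT' _ dL']; rewrite /W /weight cT' /normsq dL'.
have E2 t : f (Cn_of (T t)) * (cdot (Cn_of (T t)) p ^+ m)^* * W (T t) = F2 t.
  by rewrite /F2 (W_unitary T L) ?cT ?E ?Cn_of_hd.
have i2 : cintegrable lebC setT F2.
  have := preserving_cintegrable pT measurableT i1; rewrite preimage_setT.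
  by apply: eq_cintegrable => // t _; exact: E2.
have -> : Lpair f (fun z => cdot z p ^+ m) = cint lebC setT F2.
  rewrite /Lpair -(preserving_cint pT measurableT i1) preimage_setT.
  by apply: eq_cint => t _; exact: E2.
have u1 s : unitary_map (tail_rot s) _ := unitary_map_cons (unitary_map_rot n (normc_cis s)).
have u2 s : unitary_map (head_rot s) _ := unitary_map_phase n (normc_cis s).
pose K t := ((x t * (r%:C)%C) ^+ m)^* * W t.
pose F3 t := f (L (rcons0 (x t) 0)) * K t.
have E3 t s : F2 (tail_rot s t) =
    f (L (rcons0 (x t) 0) + cis s *: L (rcons0 0 (Cn_of (tuncons t).2))) * K t.
  rewrite /F2 (W_unitary _ _ _ (u1 s)) /x /tail_rot tconsK/= Cn_of_tcons Cn_of_rot.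
  by rewrite rcD LD -LZ rcons0Z mulr0 mulrA.
have eg1 t := sf (L (rcons0 (x t) 0)) (L (rcons0 0 (Cn_of (tuncons t).2))).
have c2 t : ccontinuous (fun s => F2 (tail_rot s t)).
  under eq_fun do rewrite E3.
  apply: ccontinuousM; last exact: ccontinuous_cst.
  have := ccontinuous_circle 1 (entire_continuous (eg1 t)).
  by under eq_fun do rewrite mul1r.
have p1 s : preserving lebC (tail_rot s) by have [] := u1 s.
have p2 s : preserving lebC (head_rot s) by have [] := u2 s.
(* Rotating the tail runs along a circle in a complex slice of [f]; by the mean value property the
   average sits at the centre, where the tail is 0. *)
have A3 t : cmean (fun s => F2 (tail_rot s t)) = F3 t.
  under eq_cmean do rewrite E3 mulrC.
  rewrite cmeanZ; last first.
    have := ccontinuous_circle 1 (entire_continuous (eg1 t)).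
    by under eq_fun do rewrite mul1r.
  by rewrite (cmean_entire (eg1 t)) scale0r addr0 mulrC.
have i3 : cintegrable lebC setT F3.
  by have := average_cintegrable measurable_tail_rot p1 i2 c2; apply: eq_cintegrable.
have -> : cint lebC setT F2 = cint lebC setT F3.
  rewrite (average_cint measurable_tail_rot p1 i2 c2).
  by apply: eq_cint => t _; exact: A3.
pose g (l : C) := f (l *: L (rcons0 1 0)).
have eg : entire g.
  by have := sf 0 (L (rcons0 1 0)); rewrite /g; under eq_fun do rewrite add0r.
have gx t : f (L (rcons0 (x t) 0)) = g (x t) by rewrite /g -LZ -rcZ mulr1.
(* Rotating the head turns the conjugate monomial into the character of frequency [-m], so the
   average is a Taylor coefficient of [g]. *)
have E4 t s : F3 (head_rot s t) = K t * (g (x t * cis s) * cis (- m%:R * s)).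
  rewrite /F3 gx /K (W_unitary _ _ _ (u2 s)) /x /head_rot tconsK/= ofCK.
  rewrite (mulrC (cis s)) mulNr cisN cis_mulrn -exprVn -cisN -conj_cis !exprMn.
  rewrite !rmorphM/= !rmorphXn/=; ring.
have c3 t : ccontinuous (fun s => F3 (head_rot s t)).
  under eq_fun do rewrite E4.
  apply: ccontinuousM; first exact: ccontinuous_cst.
  apply: ccontinuousM; last exact: ccontinuous_cisM.
  exact: ccontinuous_circle (entire_continuous eg).
have A4 t : cmean (fun s => F3 (head_rot s t)) =
    (coef g m * (r%:C)%C ^+ m) *
    ((normc (x t) ^+ (2 * m) * weight psi (Cn_of t))%:C)%C.
  under eq_cmean do rewrite E4.
  rewrite cmeanZ; last first.
    apply: ccontinuousM; last exact: ccontinuous_cisM.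
    exact: ccontinuous_circle (entire_continuous eg).
  rewrite -/(circle_coef g (- m%:R) (x t)) circle_coefE// /K /W.
  have -> : ((x t * (r%:C)%C) ^+ m)^* = (x t)^* ^+ m * (r%:C)%C ^+ m.
    by rewrite exprMn rmorphM/= !rmorphXn/= conj_real.
  have nx : ((normc (x t) ^+ (2 * m))%:C)%C = x t ^+ m * (x t)^* ^+ m.
    by rewrite -exprMn mulJc -rmorphXn/= exprM.
  by rewrite rmorphM/= nx; ring.
have i4 : cintegrable lebC setT (fun t => ((normc (x t) ^+ (2 * m) * weight psi (Cn_of t))%:C)%C).
  split; last exact: integrable0.
  apply/integrableP; split.
    apply/measurable_EFinP; apply: measurable_funM; last exact: measurable_weight.
    by apply: measurable_funX; apply: measurable_normc; apply: cmeasurable_toC; exact: measurable_head.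
  rewrite (eq_integral (fun t => (normc (x t) ^+ (2 * m) * weight psi (Cn_of t))%:E)).
    by rewrite integral_head_moment ltry.
  by move=> t _ /=; rewrite ger0_norm// mulr_ge0 ?weight_ge0// exprn_ge0// normc_ge0.
have -> : cint lebC setT F3 = cint lebC setT (fun t => (coef g m * (r%:C)%C ^+ m) *
    ((normc (x t) ^+ (2 * m) * weight psi (Cn_of t))%:C)%C).
  rewrite (average_cint measurable_head_rot p2 i3 c3).
  by apply: eq_cint => t _; exact: A4.
rewrite cintZ//.
have -> : cint lebC setT (fun t => ((normc (x t) ^+ (2 * m) * weight psi (Cn_of t))%:C)%C) =
    ((Lmoment m)%:C)%C.
  apply: complex_eqP; rewrite /= /Rintegral ?integral_head_moment//.
  by rewrite integral0.
rewrite mulrC; congr (_ * _).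
(* The vector [p] is [r] times [L (rcons0 1 0)], which accounts for the factor [r ^+ m]. *)
have -> : coef (fun l : C => f (l *: p)) m = circle_coef g (- m%:R) (r%:C)%C.
  rewrite /coef /circle_coef; apply: eq_cmean => s; congr (_ * _).
  by rewrite /g -Lp mul1r -LZ -[in LHS]rcZ -LZ -[in RHS]rcZ mulr1 mulrC.
by rewrite circle_coefE// mulrC.
Qed.

End monomial_pairing.

(** * The weight *)

Section weight_facts.
Variable R : realType.
Local Notation leb := (@lebesgue_measure R).
Local Notation D := (`[0%R, +oo[%classic : set (measurableTypeR R)).
Implicit Types (f psi : R -> R).

(** At [y > 0] the constraint [0 <= y + h] holds for all small [h], so the half-line derivative is
    the ordinary one. *)
Lemma is_derive_dhalf f (y : R) : 0 < y -> cvg (halfline_quotient f y) ->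
  is_derive y 1 f (dhalf f y).
Proof.
move=> y0 cf.
have H : (fun h => h^-1 *: ((f \o shift y) (h *: (1 : R)) - f y)) @ 0^' --> dhalf f y.
  apply/cvgrPdist_lt => e e0.
  move/cvgrPdist_lt: cf => /(_ e e0) cf.
  have : \forall h \near 0^', 0 <= y + h -> `|dhalf f y - h^-1 * (f (y + h) - f y)| < e by exact: cf.
  have : \forall h \near 0^', 0 <= y + h.
    apply: nbhs_dnbhs; apply: filterS (nbhs0_lt y0) => h; rewrite ltr_norml => /andP[h1 _].
    by rewrite -lerBlDl sub0r ltW.
  apply: filterS2 => h yh /(_ yh); rewrite /= /shift/= [_ *: 1]mulr1 addrC [h + y]addrC.
  by rewrite [_ + dhalf _ _]addrC.
split; first by apply/cvg_ex; exists (dhalf f y).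
exact: cvg_lim H.
Qed.

Lemma derive_ge0_homo f (df : R -> R) (x y : R) : (forall z : R, 0 < z -> is_derive z 1 f (df z)) ->
  (forall z : R, 0 < z -> 0 <= df z) -> 0 < x -> x <= y -> f x <= f y.
Proof.
move=> fd d0 x0; rewrite le_eqVlt => /predU1P[->//|xy].
have [c|//|c] := @MVT _ f df _ _ xy.
- by rewrite in_itv/= => /andP[xc _]; apply: fd; exact: lt_trans xc.
- apply: derivable_within_continuous => z; rewrite in_itv/= => /andP[xz _].
  by have [] := fd z (lt_le_trans x0 xz).
rewrite in_itv/= => /andP[xc _] E; rewrite -subr_ge0 E mulr_ge0//.
  by rewrite d0// (lt_trans x0).
by rewrite subr_ge0 ltW.
Qed.

Lemma exprn_le_fact_expR (x : R) m : 0 <= x -> x ^+ m <= m`!%:R * expR x.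
Proof.
move=> x0; case: m => [|m].
  by rewrite fact0 mul1r expr0 -expR0 ler_expR.
rewrite -ler_pdivrMl ?ltr0n ?fact_gt0// mulrC (le_trans _ (expR_ge1Dxn m x0))//.
by rewrite lerDr.
Qed.

Section admissible.
Variables (n : nat) (psi : R -> R).
Hypothesis psi_adm : admissible_weight n psi.

Let is_derive_iter k (y : R) : (k < 3)%N -> 0 < y ->
  is_derive y 1 (iter k (@dhalf R) psi) (iter k.+1 (@dhalf R) psi y).
Proof.
move=> k3 y0; have [_ [C3 _] _ _] := psi_adm.
by apply: is_derive_dhalf => //; apply: C3 => //; exact: ltW.
Qed.

Lemma weight_homo (x y : R) : 0 < x -> x <= y -> psi x <= psi y.
Proof.
apply: (@derive_ge0_homo _ (dhalf psi)) => z z0; first exact: (@is_derive_iter 0).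
by have [_ _ /(_ z (ltW z0))[/ltW]] := psi_adm.
Qed.

Lemma weight_slope_homo (x y : R) : 0 < x -> x <= y -> dhalf psi x <= dhalf psi y.
Proof.
apply: (@derive_ge0_homo _ (dhalf (dhalf psi))) => z z0; first exact: (@is_derive_iter 1).
by have [_ _ /(_ z (ltW z0))[]] := psi_adm.
Qed.

Lemma measurable_admissible : measurable_fun D psi.
Proof.
apply/measurable_fun_itv_obnd_cbndP; apply: open_continuous_measurable_fun.
  exact: interval_open.
move=> y; rewrite inE/= in_itv/= andbT => y0.
apply: differentiable_continuous; apply/derivable1_diffP.
by have [] := @is_derive_iter 0 y isT y0.
Qed.

(** Beyond 1, convexity puts the weight above its tangent at 1; before 1 the left-hand side is
    nonpositive. The base point 1 lies inside the half-line, where derivatives are two-sided. *)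
Lemma admissible_lower : exists2 a : R, 0 < a & forall y : R, 0 <= y -> a * (y - 1) <= psi y.
Proof.
have [psi0 _ psi1 _] := psi_adm.
exists (dhalf psi 1); first by have [] := psi1 1 ler01.
move=> y y0; have a0 : 0 <= dhalf psi 1 by have [/ltW] := psi1 1 ler01.
have [y1|y1] := leP y 1.
  by rewrite (@le_trans _ _ 0)// ?psi0// mulr_ge0_le0// subr_le0.
have [c|//|c] := @MVT _ psi (dhalf psi) _ _ y1.
- by rewrite in_itv/= => /andP[xc _]; apply: (@is_derive_iter 0) => //; exact: lt_trans xc.
- apply: derivable_within_continuous => z; rewrite in_itv/= => /andP[xz _].
  by have [] := @is_derive_iter 0 z isT (lt_le_trans ltr01 xz).
rewrite in_itv/= => /andP[c1 _] E.
rewrite (@le_trans _ _ (psi y - psi 1))//; last by rewrite gerBl psi0.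
rewrite E ler_wpM2r//; first by rewrite subr_ge0 ltW.
by apply: weight_slope_homo => //; exact: ltW.
Qed.

Lemma integrable_admissible m :
  leb.-integrable D (EFin \o (fun s : R => s ^+ m * expR (- psi s))).
Proof.
have [a a0 lower] := admissible_lower.
have b0 : 0 < a / 2 by rewrite divr_gt0.
have mD : measurable D by exact: measurable_itv.
(* The decay [expR (- a * s)] is split in halves: one absorbs [s ^+ m] through [exprn_le_fact_expR],
   the other remains as an exponential density of rate [a / 2], whose normalization is the last
   divisor. The factor [expR a] comes from the [- 1] in the lower bound. *)
pose K := m`!%:R / (a / 2) ^+ m * expR a / (a / 2).
have K0 : 0 <= K by rewrite /K !mulr_ge0 ?invr_ge0 ?exprn_ge0 ?expR_ge0 ?ler0n ?ltW// mulr_ge0// ltW.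
apply: (@le_integrable _ _ _ _ D mD _ (fun s => K%:E * (exponential_pdf (a / 2) s)%:E)%E).
- apply/measurable_EFinP; apply: measurable_funM.
    by apply: measurable_funX; exact: measurable_id.
  apply: (measurableT_comp (@measurable_expR R)); apply: measurable_funN.
  exact: measurable_admissible.
- move=> s; rewrite /= in_itv/= andbT => s0.
  have pK : 0 <= K * exponential_pdf (a / 2) s by rewrite mulr_ge0// exponential_pdf_ge0// ltW.
  rewrite lee_fin [leRHS]ger0_norm// ger0_norm; last by rewrite mulr_ge0 ?exprn_ge0 ?expR_ge0.
  rewrite /exponential_pdf patchE/= mem_set; last by rewrite /= in_itv/= andbT.
  rewrite /K mulrA divfK ?gt_eqF//.
  have E1 : expR (- psi s) <= expR a * expR (- (a / 2) * s) * expR (- (a / 2) * s).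
    rewrite -!expRD ler_expR; have := lower _ s0; rewrite mulrBr mulr1 => L.
    by rewrite -addrA -mulrDl -opprD -splitr mulNr; lra.
  have E2 : s ^+ m <= m`!%:R / (a / 2) ^+ m * expR (a / 2 * s).
    rewrite mulrAC ler_pdivlMr ?exprn_gt0// -exprMn mulrC exprn_le_fact_expR//.
    by rewrite mulr_ge0// ltW.
  apply: (le_trans (ler_pM _ _ E2 E1)); rewrite ?exprn_ge0 ?expR_ge0//.
  rewrite -!mulrA ler_wpM2l// ler_wpM2l ?invr_ge0 ?exprn_ge0// ?(ltW b0)//.
  rewrite mulrCA ler_wpM2l ?expR_ge0//.
  by rewrite -!expRD ler_expR; lra.
- apply: integrableZl => //; apply: integrableS (integrable_exponential_pdf b0) => //.
Qed.

(** Only [[T, T + 1]] is kept, where [psi] is at most [psi (T + 1)]. Since [T] is arbitrary, the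
    moments outgrow every geometric sequence. *)
Lemma cmoment_ge (T : R) r : 0 < T -> T ^+ r * expR (- psi (T + 1)) <= cmoment psi r.
Proof.
move=> T0; have I := integrable_admissible r.
rewrite -lee_fin /cmoment /Rintegral fineK; last exact: integrable_fin_num I.
have sub : `[T, T + 1] `<=` D.
  by move=> s /=; rewrite !in_itv/= andbT => /andP[Ts _]; exact: le_trans (ltW T0) Ts.
have mI : measurable (`[T, T + 1] : set (measurableTypeR R)) by exact: measurable_itv.
have nn s : D s -> (0 <= (s ^+ r * expR (- psi s))%:E)%E.
  by rewrite /= in_itv/= andbT => s0; rewrite lee_fin mulr_ge0 ?exprn_ge0 ?expR_ge0.
have mf := measurable_int _ I.
apply: (@le_trans _ _ (\int[leb]_(s in `[T, (T + 1)%R]) (s ^+ r * expR (- psi s))%:E)%E); last first.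
  by apply: ge0_subset_integral => //; exact: measurable_itv.
rewrite (_ : (_ * _)%:E = (\int[leb]_(s in `[T, (T + 1)%R]) (T ^+ r * expR (- psi (T + 1)))%:E)%E); last first.
  rewrite integral_cst//= lebesgue_measure_itv/= lte_fin ltrDl ltr01.
  by rewrite -EFinB [T + 1]addrC addrK mule1.
apply: ge0_le_integral => //.
- by move=> s _; rewrite lee_fin mulr_ge0 ?exprn_ge0 ?expR_ge0// ltW.
- exact: measurable_funS mf.
- move=> s; rewrite /= in_itv/= => /andP[Ts sT].
  rewrite lee_fin ler_pM ?exprn_ge0 ?expR_ge0 ?(ltW T0)//.
    by rewrite lerXn2r ?nnegrE ?(ltW T0)// (le_trans (ltW T0)).
  by rewrite ler_expR lerN2 weight_homo// (lt_le_trans T0).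
Qed.

Lemma cmoment_gt0 r : 0 < cmoment psi r.
Proof.
apply: lt_le_trans (cmoment_ge r ltr01).
by rewrite expr1n mul1r expR_gt0.
Qed.

End admissible.
End weight_facts.

(** * The Fock space and its kernel *)

Section Fock_space_facts.
Variables (R : realType) (n : nat).
Local Notation C := R[i].
Local Notation Cn := 'rV[R[i]]_n.+1.
Local Notation RR := (measurableTypeR R * measurableTypeR R)%type.
Local Notation lebC := (lebesgueC R n.+1).
Implicit Types (f g : Cn -> C) (p z : Cn).

Lemma holomorphic_continuous f : holomorphic f -> forall z, {for z, continuous f}.
Proof. by move=> hf z; exact: differentiable_continuous. Qed.

Lemma holomorphic_slice_entire f : holomorphic f -> slice_entire f.
Proof.
move=> hf p q l.
apply: (@differentiable_comp _ _ _ _ (fun l : C => p + l *: q) f l); last exact: hf.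
apply: differentiableD; first exact: differentiable_cst.
exact: differentiableZl.
Qed.

Lemma holomorphic_monomial p m : holomorphic (fun z => cdot z p ^+ m).
Proof.
move=> z; elim: m => [|m IH]; first exact: (differentiable_cst (1 : C) z).
rewrite (_ : (fun z : Cn => _) = (fun z => cdot z p) * (fun z => cdot z p ^+ m)); last first.
  by apply/funext => w; rewrite exprS.
apply: differentiableM => //.
rewrite (_ : (fun z => cdot z p) = \sum_j (fun z : Cn => z 0 j * (p 0 j)^*)); last first.
  by apply/funext => w; rewrite fct_sumE.
apply: differentiable_sum => j.
by apply: differentiableM; [exact: differentiable_coord|exact: differentiable_cst].
Qed.

Variable psi : R -> R.
Hypothesis psi_adm : admissible_weight n.+1 psi.

Let mpsi := measurable_admissible psi_adm.
Let ipsi := integrable_admissible psi_adm.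

Definition Fock_factor : R := n`!%:R / pi ^+ n.+1.

Lemma Fock_factor_gt0 : 0 < Fock_factor.
Proof. by rewrite divr_gt0 ?exprn_gt0 ?pi_gt0// ltr0n fact_gt0. Qed.

Lemma holomorphic_meas f : holomorphic f -> meas f.
Proof. by move/holomorphic_continuous; exact: continuous_cmeasurable. Qed.

Lemma FockP f : Fock psi f <-> holomorphic f /\ sqint psi f.
Proof.
have c0 := Fock_factor_gt0.
have mf2 : holomorphic f ->
    measurable_fun setT (fun t => (normc (f (Cn_of t)) ^+ 2 * weight psi (Cn_of t))%:E).
  move=> hf; apply/measurable_EFinP; apply: (sqint_measurable mpsi).
  exact: holomorphic_meas.
have E : holomorphic f ->
  (\int[muC R n.+1]_t (normc (f (Cn_of t)) ^+ 2 * weight psi (Cn_of t))%:E =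
  Fock_factor%:E * \int[lebC]_t (normc (f (Cn_of t)) ^+ 2 * weight psi (Cn_of t))%:E)%E.
  move=> hf; rewrite ge0_integral_mscale//.
    exact: mf2.
  by move=> t _; rewrite lee_fin mulr_ge0 ?sqr_ge0// weight_ge0.
have abs : (\int[lebC]_t `|(normc (f (Cn_of t)) ^+ 2 * weight psi (Cn_of t))%:E| =
  \int[lebC]_t (normc (f (Cn_of t)) ^+ 2 * weight psi (Cn_of t))%:E)%E.
  apply: eq_integral => t _.
  by rewrite /= ger0_norm// mulr_ge0 ?sqr_ge0// weight_ge0.
split => -[hf If]; split => //.
  apply/integrableP; split.
    exact: mf2.
  rewrite abs; move: If; rewrite E//.
  case: (integral _ _ _) => [r||] //.
    by rewrite !ltry.
  by rewrite gt0_muley// ?lte_fin.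
rewrite E//; move/integrableP : If => [_].
by rewrite abs => If; rewrite lte_mul_pinfty// ?lee_fin ?(ltW c0).
Qed.

Let integral_muC (h : n.+1.-tuple RR -> R) : lebC.-integrable setT (EFin \o h) ->
  \int[muC R n.+1]_t h t = Fock_factor * \int[lebC]_t h t.
Proof.
move=> ih; have mh := measurable_int _ ih.
rewrite /Rintegral integralE [in RHS]integralE.
rewrite !ge0_integral_mscale//; last 2 first.
  exact: measurable_funeneg.
  exact: measurable_funepos.
have fp := integrable_pos_fin_num measurableT ih.
have fm := integrable_neg_fin_num measurableT ih.
rewrite -muleBr//; last by rewrite fin_num_adde_defl// fin_numN.
by rewrite fineM// fin_numB fp fm.
Qed.

Lemma Fock_innerE f g : Fock psi f -> Fock psi g ->
  Fock_inner psi f g = ((Fock_factor)%:C)%C * Lpair psi f g.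
Proof.
move=> /FockP[/holomorphic_meas mf f2] /FockP[/holomorphic_meas mg g2].
have [i1 i2] := Lpair_cintegrable mpsi mf mg f2 g2.
rewrite /Fock_inner /Cintegral !integral_muC//.
by apply: complex_eqP; rewrite ?Re_realM ?Im_realM.
Qed.

End Fock_space_facts.

(** * The kernel series *)

Section kernel.
Variables (R : realType) (n : nat) (psi : R -> R).
Local Notation C := R[i].
Local Notation Cn := 'rV[R[i]]_n.+1.
Implicit Types (p z : Cn).

Hypothesis psi_adm : admissible_weight n.+1 psi.

(** The coefficient of [Fock_kernel] in dimension [n.+1] after substituting [r = m + n]: the falling
    factorial divided by [n!] is a binomial coefficient. *)
Definition kernel_coef m : R := 'C(m + n, n)%:R / cmoment psi (m + n).

Definition kernel_sum p M z : C := \sum_(m < M) ((kernel_coef m)%:C)%C * cdot z p ^+ m.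

Lemma kernel_coef_gt0 m : 0 < kernel_coef m.
Proof. by rewrite divr_gt0 ?(cmoment_gt0 psi_adm)// ltr0n bin_gt0 leq_addl. Qed.

(** The normalization behind the reproducing property: each kernel coefficient is inverse to the
    moment that [monomial_pairing] produces. *)
Lemma kernel_coefK m : Fock_factor R n * Lmoment n psi m * kernel_coef m = 1.
Proof.
rewrite /Fock_factor /Lmoment /kernel_coef.
have b := @bin_fact (m + n) n (leq_addl _ _).
rewrite -b addnK !natrM.
have p0 : pi ^+ n.+1 != 0 :> R by rewrite gt_eqF// exprn_gt0// pi_gt0.
have c0 : cmoment psi (m + n) != 0 by rewrite gt_eqF// (cmoment_gt0 psi_adm).
have n0 k : k`!%:R != 0 :> R by rewrite pnatr_eq0 -lt0n fact_gt0.
have b0 : 'C(m + n, n)%:R != 0 :> R by rewrite pnatr_eq0 -lt0n bin_gt0 leq_addl.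
field.
by rewrite p0 c0 !n0 b0.
Qed.

Lemma bin_le_exp2 k m : ('C(k, m) <= 2 ^ k)%N.
Proof.
have [mk|km] := leqP m k; last by rewrite bin_small.
rewrite -[2%N]/(1 + 1)%N expnDn (bigD1 (Ordinal (mk : (m < k.+1)%N)))//=.
by rewrite !exp1n !muln1 leq_addr.
Qed.

Lemma kernel_coef_growth (x : R) : 0 <= x ->
  exists2 E : R, 0 <= E & forall m, kernel_coef m * x ^+ m <= E * 2^-1 ^+ m.
Proof.
(* The binomial coefficient is at most [2 ^ (m + n)]. This [T] satisfies [2 * x <= T / 2], which
   leaves a factor [2^-1 ^+ m] to spare, and [2 <= T] for the remaining power [n]. *)
move=> x0; pose T := 4 * (x + 1).
have T0 : 0 < T by rewrite /T; lra.
exists (expR (psi (T + 1))); first exact: expR_ge0.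
move=> m; rewrite /kernel_coef mulrAC ler_pdivrMr ?(cmoment_gt0 psi_adm)//.
have Cm := cmoment_ge psi_adm (m + n) T0.
apply: le_trans (ler_wpM2l _ Cm); last by rewrite mulr_ge0 ?expR_ge0// exprn_ge0// invr_ge0.
have -> : expR (psi (T + 1)) * 2^-1 ^+ m * (T ^+ (m + n) * expR (- psi (T + 1))) =
    2^-1 ^+ m * T ^+ (m + n).
  rewrite expRN; have : expR (psi (T + 1)) != 0 by rewrite gt_eqF// expR_gt0.
  by move: (expR _) (2^-1 ^+ m) (T ^+ _) => e u v e0; field.
apply: (@le_trans _ _ (2 ^+ (m + n) * x ^+ m)).
  by rewrite ler_wpM2r ?exprn_ge0// -natrX ler_nat bin_le_exp2.
rewrite !exprD mulrAC -exprMn mulrA -exprMn ler_pM ?exprn_ge0 ?mulr_ge0//.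
  by rewrite lerXn2r ?nnegrE ?mulr_ge0// /T; lra.
by rewrite lerXn2r ?nnegrE// /T; lra.
Qed.

Lemma kernel_sum_cvg p z : exists l : C,
  forall eps : R, 0 < eps -> \forall M \near \oo, normc (kernel_sum p M z - l) < eps.
Proof.
have [E E0 HE] := kernel_coef_growth (normc_ge0 (cdot z p)).
pose b m := ((kernel_coef m)%:C)%C * cdot z p ^+ m.
have bE m : normc (b m) <= E * 2^-1 ^+ m.
  rewrite normcM normc_real normcX ger0_norm//.
  by rewrite ltW ?kernel_coef_gt0.
have key (u : nat -> R) : (forall m, `|u m| <= normc (b m)) -> cvgn (series u).
  move=> ub; apply: normed_cvg.
  apply: (@series_le_cvg _ _ (fun m => E * 2^-1 ^+ m)) => //.
  - by move=> m; exact: normr_ge0.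
  - by move=> m; rewrite mulr_ge0// exprn_ge0// invr_ge0.
  - by move=> m; exact: le_trans (ub m) (bE m).
  - by apply: (@is_cvg_geometric_series R E 2^-1); rewrite ger0_norm ?invr_ge0// invf_lt1// ltr1n.
have cR := key _ (fun m => normc_Re_le (b m)).
have cI := key _ (fun m => normc_Im_le (b m)).
exists (Complex (limn (series (fun m => Re (b m)))) (limn (series (fun m => Im (b m))))).
move=> eps e0; have e2 : 0 < eps / 2 by rewrite divr_gt0.
move/cvgrPdist_lt : cR => /(_ _ e2); move/cvgrPdist_lt : cI => /(_ _ e2).
apply: filterS2 => M hI hR.
apply: le_lt_trans (normc_le_ReIm _) _.
rewrite ReD ImD ReN ImN.
have -> : Re (kernel_sum p M z) = series (fun m => Re (b m)) M.
  rewrite /kernel_sum /series/= big_mkord.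
  by apply: (big_morph (fun x : C => Re x)) => // x y; rewrite ReD.
have -> : Im (kernel_sum p M z) = series (fun m => Im (b m)) M.
  rewrite /kernel_sum /series/= big_mkord.
  by apply: (big_morph (fun x : C => Im x)) => // x y; rewrite ImD.
by rewrite distrC [X in _ + X]distrC (splitr eps) ltrD.
Qed.

Lemma Fock_kernel_lim p z (l : C) :
  (forall eps : R, 0 < eps -> \forall M \near \oo, normc (kernel_sum p M z - l) < eps) ->
  Fock_kernel psi p z = l.
Proof.
move=> H; rewrite /Fock_kernel.
have /cvg_lim -> // : (\sum_(n.+1.-1 <= r < N) (r ^_ n.+1.-1)%:R / ((cmoment psi r)%:C)%C *
   cdot z p ^+ (r - n.+1.-1)) @[N --> \oo] --> (n`!%:R * l : C).
  have HS : kernel_sum p M z @[M --> \oo] --> (l : C).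
    by apply/(cvg_normcP _ (kernel_sum p ^~ z)) => eps e0; exact: H.
  have := @cvgMl_tmp C _ _ _ _ (n`!%:R) _ HS.
  (* Shifting the upper limit by [n] aligns the sum from [r = n] with the sum from [m = 0]. *)
  move=> /(_ _) HS2; rewrite -(cvg_shiftn n).
  rewrite (_ : (fun _ => _) = (fun M => n`!%:R * kernel_sum p M z)); first exact: HS2.
  apply/funext => M /=.
  rewrite -{1}[n]add0n big_addn addnK big_mkord mulr_sumr; apply: eq_bigr => i _.
  rewrite addnK /kernel_coef fmorph_div rmorph_nat -bin_ffact natrM /=.
  by rewrite !mulrA [n`!%:R * _]mulrC.
by rewrite /= mulKf// pnatr_eq0 -lt0n fact_gt0.
Qed.

Lemma kernel_sum_Fock_kernel p z (eps : R) : 0 < eps ->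
  \forall M \near \oo, normc (kernel_sum p M z - Fock_kernel psi p z) < eps.
Proof. by have [l Hl] := kernel_sum_cvg p z; rewrite (Fock_kernel_lim Hl); exact: Hl. Qed.

End kernel.

Lemma coef_scaled_monomial (R : realType) (c : R[i]) m k :
  coef (fun l => c * l ^+ m) k = if m == k then c else 0.
Proof.
rewrite /coef /circle_coef.
rewrite (@eq_cmean _ _ (fun t => c * cis ((m%:R - k%:R) * t))); last first.
  by move=> t; rewrite mul1r -cis_mulrn -mulrA -cisD mulrBl mulNr.
rewrite cmeanZ; last exact: ccontinuous_cisM.
case: eqP => [->|/eqP mk].
  rewrite (@eq_cmean _ _ (fun=> 1)) ?cmean_cst ?mulr1// => t.
  by rewrite subrr mul0r cis0.
rewrite cmean_cis ?mulr0//; last by rewrite subr_eq0 eqr_nat.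
by rewrite mulrBl cisD cisN !cis_natM_2pi invr1 mulr1.
Qed.

(** * Pairing with partial sums of the kernel *)

Section pairing_with_kernel_sums.
Variables (R : realType) (n : nat) (psi : R -> R).
Local Notation C := R[i].
Local Notation Cn := 'rV[R[i]]_n.+1.
Local Notation RR := (measurableTypeR R * measurableTypeR R)%type.
Local Notation lebC := (lebesgueC R n.+1).
Implicit Types (f g : Cn -> C) (p z : Cn) (b : nat -> R).

Hypothesis psi_adm : admissible_weight n.+1 psi.

Let mpsi := measurable_admissible psi_adm.
Let ipsi := integrable_admissible psi_adm.
Let w0 z : 0 <= weight psi z := weight_ge0 psi z.

Lemma measD f g : meas f -> meas g -> meas (fun z => f z + g z).
Proof. by move=> mf mg; exact: cmeasurableD. Qed.

Lemma measZ (c : C) f : meas f -> meas (fun z => c * f z).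
Proof. by move=> mf; apply: cmeasurableM => //; exact: cmeasurable_cst. Qed.

Lemma sqintZ (c : C) f : sqint psi f -> sqint psi (fun z => c * f z).
Proof.
move=> f2; have := integrableZl measurableT (normc c ^+ 2) f2.
apply: eq_integrable => // t _ /=.
by rewrite -EFinM normcM exprMn mulrA.
Qed.

Lemma sqintD f g : meas f -> meas g -> sqint psi f -> sqint psi g ->
  sqint psi (fun z => f z + g z).
Proof.
move=> mf mg f2 g2.
have := integrableZl measurableT 2 (integrableD measurableT f2 g2).
apply: le_integrable => //.
  apply/measurable_EFinP; apply: (@sqint_measurable _ _ _ mpsi (fun z => f z + g z)).
  exact: measD.
move=> t _; rewrite /= lee_fin !ger0_norm ?mulr_ge0 ?addr_ge0 ?mulr_ge0 ?exprn_ge0 ?w0 ?normc_ge0//.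
rewrite -mulrDl mulrA ler_wpM2r ?w0//.
have := ler_normcD (f (Cn_of t)) (g (Cn_of t)); have := normc_ge0 (f (Cn_of t) + g (Cn_of t)).
set x := normc (f _); set y := normc (g _); set u := normc _ => u0 uxy.
have : u ^+ 2 <= (x + y) ^+ 2 by rewrite lerXn2r ?nnegrE// (le_trans u0).
have := sqr_ge0 (x - y); rewrite !expr2; nra.
Qed.

Lemma conj_Lpair f g : meas f -> meas g -> sqint psi f -> sqint psi g ->
  (Lpair psi f g)^* = Lpair psi g f.
Proof.
move=> mf mg f2 g2; rewrite /Lpair -cint_conj//; last exact: Lpair_cintegrable.
apply: eq_cint => t _.
by rewrite !rmorphM/= conjCK conj_real [g _ * _]mulrC.
Qed.

Lemma LpairZr (c : C) f g : meas f -> meas g -> sqint psi f -> sqint psi g ->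
  Lpair psi f (fun z => c * g z) = c^* * Lpair psi f g.
Proof.
move=> mf mg f2 g2; rewrite /Lpair -cintZ//; last exact: Lpair_cintegrable.
by apply: eq_cint => t _; rewrite rmorphM/= !mulrA [f _ * _]mulrC.
Qed.

Lemma LpairDr f g h : meas f -> meas g -> meas h ->
    sqint psi f -> sqint psi g -> sqint psi h ->
  Lpair psi f (fun z => g z + h z) = Lpair psi f g + Lpair psi f h.
Proof.
move=> mf mg mh f2 g2 h2; rewrite /Lpair -cintD//; try exact: Lpair_cintegrable.
by apply: eq_cint => t _; rewrite rmorphD/= mulrDr mulrDl.
Qed.

(** Arbitrary real coefficients, so that truncated tails of the kernel series are covered as well as
    its partial sums. *)
Definition monomial_sum b p N z := \sum_(m < N) ((b m)%:C)%C * cdot z p ^+ m.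

Lemma monomial_sumS b p N :
  monomial_sum b p N.+1 = fun z => monomial_sum b p N z + ((b N)%:C)%C * cdot z p ^+ N.
Proof. by apply/funext => z; rewrite /monomial_sum big_ord_recr. Qed.

Lemma monomial_sum_meas_sqint b p N :
  meas (monomial_sum b p N) /\ sqint psi (monomial_sum b p N).
Proof.
elim: N => [|N [mN sN]].
  rewrite (_ : monomial_sum _ _ _ = fun z => 0 * cdot z p ^+ 0); last first.
    by apply/funext => z; rewrite /monomial_sum big_ord0 mul0r.
  split; first by apply: measZ; exact: meas_monomial.
  by apply: sqintZ; exact: sqint_monomial.
rewrite monomial_sumS; split.
  by apply: measD => //; apply: measZ; exact: meas_monomial.
apply: sqintD => //; first by apply: measZ; exact: meas_monomial.
by apply: sqintZ; exact: sqint_monomial.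
Qed.

Lemma Lpair_monomial_sum f b p N : meas f -> sqint psi f ->
  Lpair psi f (monomial_sum b p N) =
  \sum_(m < N) ((b m)%:C)%C * Lpair psi f (fun z => cdot z p ^+ m).
Proof.
move=> mf f2; elim: N => [|N IH].
  rewrite big_ord0 (_ : monomial_sum _ _ _ = fun z => 0 * cdot z p ^+ 0); last first.
    by apply/funext => z; rewrite /monomial_sum big_ord0 mul0r.
  rewrite LpairZr//; first by rewrite conjC0 mul0r.
  exact: sqint_monomial.
have mm := @meas_monomial R n p N; have sm := sqint_monomial mpsi ipsi p N.
have [mS sS] := monomial_sum_meas_sqint b p N.
rewrite big_ord_recr /= -IH monomial_sumS LpairDr ?LpairZr ?conj_real//.
  exact: measZ.
exact: sqintZ.
Qed.

(** Orthogonality is a case of [monomial_pairing]: along [p] the monomial is a multiple of [l ^+ m],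
    which has a single Taylor coefficient. *)
Lemma Lpair_monomials p m k :
  Lpair psi (fun z => cdot z p ^+ m) (fun z => cdot z p ^+ k) =
  if m == k then ((Lmoment n psi m * normsq p ^+ m)%:C)%C else 0.
Proof.
rewrite (monomial_pairing mpsi ipsi); last 3 first.
- by apply: holomorphic_continuous; exact: holomorphic_monomial.
- by apply: holomorphic_slice_entire; exact: holomorphic_monomial.
- exact: sqint_monomial.
rewrite (_ : (fun l : C => _) = fun l => ((normsq p ^+ m)%:C)%C * l ^+ m); last first.
  by apply/funext => l; rewrite cdotZl cdot_normsq exprMn mulrC rmorphXn.
rewrite coef_scaled_monomial; case: eqP => [->|]; last by rewrite mulr0.
by rewrite [RHS]rmorphM.
Qed.

Lemma Lpair_monomial_sums b p N :
  Lpair psi (monomial_sum b p N) (monomial_sum b p N) =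
  ((\sum_(m < N) b m ^+ 2 * Lmoment n psi m * normsq p ^+ m)%:C)%C.
Proof.
have [mS sS] := monomial_sum_meas_sqint b p N.
rewrite Lpair_monomial_sum// rmorph_sum; apply: eq_bigr => m _.
have mm := @meas_monomial R n p m; have sm := sqint_monomial mpsi ipsi p m.
rewrite -conj_Lpair// Lpair_monomial_sum// (bigD1 m)//= big1 ?addr0; last first.
  by move=> k km; rewrite Lpair_monomials eq_sym (negbTE (_ : k != m :> nat))// mulr0.
rewrite Lpair_monomials eqxx; move: (Lmoment _ _ _) (_ ^+ _) => L X.
by apply: complex_eqP; rewrite rmorphM/= ?conj_real ?Re_realM ?Im_realM/= ?mulr0//; ring.
Qed.

End pairing_with_kernel_sums.

(** * The reproducing property *)

Section reproducing.
Variables (R : realType) (n : nat) (psi : R -> R).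
Local Notation C := R[i].
Local Notation Cn := 'rV[R[i]]_n.+1.
Local Notation RR := (measurableTypeR R * measurableTypeR R)%type.
Local Notation lebC := (lebesgueC R n.+1).
Implicit Types (f g : Cn -> C) (p z : Cn) (b : nat -> R).

Hypothesis psi_adm : admissible_weight n.+1 psi.

Let mpsi := measurable_admissible psi_adm.
Let ipsi := integrable_admissible psi_adm.
Let w0 z : 0 <= weight psi z := weight_ge0 psi z.
Let c0 : R := Fock_factor R n.
Let c0_gt0 : 0 < c0. Proof. exact: Fock_factor_gt0. Qed.

Lemma integral_sq f : meas f -> sqint psi f ->
  (\int[lebC]_t (normc (f (Cn_of t)) ^+ 2 * weight psi (Cn_of t))%:E =
   (Re (Lpair psi f f))%:E)%E.
Proof.
move=> mf f2; rewrite /Lpair /cint [Re _]/=.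
rewrite (@eq_Rintegral _ _ _ _ _ (fun t => normc (f (Cn_of t)) ^+ 2 * weight psi (Cn_of t))).
  by rewrite /Rintegral fineK//; exact: integrable_fin_num f2.
by move=> t _; rewrite mulJc -rmorphM.
Qed.

Let tail M m := if (m < M)%N then 0 else kernel_coef n psi m.

Lemma tail_monomial_sum p M N z : (M <= N)%N ->
  monomial_sum (tail M) p N z = kernel_sum psi p N z - kernel_sum psi p M z.
Proof.
move=> MN; pose F b m : C := ((b m)%:C)%C * cdot z p ^+ m.
rewrite /monomial_sum /kernel_sum -(big_mkord xpredT (F (tail M))).
rewrite -!(big_mkord xpredT (F (kernel_coef n psi))) !(big_cat_nat (leq0n M) MN)//=.
rewrite [X in _ = X - _]addrC addrK /F.
rewrite big_nat big1 ?add0r.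
  by apply: eq_big_nat => m /andP[Mm _]; rewrite /tail ltnNge Mm.
by move=> m /andP[_ mM]; rewrite /tail mM mul0r.
Qed.

(** By [kernel_coefK], [kernel_coef ^+ 2 * Lmoment] is [kernel_coef / c0], so the squared norm of a
    tail is a tail of the scalar kernel series at [normsq p], which decays geometrically. *)
Lemma tail_bound p : exists2 E : R, 0 <= E & forall M N, (M <= N)%N ->
  \sum_(m < N) tail M m ^+ 2 * Lmoment n psi m * normsq p ^+ m <= E * 2^-1 ^+ M.
Proof.
have [E E0 HE] := kernel_coef_growth psi_adm (normsq_ge0 p).
exists (c0^-1 * E * 2); first by rewrite !mulr_ge0 ?invr_ge0// ltW.
move=> M N MN.
rewrite -(big_mkord xpredT (fun m => tail M m ^+ 2 * Lmoment n psi m * normsq p ^+ m)).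
rewrite (big_cat_nat (leq0n M) MN)//= big_nat big1 ?add0r; last first.
  by move=> m /andP[_ mM]; rewrite /tail mM expr0n/= !mul0r.
(* A discrete primitive of the geometric bound: [u m.+1 - u m] is [c0^-1 * E * 2^-1 ^+ m]. *)
pose u k : R := - (c0^-1 * E * 2 * 2^-1 ^+ k).
apply: (@le_trans _ _ (\sum_(M <= k < N) (u k.+1 - u k))).
  apply: ler_sum_nat => m /andP[Mm _]; rewrite /tail ltnNge Mm/=.
  have := kernel_coefK psi_adm m; rewrite -/c0 => K.
  have -> : kernel_coef n psi m ^+ 2 * Lmoment n psi m = c0^-1 * kernel_coef n psi m.
    apply: (mulfI (lt0r_neq0 c0_gt0)); rewrite mulVKf ?gt_eqF//.
    by rewrite -[RHS]mul1r -K; ring.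
  have -> : u m.+1 - u m = c0^-1 * (E * 2^-1 ^+ m).
    by rewrite /u exprS; field; rewrite gt_eqF.
  by rewrite -mulrA ler_wpM2l ?invr_ge0 ?(ltW c0_gt0)// HE.
rewrite telescope_sumr// /u opprK addrC gerBl.
by rewrite !mulr_ge0 ?exprn_ge0 ?invr_ge0// ltW.
Qed.

(** Square integrability of the kernel is not at hand here; Fatou's lemma bounds the norm of the
    pointwise limit by the norms of the finite tails. *)
Let kernel_tail_fatou p M :
  (\int[lebC]_t (normc (Fock_kernel psi p (Cn_of t) - kernel_sum psi p M (Cn_of t)) ^+ 2 *
     weight psi (Cn_of t))%:E <=
   limn_einf (fun k => (\sum_(m < M + k) tail M m ^+ 2 * Lmoment n psi m * normsq p ^+ m)%:E))%E.
Proof.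
pose F k t := (normc (monomial_sum (tail M) p (M + k) (Cn_of t)) ^+ 2 * weight psi (Cn_of t))%:E.
have mF k : measurable_fun setT (F k).
  apply/measurable_EFinP; apply: sqint_measurable => //.
  by have [] := monomial_sum_meas_sqint psi_adm (tail M) p (M + k).
have F0 k t : setT t -> (0 <= F k t)%E.
  by move=> _; rewrite lee_fin mulr_ge0 ?w0 ?exprn_ge0 ?normc_ge0.
have := fatou lebC measurableT mF F0.
congr (_ <= _)%E.
  apply: eq_integral => t _; set z := Cn_of t.
  suff /cvg_limn_einf_sup[-> _] : (F ^~ t) @ \oo -->
    (normc (Fock_kernel psi p z - kernel_sum psi p M z) ^+ 2 * weight psi z)%:E by [].
  apply: cvg_EFin; first exact: nearW.
  have c : normc (monomial_sum (tail M) p (M + k) z) @[k --> \oo] -->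
      normc (Fock_kernel psi p z - kernel_sum psi p M z).
    apply/cvgrPdist_lt => e e0.
    have : \forall k \near \oo, normc (kernel_sum psi p (k + M) z - Fock_kernel psi p z) < e.
      have [N _ HN] := kernel_sum_Fock_kernel psi_adm p z e0.
      by exists N => // k /= Nk; apply: HN; rewrite /= (leq_trans Nk)// leq_addr.
    apply: filterS => k; apply: le_lt_trans.
    rewrite tail_monomial_sum ?leq_addr// (le_trans (dist_normc _ _))//.
    by rewrite opprB addrA subrK normcB addnC.
  by rewrite /comp/=; apply: cvgMr_tmp; rewrite expr2; exact: cvgM.
congr limn_einf; apply/funext => k.
have [mS sS] := monomial_sum_meas_sqint psi_adm (tail M) p (M + k).
by rewrite integral_sq// Lpair_monomial_sums.
Qed.

Lemma kernel_tail_integral p : exists2 E : R, 0 <= E & forall M,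
  (\int[lebC]_t (normc (Fock_kernel psi p (Cn_of t) - kernel_sum psi p M (Cn_of t)) ^+ 2 *
     weight psi (Cn_of t))%:E <= (E * 2^-1 ^+ M)%:E)%E.
Proof.
have [E E0 HE] := tail_bound p; exists E => // M.
apply: le_trans (kernel_tail_fatou p M) _.
rewrite limn_einf_lim; apply: lime_le; first exact: is_cvg_einfs.
apply: nearW => k; apply: (@le_trans _ _ (\sum_(m < M + k) tail M m ^+ 2 * Lmoment n psi m *
  normsq p ^+ m)%:E); last by rewrite lee_fin HE// leq_addr.
by apply: ereal_inf_lbound; exists k => /=.
Qed.

Lemma kernel_reproducing f p : holomorphic f -> sqint psi f ->
    meas (Fock_kernel psi p) -> sqint psi (Fock_kernel psi p) ->
  (c0%:C)%C * Lpair psi f (Fock_kernel psi p) = f p.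
Proof.
move=> hf f2; set K := Fock_kernel psi p => mK K2.
have mf := holomorphic_meas hf.
have [E E0 HE] := kernel_tail_integral p.
pose dK M z := K z - kernel_sum psi p M z.
have mS M : meas (kernel_sum psi p M) /\ sqint psi (kernel_sum psi p M).
  exact: monomial_sum_meas_sqint.
have dKE M : dK M = fun z => K z + (-1) * kernel_sum psi p M z.
  by apply/funext => z; rewrite mulN1r.
have mdK M : meas (dK M).
  by rewrite dKE; apply: measD => //; apply: measZ; have [] := mS M.
have sdK M : sqint psi (dK M).
  rewrite dKE; have [m1 s1] := mS M; apply: sqintD => //; first exact: measZ.
  exact: sqintZ.
pose I g := \int[lebC]_t (normc (g (Cn_of t)) ^+ 2 * weight psi (Cn_of t)).
have IdK M : I (dK M) <= E * 2^-1 ^+ M.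
  rewrite -lee_fin /I /Rintegral fineK; first exact: HE.
  exact: (integrable_fin_num measurableT (sdK M)).
have I0 g : 0 <= I g.
  by apply: Rintegral_ge0 => // t _; rewrite mulr_ge0 ?w0 ?exprn_ge0 ?normc_ge0.
(* A weighted arithmetic-geometric mean inequality plays the part of Cauchy-Schwarz: [eta] is fixed
   first to make the [f] term small, then [M] to make the tail small. *)
have bound eta M : 0 < eta ->
    normc (Lpair psi f (dK M)) <= 2 * (eta * I f + eta^-1 * (E * 2^-1 ^+ M)).
  move=> eta0; pose q g t := normc (g (Cn_of t)) ^+ 2 * weight psi (Cn_of t).
  have if1 : lebC.-integrable setT (EFin \o (fun t => eta * q f t)).
    by have := integrableZl measurableT eta f2; apply: eq_integrable.
  have if2 : lebC.-integrable setT (EFin \o (fun t => eta^-1 * q (dK M) t)).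
    by have := integrableZl measurableT eta^-1 (sdK M); apply: eq_integrable.
  have ii : lebC.-integrable setT (EFin \o (fun t => eta * q f t + eta^-1 * q (dK M) t)).
    by have := integrableD measurableT if1 if2; apply: eq_integrable.
  have dKi := Lpair_cintegrable mpsi mf (mdK M) f2 (sdK M).
  have := normc_cint_le measurableT dKi ii; move=> /(_ _)/le_trans; apply.
    move=> t _; rewrite !normcM normc_conj normc_real ger0_norm ?w0//.
    rewrite /q !mulrA -mulrDl ler_wpM2r ?w0//.
    set a := normc _; set b := normc _.
    have -> : b = eta * (b / eta) by rewrite mulrCA divff ?gt_eqF// mulr1.
    move: (b / eta) => {}b.
    have -> : eta^-1 * (eta * b) * (eta * b) = eta * (b * b) by field; rewrite gt_eqF.
    rewrite -mulrA mulrCA -mulrDr ler_wpM2l ?(ltW eta0)//.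
    by have := sqr_ge0 (a - b); have := sqr_ge0 (a + b); rewrite !expr2; nra.
  rewrite RintegralD// ler_wpM2l// (RintegralZl _ measurableT f2)//.
  rewrite (RintegralZl _ measurableT (sdK M))//.
  by rewrite lerD2l ler_wpM2l ?invr_ge0 ?(ltW eta0) ?IdK.
have LS M : (c0%:C)%C * Lpair psi f (kernel_sum psi p M) =
    \sum_(m < M) coef (fun l => f (l *: p)) m.
  rewrite [Lpair _ _ _](Lpair_monomial_sum psi_adm (kernel_coef n psi) p M mf f2) mulr_sumr.
  apply: eq_bigr => m _; rewrite monomial_pairing//; last 2 first.
  - exact: holomorphic_continuous.
  - exact: holomorphic_slice_entire.
  have k1 := kernel_coefK psi_adm m; rewrite -/c0 in k1.
  apply: complex_eqP; rewrite ?Re_realM ?Im_realM -[RHS]mul1r -k1; ring.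
have LK M : Lpair psi f K = Lpair psi f (kernel_sum psi p M) + Lpair psi f (dK M).
  have [m1 s1] := mS M.
  rewrite -(LpairDr psi_adm mf m1 (mdK M) f2 s1 (sdK M)).
  by congr Lpair; apply/funext => z; rewrite addrC subrK.
apply/eqP; rewrite -subr_eq0 -normc_eq0; apply/negPn/negP => x0.
set x := normc _ in x0.
have {}x0 : 0 < x by rewrite lt_neqAle eq_sym x0 normc_ge0.
(* Chosen so that [2 * c0 * (eta * (I f + 1))] is [x / 4]; the [+ 1] keeps the divisor positive.
   Together with the Taylor error and the tail, the total error stays below three quarters of
   [x]. *)
pose eta := x / (8 * c0 * (I f + 1)).
have I1 : 0 < I f + 1 by have := I0 f; lra.
have eta0 : 0 < eta by apply: divr_gt0 => //; apply: mulr_gt0 => //; apply: mulr_gt0.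
have eg : entire (fun l : C => f (l *: p)).
  rewrite (_ : (fun l : C => f (l *: p)) = fun l => f (0 + l *: p)).
    exact: holomorphic_slice_entire.
  by apply/funext => l; rewrite add0r.
have x4 : 0 < x / 4 by rewrite divr_gt0.
have near1 := coef_sum_cvg eg x4; rewrite scale1r in near1.
have near2 : \forall M \near \oo, 2 * c0 * (eta^-1 * (E * 2^-1 ^+ M)) < x / 4.
  have z1 : `|2^-1 : R| < 1 by rewrite ger0_norm ?invr_ge0// invf_lt1// ltr1n.
  have /cvgrPdist_lt/(_ _ x4) := cvg_geometric (2 * c0 * (eta^-1 * E)) z1.
  apply: filterS => M; apply: le_lt_trans.
  by rewrite /geometric/= sub0r normrN !mulrA ler_norm.
have [M [h1 h2]] : exists M, normc (\sum_(m < M) coef (fun l => f (l *: p)) m - f p) < x / 4 /\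
   2 * c0 * (eta^-1 * (E * 2^-1 ^+ M)) < x / 4.
  by have [M [? ?]] := filter_ex (filterI near1 near2); exists M.
have : x < x.
  rewrite {1}/x (LK M) mulrDr LS addrAC.
  rewrite (le_lt_trans (ler_normcD _ _))// normcM normc_real ger0_norm ?(ltW c0_gt0)//.
  have := ler_wpM2l (ltW c0_gt0) (bound eta M eta0).
  have : 2 * c0 * (eta * I f) <= x / 4.
    have -> : x / 4 = 2 * c0 * (eta * (I f + 1)) by rewrite /eta; field; rewrite !gt_eqF.
    apply: ler_wpM2l; first by apply: mulr_ge0 => //; exact: ltW.
    by apply: ler_wpM2l; [exact: ltW|rewrite lerDl].
  lra.
by rewrite ltxx.
Qed.

End reproducing.

(** * The two implications *)

Section Fock_pairing.
Variables (R : realType) (n : nat) (psi : R -> R).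
Local Notation C := R[i].
Local Notation Cn := 'rV[R[i]]_n.+1.
Implicit Types (f g : Cn -> C) (p z : Cn).

Hypothesis psi_adm : admissible_weight n.+1 psi.

Let mpsi := measurable_admissible psi_adm.
Let ipsi := integrable_admissible psi_adm.

Lemma Fock_monomial p m : Fock psi (fun z => cdot z p ^+ m).
Proof.
by apply/(FockP psi_adm); split; [exact: holomorphic_monomial|exact: sqint_monomial].
Qed.

Lemma FockZ (c : C) f : Fock psi f -> Fock psi (fun z => c * f z).
Proof.
move=> /(FockP psi_adm)[hf f2]; apply/(FockP psi_adm); split; last exact: sqintZ.
by move=> z; apply: differentiableM; [exact: differentiable_cst|exact: hf].
Qed.

Lemma conj_Fock_inner f g : Fock psi f -> Fock psi g ->
  (Fock_inner psi f g)^* = Fock_inner psi g f.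
Proof.
move=> Ff Fg; rewrite !(Fock_innerE psi_adm)// rmorphM/= conj_real.
have [/holomorphic_meas mf f2] := (FockP psi_adm f).1 Ff.
have [/holomorphic_meas mg g2] := (FockP psi_adm g).1 Fg.
by rewrite conj_Lpair.
Qed.

Lemma Fock_innerZr (c : C) f g : Fock psi f -> Fock psi g ->
  Fock_inner psi f (fun z => c * g z) = c^* * Fock_inner psi f g.
Proof.
move=> Ff Fg; rewrite !(Fock_innerE psi_adm)//; last exact: FockZ.
have [/holomorphic_meas mf f2] := (FockP psi_adm f).1 Ff.
have [/holomorphic_meas mg g2] := (FockP psi_adm g).1 Fg.
by rewrite LpairZr// mulrCA.
Qed.

Lemma Fock_innerZl (c : C) f g : Fock psi f -> Fock psi g ->
  Fock_inner psi (fun z => c * f z) g = c * Fock_inner psi f g.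
Proof.
move=> Ff Fg; rewrite -conj_Fock_inner//; last exact: FockZ.
by rewrite Fock_innerZr// rmorphM/= conjCK conj_Fock_inner.
Qed.

Lemma Fock_inner_monomial f p m : Fock psi f ->
  ((kernel_coef n psi m)%:C)%C * Fock_inner psi f (fun z => cdot z p ^+ m) =
  coef (fun l => f (l *: p)) m.
Proof.
move=> Ff; rewrite (Fock_innerE psi_adm)//; last exact: Fock_monomial.
have [hf f2] := (FockP psi_adm f).1 Ff.
rewrite monomial_pairing//; last 2 first.
- exact: holomorphic_continuous.
- exact: holomorphic_slice_entire.
have k1 := kernel_coefK psi_adm m.
by apply: complex_eqP; rewrite !(Re_realM, Im_realM) -[RHS]mul1r -k1; ring.
Qed.

Lemma Fock_coef_cvg f p (eps : R) : Fock psi f -> 0 < eps ->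
  \forall N \near \oo, normc (\sum_(m < N) coef (fun l => f (l *: p)) m - f p) < eps.
Proof.
move=> [hf _] e0.
have eg : entire (fun l : C => f (l *: p)).
  rewrite (_ : (fun l : C => f (l *: p)) = fun l => f (0 + l *: p)).
    exact: holomorphic_slice_entire.
  by apply/funext => l; rewrite add0r.
by have := coef_sum_cvg eg e0; rewrite scale1r.
Qed.

Lemma Fock_inner_kernel f p : Fock psi f -> Fock psi (Fock_kernel psi p) ->
  Fock_inner psi f (Fock_kernel psi p) = f p.
Proof.
move=> Ff FK; rewrite (Fock_innerE psi_adm)//.
have [hf f2] := (FockP psi_adm f).1 Ff.
have [/holomorphic_meas mK K2] := (FockP psi_adm (Fock_kernel psi p)).1 FK.
exact: kernel_reproducing.
Qed.

Lemma Fock_inner_one f : Fock psi f ->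
  Fock_inner psi f (fun z => 1) = ((cmoment psi n)%:C)%C * f 0.
Proof.
(* The constant 1 is the monomial with [p = 0] and [m = 0], and [kernel_coef] at 0 is the inverse of
   [cmoment psi n]. *)
move=> Ff; have := Fock_inner_monomial 0 0 Ff.
rewrite coef0 ?scaler0; last first.
  by move=> z; under eq_fun do rewrite scaler0; exact: differentiable_cst.
rewrite /kernel_coef add0n binn => <-.
have c0 : cmoment psi n != 0 by rewrite gt_eqF// (cmoment_gt0 psi_adm).
by apply: complex_eqP; rewrite !(Re_realM, Im_realM) /=; field.
Qed.

Lemma kernel_of_self_adjoint (D : Cn) U : Fock psi U ->
    (forall f g, Fock psi f -> Fock psi g ->
      Fock_inner psi (fun z => U z * f D) g = Fock_inner psi f (fun z => U z * g D)) ->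
  let alpha := ((cmoment psi n)%:C)%C * (U 0)^* in
  alpha \is Num.real /\ forall z, U z = alpha * Fock_kernel psi D z.
Proof.
move=> FU SA alpha.
have F1 : Fock psi (fun _ : Cn => 1) := Fock_monomial 0 0.
have U1 : (fun z => U z * 1) = U by apply/funext => z; rewrite mulr1.
have alphaE : alpha = (Fock_inner psi U (fun=> 1))^*.
  by rewrite Fock_inner_one// rmorphM/= conj_real.
have alpha_conj : alpha^* = alpha.
  rewrite {1}alphaE conjCK alphaE conj_Fock_inner//.
  by have := SA _ _ F1 F1; rewrite U1.
split; first by rewrite CrealE alpha_conj.
move=> p.
have coefU m : coef (fun l => U (l *: p)) m =
    alpha * (((kernel_coef n psi m)%:C)%C * cdot p D ^+ m).
  have Fe := Fock_monomial p m.
  rewrite -Fock_inner_monomial// mulrCA; congr (_ * _).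
  have := SA _ _ Fe F1; rewrite U1.
  under eq_fun do rewrite mulrC.
  rewrite Fock_innerZl// => /(congr1 (fun x => x^*)).
  rewrite conj_Fock_inner// => <-.
  by rewrite rmorphM/= -alphaE rmorphXn/= conj_cdot mulrC.
have sumU N : \sum_(m < N) coef (fun l => U (l *: p)) m = alpha * kernel_sum psi D N p.
  by rewrite /kernel_sum mulr_sumr; apply: eq_bigr => m _; exact: coefU.
apply/eqP; rewrite -subr_eq0 -normc_eq0; apply/negPn/negP => x0.
set x := normc _ in x0.
have {}x0 : 0 < x by rewrite lt_neqAle eq_sym x0 normc_ge0.
have x2 : 0 < x / 2 by rewrite divr_gt0.
(* The [+ 1] allows division by this bound on [normc alpha] even when [alpha] is 0. *)
have a1 : 0 < normc alpha + 1 by rewrite ltr_wpDl// normc_ge0.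
have xa : 0 < x / 2 / (normc alpha + 1) by rewrite divr_gt0.
have [M [h1 h2]] := filter_ex (filterI (Fock_coef_cvg p FU x2)
  (kernel_sum_Fock_kernel psi_adm D p xa)).
rewrite sumU in h1.
have : x < x.
  rewrite {1}/x (_ : U p - _ = - (alpha * kernel_sum psi D M p - U p) +
    alpha * (kernel_sum psi D M p - Fock_kernel psi D p)); last by ring.
  rewrite (le_lt_trans (ler_normcD _ _))// normcN normcM.
  rewrite (splitr x) ltr_leD//.
  apply: (@le_trans _ _ ((normc alpha + 1) * (x / 2 / (normc alpha + 1)))).
    by rewrite ler_pM ?normc_ge0 ?lerDl ?ltW.
  by rewrite mulrCA divff ?mulr1// gt_eqF.
by rewrite ltxx.
Qed.

Lemma self_adjoint_of_kernel (D : Cn) U (alpha : C) : Fock psi U ->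
    alpha \is Num.real -> (forall z, U z = alpha * Fock_kernel psi D z) ->
  forall f g, Fock psi f -> Fock psi g ->
    Fock_inner psi (fun z => U z * f D) g = Fock_inner psi f (fun z => U z * g D).
Proof.
move=> FU; rewrite CrealE => /eqP alpha_conj UE.
have innerU f : Fock psi f -> Fock_inner psi f U = alpha * f D.
  (* Membership of the kernel in the Fock space is inherited from [U] by dividing by [alpha]; when
     [alpha] is 0 the claim is immediate because [U] vanishes. *)
  move=> Ff; have [a0|a0] := eqVneq alpha 0.
    have -> : U = fun z => 0 * U z by apply/funext => z; rewrite mul0r UE a0 mul0r.
    by rewrite Fock_innerZr// conjC0 a0 !mul0r.
  have KE : Fock_kernel psi D = fun z => alpha^-1 * U z.
    by apply/funext => z; rewrite UE mulKf.
  have FK : Fock psi (Fock_kernel psi D) by rewrite KE; exact: FockZ.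
  have -> : U = fun z => alpha * Fock_kernel psi D z by apply/funext.
  by rewrite Fock_innerZr// Fock_inner_kernel// alpha_conj.
move=> f g Ff Fg.
have swap h : (fun z => U z * h D) = fun z => h D * U z.
  by apply/funext => z; rewrite mulrC.
rewrite !swap.
rewrite Fock_innerZl// Fock_innerZr// -(conj_Fock_inner Fg FU) !innerU//.
by rewrite rmorphM/= alpha_conj; ring.
Qed.

End Fock_pairing.

Theorem proposition2p8 (R : realType) (n : nat) (n_ge1 : (1 <= n)%N)
    (psi : R -> R) (psi_adm : admissible_weight n psi)
    (D : 'rV[R[i]]_n) (Gamma : 'rV[R[i]]_n -> 'rV[R[i]]_n)
    (GammaD : forall z, Gamma z = D)
    (U : 'rV[R[i]]_n -> R[i]) (U_hol : holomorphic U)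
    (bndC : bounded_on_Fock psi (wcomp U Gamma)) :
  Fock_self_adjoint psi (wcomp U Gamma) <->
  let alpha : R[i] := (cmoment psi n.-1)%:C%C * (U 0)^* in
  alpha \is Num.real /\
  (forall z, U z = alpha * Fock_kernel psi (Gamma 0) z).
Proof.
case: n n_ge1 psi_adm D Gamma GammaD U U_hol bndC => // n _ psi_adm D Gamma GammaD U _ [bndC _ _].
have wE f : wcomp U Gamma f = fun z => U z * f D.
  by apply/funext => z; rewrite /wcomp GammaD.
(* [U] is the image of the constant 1, which lies in the Fock space. *)
have FU : Fock psi U.
  have := bndC _ (Fock_monomial psi_adm 0 0).
  by rewrite wE; under eq_fun do rewrite mulr1.
rewrite GammaD; split => [[_ SA]|[alpha_real UE]].
  apply: kernel_of_self_adjoint => // f g Ff Fg.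
  by have := SA f g Ff Fg; rewrite !wE.
split; first exact: bndC.
move=> f g Ff Fg; rewrite !wE.
exact: (self_adjoint_of_kernel psi_adm FU alpha_real UE).
Qed.
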